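(* Let $X$ and $Y$ be independent random variables, $X$ with cdf $F$ and $0<P\{Y>0\}\le P\{Y\ge 0\}=1$, and let $(X_i,Y_i)$, $i\ge1$, be i.i.d. copies of $(X,Y)$. Assume $E|X|<\infty$. Suppose that along a subsequence $\{n'\}$ of $\{n\}$, for norming constants $a_{n'}>0$ with $a_{n'}\to\infty$, $$\frac{1}{a_{n'}}\sum_{i=1}^{n'}Y_i\overset{\mathrm{D}}{\longrightarrow}W_2,\quad n'\to\infty,$$ where $W_2$ is a $[0,\infty)$-valued infinitely divisible random variable with $$\log Ee^{\mathrm{i}uW_2}=\mathrm{i}ub+\int_0^\infty\left(e^{\mathrm{i}ux}-1-\mathrm{i}ux I\{x\le 1\}\right)\Lambda(\mathrm{d}x)=\mathrm{i}u\alpha+\int_0^\infty\left(e^{\mathrm{i}ux}-1\right)\Lambda(\mathrm{d}x),$$ $\Lambda$ a Lévy measure on $(0,\infty)$ with $\int_0^1 s\,\Lambda(\mathrm{d}s)<\infty$, $b\in\mathbb{R}$, and necessarily $\alpha=b-\int_0^1x\,\Lambda(\mathrm{d}x)\ge 0$. Then along the same subsequence $$\left(\frac{\sum_{i=1}^{n'}X_iY_i}{a_{n'}},\frac{\sum_{i=1}^{n'}Y_i}{a_{n'}}\right)\overset{\mathrm{D}}{\longrightarrow}(W_1,W_2),\quad n'\to\infty,$$ where $(W_1,W_2)$ is infinitely divisible with characteristic function $$Ee^{\mathrm{i}(\theta_1W_1+\theta_2W_2)}=\exp\Big\{\mathrm{i}(\theta_1b_1+\theta_2b_2)+\int_0^\infty\int_{-\infty}^\infty\left(e^{\mathrm{i}(\theta_1x+\theta_2y)}-1-(\mathrm{i}\theta_1x+\mathrm{i}\theta_2y)I\{x^2+y^2\le1\}\right)F\Big(\frac{\mathrm{d}x}{y}\Big)\Lambda(\mathrm{d}y)\Big\},$$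 with $$b_1=\alpha EX+\int_{0<u^2+v^2\le1}u\,\Pi(\mathrm{d}u,\mathrm{d}v),\qquad b_2=\alpha+\int_{0<u^2+v^2\le1}v\,\Pi(\mathrm{d}u,\mathrm{d}v).$$
   Context: $\Pi$ is the Lévy measure on $(-\infty,\infty)\times(0,\infty)$ determined by $$\Pi\left((a,b]\times(c,d]\right)=\int_{(c,d]}\left(F(b/s)-F(a/s)\right)\Lambda(\mathrm{d}s),\qquad -\infty<a<b<\infty,\ 0<c<d<\infty,$$ i.e. $\Pi(\mathrm{d}u,\mathrm{d}v)=F(\mathrm{d}u/v)\Lambda(\mathrm{d}v)$, the image of the product measure $F(\mathrm{d}x)\otimes\Lambda(\mathrm{d}s)$ under $(x,s)\mapsto(xs,s)$. Here $F(\mathrm{d}x/y)$ denotes, for fixed $y>0$, the law of $yX$. The limit law is thus the bivariate infinitely divisible law with no Gaussian part, Lévy measure $\Pi$, and drift vector $(b_1,b_2)$ relative to truncation at the Euclidean unit ball. *)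

(* Defs.v *)
From HB Require Import structures.
From mathcomp Require Import all_boot all_order all_algebra.
From mathcomp Require Import all_classical all_reals all_analysis measurable_realfun.
From mathcomp Require Import complex.

Set Implicit Arguments.
Unset Strict Implicit.
Unset Printing Implicit Defensive.

Import Order.TTheory GRing.Theory Num.Theory.
Import numFieldNormedType.Exports.

Local Open Scope classical_set_scope.
Local Open Scope complex_scope.
Local Open Scope ring_scope.

(* Equality of laws is asserted on measurable sets only: measures are total
   functions on all sets, with unconstrained values off the sigma-algebra. *)
Definition same_law (R : realType) (d1 d2 d : measure_display)
    (S : measurableType d1) (T : measurableType d2) (E : measurableType d)
    (P : probability S R) (Q : probability T R) (X : S -> E) (Y : T -> E) : Prop :=
  forall B : set E, measurable B -> P (X @^-1` B) = Q (Y @^-1` B).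

Definition independent (R : realType) (d d1 d2 : measure_display)
    (T : measurableType d) (E1 : measurableType d1) (E2 : measurableType d2)
    (P : probability T R) (X : T -> E1) (Y : T -> E2) : Prop :=
  forall (A : set E1) (B : set E2), measurable A -> measurable B ->
    P (X @^-1` A `&` Y @^-1` B) = (P (X @^-1` A) * P (Y @^-1` B))%E.

Definition mutually_independent (R : realType) (d d' : measure_display)
    (T : measurableType d) (E : measurableType d') (I : eqType)
    (P : probability T R) (Z : I -> T -> E) : Prop :=
  forall (J : seq I) (B : I -> set E), uniq J ->
    (forall i, measurable (B i)) ->
    P (\bigcap_(i in [set` J]) Z i @^-1` B i) =
    (\prod_(i <- J) P (Z i @^-1` B i))%E.

Definition cvg_in_distribution (R : realType) (d d' : measure_display)
    (T : measurableType d) (T' : measurableType d') (E : topologicalType)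
    (P : probability T R) (Q : probability T' R)
    (Z : nat -> T -> E) (W : T' -> E) : Prop :=
  forall f : E -> R, continuous f -> bounded_fun f ->
    'E_P[f \o Z n]%E @[n --> \oo] --> 'E_Q[f \o W]%E.

Definition infinitely_divisible (R : realType) (d : measure_display)
    (T : measurableType d) (P : probability T R) (W : T -> R) : Prop :=
  forall n : nat, (0 < n)%N ->
    exists (d' : measure_display) (S : measurableType d') (Q : probability S R)
           (Z : 'I_n -> {RV Q >-> R}),
      [/\ mutually_independent Q (fun i => Z i : S -> R),
          forall i j, same_law Q Q (Z i) (Z j)
        & same_law P Q W (fun w => \sum_(i < n) Z i w)].

Definition infinitely_divisible2 (R : realType) (d : measure_display)
    (T : measurableType d) (P : probability T R) (W1 W2 : T -> R) : Prop :=
  forall n : nat, (0 < n)%N ->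
    exists (d' : measure_display) (S : measurableType d') (Q : probability S R)
           (U V : 'I_n -> {RV Q >-> R}),
      [/\ mutually_independent Q (fun i w => (U i w, V i w)),
          forall i j, same_law Q Q (fun w => (U i w, V i w))
                                   (fun w => (U j w, V j w))
        & same_law P Q (fun w => (W1 w, W2 w))
            (fun w => (\sum_(i < n) U i w, \sum_(i < n) V i w))].

Definition cexp (R : realType) (z : R[i]) : R[i] :=
  (expR (complex.Re z))%:C * (cos (complex.Im z) +i* sin (complex.Im z)).

Definition cintegral (R : realType) (d : measure_display)
    (T : measurableType d) (mu : {measure set T -> \bar R}) (D : set T)
    (f : T -> R[i]) : R[i] :=
  (\int[mu]_(x in D) complex.Re (f x)) +i* (\int[mu]_(x in D) complex.Im (f x)).

Definition char_fun (R : realType) (d : measure_display)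
    (T : measurableType d) (P : probability T R) (W : T -> R) (u : R) : R[i] :=
  cintegral P setT (fun w => cexp ('i%C * (u * W w)%:C)).

Definition char_fun2 (R : realType) (d : measure_display)
    (T : measurableType d) (P : probability T R) (W1 W2 : T -> R)
    (t1 t2 : R) : R[i] :=
  cintegral P setT (fun w => cexp ('i%C * (t1 * W1 w + t2 * W2 w)%:C)).

(* A measure on (0, oo) is represented as a measure on R that does not charge
   ]-oo, 0]. *)
Definition levy_measure_pos (R : realType) (L : {measure set R -> \bar R}) : Prop :=
  L `]-oo, 0]%classic = 0%E /\
  (\int[L]_(x in `]0%R, +oo[) (Num.min 1 (x ^+ 2))%:E < +oo)%E.

Definition levy_measure2 (R : realType) (Pi : {measure set (R * R) -> \bar R}) : Prop :=
  Pi [set (0, 0)] = 0%E /\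
  (\int[Pi]_z (Num.min 1 (z.1 ^+ 2 + z.2 ^+ 2))%:E < +oo)%E.

Definition levy_exponent (R : realType) (b : R) (L : {measure set R -> \bar R})
    (u : R) : R[i] :=
  'i%C * (u * b)%:C +
  cintegral L `]0, +oo[
    (fun x => cexp ('i%C * (u * x)%:C) - 1 - 'i%C * (u * x * (x <= 1)%R%:R)%:C).

(* The half-plane 0 < y is where the jump measures below are concentrated. *)
Definition levy_exponent2 (R : realType) (b1 b2 : R)
    (Pi : {measure set (R * R) -> \bar R}) (t1 t2 : R) : R[i] :=
  'i%C * (t1 * b1 + t2 * b2)%:C +
  cintegral Pi [set z : R * R | 0 < z.2]
    (fun z => cexp ('i%C * (t1 * z.1 + t2 * z.2)%:C) - 1
              - 'i%C * ((t1 * z.1 + t2 * z.2)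
                      * (z.1 ^+ 2 + z.2 ^+ 2 <= 1)%R%:R)%:C).

(* F(du/v) L(dv): the image of the product of F and L under
   (x, s) |-> (x s, s), where \x^ integrates over the second factor last, so
   that L may be an arbitrary measure. *)
Definition product_jump_measure (R : realType) (F : probability R R)
    (L : {measure set R -> \bar R}) : set (R * R) -> \bar R :=
  pushforward (F \x^ L)%E (fun p : R * R => (p.1 * p.2, p.2)).

Section product_jump_measure_is_measure.
Context (R : realType) (F : probability R R) (L : {measure set R -> \bar R}).

Let map (p : R * R) : R * R := (p.1 * p.2, p.2).

Let measurable_map : measurable_fun setT map.
Proof.
apply: measurable_fun_pair; last exact: measurable_snd.
by apply: measurable_funM; [exact: measurable_fst|exact: measurable_snd].
Qed.

HB.instance Definition _ := isMeasurableFun.Build _ _ _ _ map measurable_map.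

Let jump0 : product_jump_measure F L set0 = 0%E.
Proof. exact: (measure0 (pushforward (F \x^ L)%E map)). Qed.

Let jump_ge0 A : (0 <= product_jump_measure F L A)%E.
Proof. exact: (measure_ge0 (pushforward (F \x^ L)%E map)). Qed.

Let jump_sigma_additive : semi_sigma_additive (product_jump_measure F L).
Proof.
exact: (@measure_semi_sigma_additive _ _ _ (pushforward (F \x^ L)%E map)).
Qed.

HB.instance Definition _ := isMeasure.Build _ _ _ (product_jump_measure F L)
  jump0 jump_ge0 jump_sigma_additive.

End product_jump_measure_is_measure.

Definition punctured_disk (R : realType) : set (R * R) :=
  [set z : R * R | 0 < z.1 ^+ 2 + z.2 ^+ 2 <= 1].
Arguments punctured_disk : clear implicits.

(* Main.v *)
(** Put w(y) = y / (1 + y) and L_k f = n_k E[f(Y / a_k) w(Y / a_k)]. The Laplace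
    transforms of the sums of the Y_i bound L_k and its tails, so along every
    ultrafilter L_k f tends, for bounded continuous f, to the integral of f
    against a finite measure on [0, oo[. Comparing moduli of characteristic
    functions identifies this measure off 0 as w Lambda, and comparing phases
    shows that its mass at 0 is alpha. Since E|X| < oo, the function
    y |-> (E exp(i (t1 X + t2) y) - 1) / w(y) is bounded and continuous on
    [0, oo[; integrating it gives the limit psi of n_k (phi_k - 1), where phi_k is
    the characteristic function of one summand. Hence the pairs of sums of
    n_k %/ m summands have characteristic functions tending to exp (psi / m), and
    they are tight. A Helly theorem along ultrafilters, reduced from the plane to
    the line by a space-filling curve, provides limits in law on [0, 1[, which
    Fourier uniqueness shows to be independent of the ultrafilter and, for m = 1,
    infinitely divisible. Fubini's theorem turns psi into the exponent of Pi. *)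
Require Import Defs.
From HB Require Import structures.
From mathcomp Require Import all_boot all_order all_algebra.
From mathcomp Require Import all_classical all_reals all_analysis.
From mathcomp Require Import measurable_realfun.
From mathcomp Require Import complex.
From mathcomp Require Import ring lra.

Set Implicit Arguments.
Unset Strict Implicit.
Unset Printing Implicit Defensive.

Import Order.TTheory GRing.Theory Num.Theory.
Import numFieldNormedType.Exports.

Local Open Scope classical_set_scope.
Local Open Scope ring_scope.

Import HBNNSimple.

(** * Functional monotone class theorem for bounded measurable functions *)

Section bounded_measurable.
Context (R : realType) (d : measure_display) (Z : measurableType d).
Implicit Types (f g : Z -> R) (A B : set Z).

(** The weight w is comparable with min (1, y), which is Lambda-integrable once s is integrable near
    0. Weighting by w turns the drift into an atom at 0, so alpha and Lambda are treated together as
    one finite measure. The obstacle is that exponents are known only through their exponentials. No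
    logarithm is taken: an identity modulo 2 pi that holds for every frequency pins down the single
    unknown number. Integrability of X has a second role besides the quotient: Y may have infinite
    mean, and the sums of X_i Y_i are tight because the truncation min (1, |s| / m) is subadditive
    and costs only E|X| / m when |X| exceeds m. Measures are kept as functionals on bounded
    functions, so uniqueness becomes a closure property of a class of functions, and limit measures
    appear as images of Lebesgue measure under quantile maps. Ultrafilters take the place of
    subsequence extraction: every bounded sequence of reals converges at once. Blocks of n_k %/ m
    summands have laws whose limits are m-th roots, so divisibility is read off the array itself. *)

Definition bmeas f := measurable_fun setT f /\ exists M : R, forall z, `|f z| <= M.

Lemma bmeas_cst (c : R) : bmeas (fun=> c).
Proof. by split; [exact: measurable_cst|exists `|c|]. Qed.

Lemma bmeasD f g : bmeas f -> bmeas g -> bmeas (fun z => f z + g z).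
Proof.
move=> [mf [M fM]] [mg [N gN]]; split; first exact: measurable_funD.
by exists (M + N) => z; rewrite (le_trans (ler_normD _ _))// lerD.
Qed.

Lemma bmeasM f g : bmeas f -> bmeas g -> bmeas (fun z => f z * g z).
Proof.
move=> [mf [M fM]] [mg [N gN]]; split; first exact: measurable_funM.
by exists (M * N) => z; rewrite normrM ler_pM.
Qed.

Lemma bmeasZ (c : R) f : bmeas f -> bmeas (fun z => c * f z).
Proof. exact: bmeasM (bmeas_cst c). Qed.

Lemma bmeasN f : bmeas f -> bmeas (fun z => - f z).
Proof.
move=> /(bmeasZ (-1)); congr bmeas; apply/funext => z; exact: mulN1r.
Qed.

Lemma bmeasB f g : bmeas f -> bmeas g -> bmeas (fun z => f z - g z).
Proof. by move=> bf /bmeasN; exact: bmeasD. Qed.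

Lemma bmeas_sum (I : Type) (r : seq I) (F : I -> Z -> R) :
  (forall i, bmeas (F i)) -> bmeas (fun z => \sum_(i <- r) F i z).
Proof.
move=> bF; elim: r => [|i r ih].
  by under eq_fun do rewrite big_nil; exact: bmeas_cst.
by under eq_fun do rewrite big_cons; exact: bmeasD.
Qed.

Lemma bmeas_indic A : measurable A -> bmeas (\1_A : Z -> R).
Proof.
move=> mA; split; first exact: measurable_indic.
by exists 1 => z; rewrite indicE; case: (_ \in _); rewrite /= ?normr1 ?normr0.
Qed.

Lemma bmeas_lim (f_ : nat -> Z -> R) f (M : R) : (forall n, bmeas (f_ n)) ->
  (forall n z, `|f_ n z| <= M) -> (forall z, f_ ^~ z @ \oo --> f z) -> bmeas f.
Proof.
move=> bf fM ff; split.
  by apply: (measurable_fun_cvg (h := f_)) => [n|z _]; [case: (bf n)|exact: ff].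
exists M => z; apply: (@closed_cvg _ _ \oo _ (fun n => `|f_ n z|) [set x | x <= M]).
- exact: closed_le.
- by apply: nearW => n; exact: fM.
- by apply: cvg_norm; exact: ff.
Qed.

(** A finite signed measure kept as a functional: bounded convergence plays the part of countable
    additivity. *)
Record bint (L : (Z -> R) -> R) : Prop := Bint {
  bintD : forall f g, bmeas f -> bmeas g -> L (fun z => f z + g z) = L f + L g;
  bintZ : forall c f, bmeas f -> L (fun z => c * f z) = c * L f;
  bint_lim : forall (f_ : nat -> Z -> R) f (M : R), (forall n, bmeas (f_ n)) ->
    (forall n z, `|f_ n z| <= M) -> (forall z, f_ ^~ z @ \oo --> f z) ->
    L \o f_ @ \oo --> L f }.

(** Only linear combinations and bounded pointwise limits are constructors, the operations along
    which an equality of two [bint] functionals propagates. Stability under products is derived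
    below from [KM]. *)
Inductive mclass (K : (Z -> R) -> Prop) : (Z -> R) -> Prop :=
| mclass_base f of K f : mclass K f
| mclassD f g of mclass K f & mclass K g : mclass K (fun z => f z + g z)
| mclassZ c f of mclass K f : mclass K (fun z => c * f z)
| mclass_lim (f_ : nat -> Z -> R) f (M : R) of (forall n, mclass K (f_ n)) &
    (forall n z, `|f_ n z| <= M) & (forall z, f_ ^~ z @ \oo --> f z) : mclass K f.

Lemma mclass_bmeas (K : (Z -> R) -> Prop) f :
  (forall f, K f -> bmeas f) -> mclass K f -> bmeas f.
Proof.
move=> bK; elim=> [||c|f_]; [exact: bK| | |].
- by move=> ? ? _ ? _; exact: bmeasD.
- by move=> ? _; exact: bmeasZ.
- by move=> g M _ ? fM ff; exact: bmeas_lim fM ff.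
Qed.

Lemma mclass_eq (K : (Z -> R) -> Prop) (L1 L2 : (Z -> R) -> R) f :
  (forall f, K f -> bmeas f) -> bint L1 -> bint L2 ->
  (forall f, K f -> L1 f = L2 f) -> mclass K f -> L1 f = L2 f.
Proof.
move=> bK b1 b2 K12; elim=> [||c|f_]; [exact: K12| | |].
- move=> g h mg e mh e'; have := mclass_bmeas bK mg.
  by have := mclass_bmeas bK mh => bh bg; rewrite !bintD// e e'.
- by move=> g mg e; have := mclass_bmeas bK mg => bg; rewrite !bintZ// e.
- move=> g M mf e fM ff; have bf n := mclass_bmeas bK (mf n).
  apply: (@cvg_unique _ (@Rhausdorff R) (L1 \o f_ @ \oo)); first exact: bint_lim fM ff.
  have -> : L1 \o f_ = L2 \o f_ by apply/funext => n /=.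
  exact: bint_lim fM ff.
Qed.

Section algebra.
Context (K : (Z -> R) -> Prop).
Hypothesis bK : forall f, K f -> bmeas f.
Hypothesis K1 : K (fun=> 1).
Hypothesis KM : forall f g, K f -> K g -> mclass K (fun z => f z * g z).

Lemma mclass_cst c : mclass K (fun=> c).
Proof.
have := mclassZ c (mclass_base K1); congr mclass.
by apply/funext => z; rewrite mulr1.
Qed.

Lemma mclassN f : mclass K f -> mclass K (fun z => - f z).
Proof.
move=> /(mclassZ (-1)); congr mclass; apply/funext => z; exact: mulN1r.
Qed.

Lemma mclassB f g : mclass K f -> mclass K g -> mclass K (fun z => f z - g z).
Proof. by move=> mf /mclassN; exact: mclassD. Qed.

Let mclassMK f g : K f -> mclass K g -> mclass K (fun z => f z * g z).
Proof.
move=> Kf; have [_ [N fN]] := bK Kf.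
elim=> [h Kh|h k _ mh _ mk|c h _ mh|f_ h M _ mf fM ff].
- exact: KM.
- by have := mclassD mh mk; congr mclass; apply/funext => z; rewrite mulrDr.
- by have := mclassZ c mh; congr mclass; apply/funext => z; rewrite mulrCA.
- apply: (mclass_lim (f_ := fun n z => f z * f_ n z) (M := N * M)) => //.
    by move=> n z; rewrite normrM ler_pM.
  by move=> z; apply: cvgMr; exact: ff.
Qed.

Lemma mclassM f g : mclass K f -> mclass K g -> mclass K (fun z => f z * g z).
Proof.
move=> + mg; have [_ [N gN]] := mclass_bmeas bK mg.
elim=> [h Kh|h k _ mh _ mk|c h _ mh|f_ h M _ mf fM ff].
- exact: mclassMK.
- by have := mclassD mh mk; congr mclass; apply/funext => z; rewrite mulrDl.
- by have := mclassZ c mh; congr mclass; apply/funext => z; rewrite mulrA.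
- apply: (mclass_lim (f_ := fun n z => f_ n z * g z) (M := M * N)) => //.
    by move=> n z; rewrite normrM ler_pM.
  by move=> z; apply: cvgMl; exact: ff.
Qed.

Lemma mclassX f n : mclass K f -> mclass K (fun z => f z ^+ n).
Proof.
move=> mf; elim: n => [|n ih].
  by under eq_fun do rewrite expr0; exact: mclass_cst.
by under eq_fun do rewrite exprS; exact: mclassM.
Qed.

Lemma mclass_exp f : mclass K f -> mclass K (fun z => expR (f z)).
Proof.
move=> mf; have [_ [M fM]] := mclass_bmeas bK mf.
apply: (mclass_lim (f_ := fun n z => series (exp_coeff (f z)) n) (M := expR M)).
- elim=> [|n ih].
    by under eq_fun do rewrite /series/= big_geq//; exact: mclass_cst.
  under eq_fun do rewrite seriesSr.
  apply: mclassD => //; rewrite /exp_coeff /=.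
  under eq_fun do rewrite mulrC.
  by apply: mclassZ; exact: mclassX.
- move=> n z; apply: (@le_trans _ _ (series (exp_coeff `|f z|) n)).
    rewrite -normed_series_exp_coeff /series /= (le_trans (ler_norm_sum _ _ _))//.
  rewrite /expR (le_trans _ (nondecreasing_cvgn_le _ (is_cvg_series_exp_coeff M) n))//.
    rewrite /series /= ler_sum// => i _; rewrite /exp_coeff/= ler_wpM2r//.
    by rewrite lerXn2r ?nnegrE// (le_trans (normr_ge0 (f z))).
  apply/nondecreasing_seqP => k; rewrite seriesSr lerDl /exp_coeff /= divr_ge0//.
  by rewrite exprn_ge0// (le_trans (normr_ge0 (f z))).
- by move=> z; exact: is_cvg_series_exp_coeff.
Qed.

(* exp (- l exp (- l^2 (x - c))) tends to the indicator of x > c. *)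
Let step (l x : R) := expR (- l * expR (- l ^+ 2 * x)).

Let step_le1 (l x : R) : 0 <= l -> `|step l x| <= 1.
Proof.
by move=> l0; rewrite ger0_norm ?expR_ge0// -expR0 ler_expR mulNr oppr_le0 mulr_ge0// expR_ge0.
Qed.

Let step_cvg x : step n%:R x @[n --> \oo] --> ((0 < x)%R%:R : R).
Proof.
have [x0|x0] := ltP 0 x => /=.
  (* From 1 - exp (- u) <= u and exp (- n^2 x) <= 1 / (n^2 x). At n = 0 the inverse is 0 by
     convention and both sides vanish. *)
  have H (n : nat) : 1 - step n%:R x <= (x * n%:R)^-1.
    case: n => [|n].
      by rewrite /step mulr0 invr0 oppr0 mul0r expR0 subrr.
    rewrite lerBlDr -lerBlDl /step.
    apply: (le_trans _ (expR_ge1Dx _)).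
    rewrite lerD2l mulNr lerN2 mulNr expRN.
    rewrite ler_pdivrMr ?expR_gt0//.
    apply: (@le_trans _ _ ((x * n.+1%:R)^-1 * (n.+1%:R ^+ 2 * x))).
      suff -> : (x * n.+1%:R)^-1 * (n.+1%:R ^+ 2 * x) = n.+1%:R by [].
      have m0 : (n.+1%:R : R) != 0 by rewrite pnatr_eq0.
      have xm0 : x * n.+1%:R != 0 by rewrite mulf_neq0// gt_eqF.
      by apply: (mulfI xm0); rewrite mulrA divff// mul1r; ring.
    by rewrite ler_wpM2l ?invr_ge0 ?mulr_ge0 ?(ltW x0)//; apply: le_trans (expR_ge1Dx _); rewrite lerDr.
  have H2 (n : nat) : step n%:R x <= 1.
    by apply: le_trans (step_le1 x (ler0n _ n)); exact: ler_norm.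
  apply/cvgrPdist_le => e e0; near=> n.
  rewrite ger0_norm ?subr_ge0// (le_trans (H n))//.
  rewrite invf_ple ?posrE//; last by rewrite mulr_gt0// ltr0n; near: n; exact: nbhs_infty_gt.
  by rewrite mulrC -ler_pdivrMr//; near: n; exact: nbhs_infty_ger.
apply/cvgrPdist_le => e e0; near=> n.
rewrite sub0r normrN ger0_norm ?expR_ge0// /step mulNr expRN.
rewrite invf_ple ?posrE ?expR_gt0//.
apply: (@le_trans _ _ n%:R); first by near: n; exact: nbhs_infty_ger.
apply: (@le_trans _ _ (1 + n%:R * expR (- n%:R ^+ 2 * x))); last exact: expR_ge1Dx.
rewrite (@le_trans _ _ (1 + n%:R))// ?lerDr//.
rewrite lerD2l ler_peMr// -expR0 ler_expR mulNr -mulrN mulr_ge0 ?exprn_ge0 ?oppr_ge0//.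
Unshelve. all: by end_near. Qed.

(** The limit g may be unbounded, hence outside the class. Composing with [step] restores a bound,
    so the limit in n is taken at fixed l, and l goes to infinity afterwards. *)
Lemma mclass_gt (g_ : nat -> Z -> R) g c : (forall n, mclass K (g_ n)) ->
  (forall z, g_ ^~ z @ \oo --> g z) -> mclass K (\1_[set z | c < g z] : Z -> R).
Proof.
move=> mg gg.
apply: (mclass_lim (f_ := fun l z => step l%:R (g z - c)) (M := 1)).
- move=> l.
  apply: (mclass_lim (f_ := fun n z => step l%:R (g_ n z - c)) (M := 1)).
  + move=> n; rewrite /step; apply: mclass_exp; apply: mclassZ; apply: mclass_exp.
    apply: mclassZ; apply: mclassB => //; exact: mclass_cst.
  + by move=> n z; exact: step_le1.
  + move=> z; rewrite /step; apply: continuous_cvg; first exact: continuous_expR.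
    apply: cvgMr; apply: continuous_cvg; first exact: continuous_expR.
    by apply: cvgMr; apply: cvgB => //; exact: cvg_cst.
- by move=> n z; exact: step_le1.
- move=> z; rewrite indicE; have := @step_cvg (g z - c).
  suff -> : (z \in [set z | c < g z]) = (0 < g z - c) by [].
  by rewrite subr_gt0; apply/idP/idP; rewrite inE.
Qed.

(** Complements come from 1 - f and finite intersections from products; a countable union is the
    bounded limit of its finite unions. *)
Lemma mclass_sigma : sigma_algebra setT [set A | mclass K (\1_A : Z -> R)].
Proof.
have CK A : mclass K (\1_A : Z -> R) -> mclass K (\1_(setT `\` A) : Z -> R).
  move=> mA; have := mclassB (mclass_cst 1) mA; congr mclass.
  apply/funext => z; rewrite setTD !indicE in_setC; case: (_ \in _) => /=; last exact: subr0.
  exact: subrr.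
split => /=.
- have := mclass_cst 0; congr mclass; apply/funext => z.
  by rewrite indicE in_set0.
- exact: CK.
- move=> F mF.
  have mU n : mclass K (\1_(\big[setU/set0]_(i < n) F i) : Z -> R).
    elim: n => [|n ih].
      rewrite big_ord0; have := mclass_cst 0; congr mclass; apply/funext => z.
      by rewrite indicE in_set0.
    rewrite big_ord_recr /= -[X in \1_X]setCK setCU -setTD; apply: (CK).
    have := mclassM (CK _ ih) (CK _ (mF n)); rewrite !setTD; congr mclass; apply/funext => z.
    by rewrite !indicE in_setI -natrM mulnb.
  apply: (mclass_lim mU (M := 1)).
    by move=> n z; rewrite indicE; case: (_ \in _); rewrite /= ?normr1 ?normr0.
  move=> z; have [[i _ Fi]|nF] := pselect ((\bigcup_k F k) z).
    rewrite indicE mem_set; last by exists i.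
    apply: cvg_near_cst; exists i.+1 => //= n ni.
    by rewrite -bigcup_mkord indicE mem_set//=; exists i.
  rewrite indicE memNset//; apply: cvg_near_cst; apply: nearW => n.
  rewrite -bigcup_mkord indicE memNset//= => -[i _ Fi].
  by apply: nF; exists i.
Qed.

Lemma mclass_preimage (g_ : nat -> Z -> R) g (A : set R) :
  (forall n, mclass K (g_ n)) -> (forall z, g_ ^~ z @ \oo --> g z) ->
  measurable A -> mclass K (\1_(g @^-1` A) : Z -> R).
Proof.
move=> mg gg mA.
have : (RGenOInfty.G (R:=R)).-sigma.-measurable A by rewrite -RGenOInfty.measurableE.
apply: (@smallest_sub _ _ _ [set A | mclass K (\1_(g @^-1` A) : Z -> R)]).
  have [s0 sC sU] := mclass_sigma; split => /=.
  - by rewrite preimage_set0.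
  - by move=> B /sC /=; rewrite !setTD preimage_setC.
  - by move=> F /sU; rewrite preimage_bigcup.
move=> _ [c ->] /=; have := mclass_gt c mg gg; congr (mclass K (\1_ _)).
by apply/seteqP; split => z /=; rewrite in_itv /= andbT.
Qed.

End algebra.

(** Simple functions increase to a nonnegative f and stay below its bound M, so bounded limits
    suffice; a signed f is shifted by M first. *)
Lemma bmeas_ind (P : (Z -> R) -> Prop) :
  (forall A, measurable A -> P (\1_A : Z -> R)) ->
  (forall f g, P f -> P g -> P (fun z => f z + g z)) ->
  (forall c f, P f -> P (fun z => c * f z)) ->
  (forall (f_ : nat -> Z -> R) f (M : R), (forall n, bmeas (f_ n)) -> (forall n, P (f_ n)) ->
    (forall n z, `|f_ n z| <= M) -> (forall z, f_ ^~ z @ \oo --> f z) -> P f) ->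
  forall f, bmeas f -> P f.
Proof.
move=> PI PD PZ PL.
have Pc c : P (fun=> c).
  have := PZ c _ (PI _ measurableT); congr P; apply/funext => z.
  by rewrite indicE in_setT mulr1.
have Pge0 f : bmeas f -> (forall z, 0 <= f z) -> P f.
  move=> [mf [M fM]] f0.
  have mef : measurable_fun setT (EFin \o f) by exact/measurable_EFinP.
  have [|g [ndg gf]] := approximation measurableT mef.
    by move=> z _; rewrite lee_fin.
  have gff z : (fun n => g n z) @ \oo --> f z.
    by apply: (@fine_cvg _ _ _ _ (fun n => (g n z)%:E)); exact: gf.
  have gM n z : `|g n z| <= M.
    rewrite ger0_norm//; apply: le_trans (fM z); rewrite ger0_norm//.
    rewrite -(cvg_lim (@Rhausdorff R) (gff z)).
    apply: (@nondecreasing_cvgn_le R (fun n => g n z)); last by apply/cvg_ex; exists (f z).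
    by move=> i j ij; have /lefP := ndg _ _ ij; exact.
  apply: (PL (fun n => g n : Z -> R) _ M) => //.
    by move=> n; split; [exact: measurable_funPT|exists M].
  move=> n.
  have -> : (g n : Z -> R) = fun x => \sum_(y <- finmap.enum_fset (fset_set (range (g n)))) y * \1_(g n @^-1` [set y]) x.
    by apply/funext => z; rewrite fimfunE fsbig_finite//; exact: fimfunP.
  elim: (finmap.enum_fset _) => [|y r ih].
    by under eq_fun do rewrite big_nil.
  under eq_fun do rewrite big_cons.
  by apply: PD => //; apply: PZ; exact: PI.
move=> f bf; have [mf [M fM]] := bf.
have -> : f = fun z => (f z + M) + - M by apply/funext => z; rewrite addrK.
apply: PD => //; apply: Pge0; first by apply: bmeasD => //; exact: bmeas_cst.
by move=> z; have := fM z; rewrite ler_norml -lerBlDr sub0r => /andP[].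
Qed.

Lemma bint_eq (L1 L2 : (Z -> R) -> R) : bint L1 -> bint L2 ->
  (forall A, measurable A -> L1 (\1_A) = L2 (\1_A)) ->
  forall f, bmeas f -> L1 f = L2 f.
Proof.
move=> b1 b2 L12 f bf.
suff [] : bmeas f /\ L1 f = L2 f by [].
move: f bf; apply: bmeas_ind => [A mA|f g [bf ef] [bg eg]|c f [bf ef]|f_ f M _ ef fM ff].
- by split; [exact: bmeas_indic|exact: L12].
- by split; [exact: bmeasD|rewrite !bintD// ef eg].
- by split; [exact: bmeasZ|rewrite !bintZ// ef].
- have bf n := proj1 (ef n).
  split; first exact: bmeas_lim fM ff.
  apply: (@cvg_unique _ (@Rhausdorff R) (L1 \o f_ @ \oo)); first exact: bint_lim fM ff.
  have -> : L1 \o f_ = L2 \o f_ by apply/funext => n /=; case: (ef n).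
  exact: bint_lim fM ff.
Qed.

End bounded_measurable.

(** * Integrals with an integrable density as functionals *)

Section integrals.
Context (R : realType) (d : measure_display) (Z : measurableType d).
Context (dT : measure_display) (T : measurableType dT).
Context (mu : {measure set T -> \bar R}) (D : set T) (v : T -> Z) (k : T -> R).
Hypotheses (mD : measurable D) (mv : measurable_fun D v).
Hypothesis ik : mu.-integrable D (EFin \o k).

Let mk : measurable_fun D k.
Proof. by apply/measurable_EFinP; case/integrableP: ik. Qed.

Lemma integrable_bmeasM (f : Z -> R) : bmeas f ->
  mu.-integrable D (EFin \o (fun x => f (v x) * k x)).
Proof.
move=> [mf [M fM]].
apply: (le_integrable mD (g := fun x => M%:E * (EFin \o k) x)%E) => //.
- apply/measurable_EFinP; apply: measurable_funM => //.
  exact: measurableT_comp.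
- move=> x Dx; rewrite /= !lee_fin !normrM ler_wpM2r//.
  by rewrite (le_trans (fM (v x)))// ler_norm.
- exact: integrableZl.
Qed.

(** Dominated convergence with dominating function M |k|. The density k lets an infinite measure,
    such as a Lévy measure, define a [bint]. *)
Lemma bint_Rintegral : bint (fun f : Z -> R => \int[mu]_(x in D) (f (v x) * k x)).
Proof.
split.
- move=> f g bf bg; rewrite -RintegralD//; [|exact: integrable_bmeasM..].
  by apply: eq_Rintegral => x _; rewrite mulrDl.
- move=> c f bf; rewrite -RintegralZl//; last exact: integrable_bmeasM.
  by apply: eq_Rintegral => x _; rewrite mulrA.
- move=> f_ f M bf fM ff; rewrite /Rintegral /=.
  apply: fine_cvg; rewrite fineK; last first.
    apply: integrable_fin_num => //; apply: integrable_bmeasM; exact: bmeas_lim fM ff.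
  apply: (dominated_cvg mD (g := fun x => `|M%:E * (EFin \o k) x|%E)) => //=.
  + by move=> n; have /integrableP[] := integrable_bmeasM (bf n).
  + move=> x Dx; apply: cvg_EFin; first exact: nearW.
    by apply: cvgMl; exact: ff.
  + apply: (integrable_norm (f := fun x => M * k x)).
    by apply: (eq_integrable mD _ _ _ (integrableZl mD M ik)) => x _.
  + move=> n x Dx; rewrite !lee_fin !normrM ler_wpM2r//.
    by rewrite (le_trans (fM n (v x)))// ler_norm.
Qed.

End integrals.

(** * Elementary inequalities for sine and cosine *)

Section trigonometry.
Context {R : realType}.
Implicit Types u x : R.

Lemma sin_mean u : exists2 c : R, `|c| <= `|u| & sin u = u * cos c.
Proof.
wlog u0 : u / 0 <= u.
  move=> H; have [|u0] := leP 0 u; first exact: H.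
  have [c cu e] := H (- u) (etrans (oppr_ge0 u) (ltW u0)).
  exists c; first by rewrite -(normrN u).
  by apply: oppr_inj; rewrite -sinN e mulNr.
have [|c] := @MVT_segment R sin cos 0 u u0.
  by apply: continuous_subspaceT => x; exact: continuous_sin.
rewrite in_itv /= sin0 !subr0 => /andP[c0 cu] e; exists c; last by rewrite e mulrC.
by rewrite !ger0_norm.
Qed.

Lemma abs_sin_le u : `|sin u| <= `|u|.
Proof.
by have [c _ ->] := sin_mean u; rewrite normrM ler_piMr// cos_max.
Qed.

Lemma oneBcosE u : 1 - cos u = 2 * sin (u / 2) ^+ 2.
Proof.
rewrite {1}(_ : u = (u / 2) *+ 2); last by rewrite -mulr_natr divfK.
by rewrite cos_mulr2n -[cos _ ^+ 2](addrK (sin (u / 2) ^+ 2)) cos2Dsin2; ring.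
Qed.

Lemma oneBcos_ge0 u : 0 <= 1 - cos u.
Proof. by rewrite subr_ge0 cos_le1. Qed.

Lemma oneBcos_le2 u : 1 - cos u <= 2.
Proof. by have := cos_geN1 u; lra. Qed.

Lemma oneBcos_sqr u : 1 - cos u <= u ^+ 2 / 2.
Proof.
rewrite oneBcosE; have := abs_sin_le (u / 2).
by rewrite -(ler_pXn2r (ltn0Sn 1))//; rewrite ?nnegrE// -!normrX !ger0_norm ?sqr_ge0//; lra.
Qed.

Lemma oneBcos_abs u : 1 - cos u <= `|u|.
Proof.
have h2 := oneBcos_le2 u; have h := oneBcos_sqr u; have u0 := normr_ge0 u.
move: h; rewrite -[u ^+ 2]ger0_norm ?sqr_ge0// normrX => h.
by have [|] := leP `|u| 2; nra.
Qed.

Lemma abs_sin_sub_le u : `|sin u - u| <= u ^+ 2.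
Proof.
have [c cu ->] := sin_mean u.
have -> : u * cos c - u = - (u * (1 - cos c)) by ring.
rewrite normrN normrM (ger0_norm (oneBcos_ge0 _)) -[u ^+ 2]ger0_norm ?sqr_ge0// normrX expr2.
by rewrite ler_wpM2l// (le_trans (oneBcos_abs c)).
Qed.

Lemma cvg_sin_div x : sin (x / n%:R) * n%:R @[n --> \oo] --> x.
Proof.
apply/cvgrPdist_le => e e0; near=> n.
have n0 : 0 < n%:R :> R by rewrite ltr0n; near: n; exact: nbhs_infty_gt.
have -> : x - sin (x / n%:R) * n%:R = - ((sin (x / n%:R) - x / n%:R) * n%:R).
  by field; rewrite gt_eqF.
rewrite normrN normrM (gtr0_norm n0) (le_trans (ler_wpM2r (ltW n0) (abs_sin_sub_le _)))//.
have -> : (x / n%:R) ^+ 2 * n%:R = x ^+ 2 / n%:R by field; rewrite gt_eqF.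
by rewrite ler_pdivrMr// mulrC -ler_pdivrMr//; near: n; exact: nbhs_infty_ger.
Unshelve. all: by end_near. Qed.

Lemma measurable_cos (d : measure_display) (Z : measurableType d) (f : Z -> R) :
  measurable_fun setT f -> measurable_fun setT (fun z => cos (f z)).
Proof.
move=> mf; apply: (measurableT_comp (f := cos)) => //.
by apply: continuous_measurable_fun; exact: continuous_cos.
Qed.

Lemma measurable_sin (d : measure_display) (Z : measurableType d) (f : Z -> R) :
  measurable_fun setT f -> measurable_fun setT (fun z => sin (f z)).
Proof.
move=> mf; apply: (measurableT_comp (f := sin)) => //.
by apply: continuous_measurable_fun; exact: continuous_sin.
Qed.

Lemma bmeas_cos (d : measure_display) (Z : measurableType d) (f : Z -> R) :
  measurable_fun setT f -> bmeas (fun z => cos (f z)).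
Proof. by move=> mf; split; [exact: measurable_cos|exists 1 => z; exact: cos_max]. Qed.

Lemma bmeas_sin (d : measure_display) (Z : measurableType d) (f : Z -> R) :
  measurable_fun setT f -> bmeas (fun z => sin (f z)).
Proof. by move=> mf; split; [exact: measurable_sin|exists 1 => z; exact: sin_max]. Qed.

End trigonometry.

(** * Uniqueness from Fourier and cosine transforms *)

Section fourier_uniqueness.
Context {R : realType}.

Lemma measurable_lin2 (t1 t2 : R) :
  measurable_fun setT (fun z : R * R => t1 * z.1 + t2 * z.2).
Proof.
by apply: measurable_funD; exact: measurable_funM.
Qed.

(** Cosines of affine forms are closed under products up to sums, so their class is an algebra. It
    contains the indicators of preimages under linear forms, hence those of rectangles, which
    generate the Borel sets of the plane. *)
Lemma fourier_unique2 (L1 L2 : (R * R -> R) -> R) : bint L1 -> bint L2 ->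
  (forall t1 t2, L1 (fun z => cos (t1 * z.1 + t2 * z.2)) =
                 L2 (fun z => cos (t1 * z.1 + t2 * z.2))) ->
  (forall t1 t2, L1 (fun z => sin (t1 * z.1 + t2 * z.2)) =
                 L2 (fun z => sin (t1 * z.1 + t2 * z.2))) ->
  forall f, bmeas f -> L1 f = L2 f.
Proof.
move=> b1 b2 ec es; apply: (bint_eq b1 b2).
pose K (f : R * R -> R) := exists t1 t2 c, f = fun z => cos (t1 * z.1 + t2 * z.2 + c).
have bK f : K f -> bmeas f.
  move=> [t1 [t2 [c ->]]]; apply: bmeas_cos; apply: measurable_funD => //.
  exact: measurable_lin2.
have K1 : K (fun=> 1).
  by exists 0, 0, 0; apply/funext => z; rewrite !mul0r !addr0 cos0.
have KM f g : K f -> K g -> mclass K (fun z => f z * g z).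
  move=> [t1 [t2 [c ->]]] [s1 [s2 [e ->]]].
  have -> : (fun z : R * R => cos (t1 * z.1 + t2 * z.2 + c) * cos (s1 * z.1 + s2 * z.2 + e)) =
    (fun z => 2^-1 * (cos ((t1 + s1) * z.1 + (t2 + s2) * z.2 + (c + e)) +
                      cos ((t1 - s1) * z.1 + (t2 - s2) * z.2 + (c - e)))).
    apply/funext => z.
    set x := t1 * z.1 + t2 * z.2 + c; set y := s1 * z.1 + s2 * z.2 + e.
    have -> : (t1 + s1) * z.1 + (t2 + s2) * z.2 + (c + e) = x + y by rewrite /x /y; ring.
    have -> : (t1 - s1) * z.1 + (t2 - s2) * z.2 + (c - e) = x - y by rewrite /x /y; ring.
    by rewrite (cosD x y) (cosB x y); field.
  by apply: mclassZ; apply: mclassD; apply: mclass_base; do 3 eexists; reflexivity.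
have e12 f : K f -> L1 f = L2 f.
  move=> [t1 [t2 [c ->]]].
  have -> : (fun z : R * R => cos (t1 * z.1 + t2 * z.2 + c)) =
    (fun z => cos c * cos (t1 * z.1 + t2 * z.2) + - sin c * sin (t1 * z.1 + t2 * z.2)).
    by apply/funext => z; rewrite cosD; ring.
  have bc : bmeas (fun z : R * R => cos (t1 * z.1 + t2 * z.2)).
    by apply: bmeas_cos; exact: measurable_lin2.
  have bs : bmeas (fun z : R * R => sin (t1 * z.1 + t2 * z.2)).
    by apply: bmeas_sin; exact: measurable_lin2.
  rewrite !bintD ?bintZ ?ec ?es//; exact: bmeasZ.
have mlin t1 t2 (A : set R) : measurable A ->
    mclass K (\1_((fun z : R * R => t1 * z.1 + t2 * z.2) @^-1` A) : R * R -> R).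
  (* The phase - pi / 2 turns the cosine into a sine: n sin (x / n) tends to the linear form x. *)
  apply: (mclass_preimage bK K1 KM
    (g_ := fun n z => n%:R * cos (t1 / n%:R * z.1 + t2 / n%:R * z.2 + - (pi / 2)))).
    by move=> n; apply: mclassZ; apply: mclass_base; do 3 eexists; reflexivity.
  move=> z; have := @cvg_sin_div R (t1 * z.1 + t2 * z.2).
  apply: cvg_trans; apply: near_eq_cvg; apply: nearW => n.
  by rewrite cosBpihalf [RHS]mulrC; congr (sin _ * _); ring.
move=> A; rewrite measurable_prod_measurableType => mA.
apply: (mclass_eq bK b1 b2 e12); move: A mA.
apply: smallest_sub; first exact: mclass_sigma.
move=> _ [A mA] [B mB] <- /=.
have := mclassM bK KM (mlin 1 0 A mA) (mlin 0 1 B mB); congr mclass.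
apply/funext => z; rewrite !indicE -natrM mulnb; congr (_%:R); congr nat_of_bool.
apply/idP/idP.
  by move=> /andP[]; rewrite !inE /= !mul1r !mul0r addr0 add0r.
rewrite inE => -[Az Bz]; apply/andP; rewrite !inE /=.
by rewrite !mul1r !mul0r addr0 add0r.
Qed.

(* The cosines x |-> cos (u x) only see |x|. *)
Lemma cosine_unique (L1 L2 : (R -> R) -> R) : bint L1 -> bint L2 ->
  (forall u, L1 (fun x => cos (u * x)) = L2 (fun x => cos (u * x))) ->
  forall f, bmeas f -> L1 (fun x => f `|x|) = L2 (fun x => f `|x|).
Proof.
move=> b1 b2 ec.
pose K (f : R -> R) := exists u, f = fun x => cos (u * x).
have bK f : K f -> bmeas f.
  by move=> [u ->]; apply: bmeas_cos; exact: measurable_funM.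
have K1 : K (fun=> 1) by exists 0; apply/funext => z; rewrite mul0r cos0.
have KM f g : K f -> K g -> mclass K (fun z => f z * g z).
  move=> [u ->] [w ->].
  have -> : (fun z => cos (u * z) * cos (w * z)) =
      (fun z => 2^-1 * (cos ((u + w) * z) + cos ((u - w) * z))).
    by apply/funext => z; rewrite mulrDl mulrBl cosD cosB; field.
  by apply: mclassZ; apply: mclassD; apply: mclass_base; eexists; reflexivity.
have e12 f : K f -> L1 f = L2 f by move=> [u ->].
have msq (A : set R) : measurable A -> mclass K (\1_((fun z : R => z ^+ 2) @^-1` A) : R -> R).
  (* Half-angle formula: n^2 (1 - cos (2 z / n)) / 2 equals (n sin (z / n))^2, which tends to
     z^2. *)
  apply: (mclass_preimage bK K1 KM
    (g_ := fun n z => 2^-1 * n%:R ^+ 2 * (1 - cos ((2 / n%:R) * z)))).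
    move=> n; apply: mclassZ; apply: mclassB; first exact: mclass_base.
    by apply: mclass_base; eexists; reflexivity.
  move=> z.
  have -> : (fun n => 2^-1 * n%:R ^+ 2 * (1 - cos ((2 / n%:R) * z))) =
            (fun n => (sin (z / n%:R) * n%:R) ^+ 2).
    apply/funext => n; rewrite oneBcosE.
    have -> : 2 / n%:R * z / 2 = z / n%:R.
      by rewrite [2 / _]mulrC -!mulrA [z / 2]mulrC (mulrA 2) divff// mul1r mulrC.
    by field.
  by under eq_fun do rewrite expr2; rewrite expr2; apply: cvgM; exact: cvg_sin_div.
have mabs : measurable_fun setT (fun x : R => `|x|) by exact: normr_measurable.
pose L1' f := L1 (fun x => f `|x|); pose L2' f := L2 (fun x => f `|x|).
have bcomp f : bmeas f -> bmeas (fun x : R => f `|x|).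
  by move=> [mf [M fM]]; split; [exact: (measurableT_comp mf)|exists M].
have bL (L : (R -> R) -> R) : bint L -> bint (fun f => L (fun x => f `|x|)).
  move=> bL; split.
  - by move=> f g bf bg; rewrite bintD//; exact: bcomp.
  - by move=> c f bf; rewrite bintZ//; exact: bcomp.
  - move=> f_ f M bf fM ff.
    by apply: (bint_lim bL (f_ := fun n x => f_ n `|x|) (M := M)) => // n; exact: bcomp.
apply: (bint_eq (bL _ b1) (bL _ b2)) => A mA.
have mA' : measurable (Num.sqrt @^-1` A : set R).
  rewrite -[X in measurable X]setTI.
  apply: (_ : measurable_fun setT (@Num.sqrt R)) => //.
  by apply: continuous_measurable_fun; exact: sqrt_continuous.
apply: (mclass_eq bK b1 b2 e12); have := msq _ mA'; congr mclass.
apply/funext => x; rewrite !indicE; congr (_%:R); congr nat_of_bool.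
by apply/idP/idP; rewrite !inE /= sqrtr_sqr.
Qed.

End fourier_uniqueness.

(** * Limits of bounded sequences along an ultrafilter *)

Section ultrafilter_limits.
Context {R : realType} (U : set_system nat) {UU : UltraFilter U}.

(** The limit is the supremum of the eventual lower bounds. That u stays below sup S + e eventually
    follows from maximality: a set or its complement belongs to U. *)
Lemma ultra_cvg_bounded (u : nat -> R) (M : R) :
  (\forall k \near U, `|u k| <= M) -> exists l : R, u @ U --> l.
Proof.
move=> uM.
pose S := [set x | \forall k \near U, x <= u k].
have S0 : S (- M).
  by near=> k; have : `|u k| <= M; [near: k|rewrite ler_norml => /andP[]].
have Sub x : S x -> x <= M.
  move=> Sx; have /filter_ex[k [xu]] : \forall k \near U, x <= u k /\ `|u k| <= M.
    by near=> k; split; near: k.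
  by rewrite ler_norml => /andP[_]; exact: le_trans.
have hS : has_sup S by split; [exists (- M)|exists M => x; exact: Sub].
exists (sup S); apply/cvgrPdist_le => e e0.
have [x Sx xe] := sup_adherent e0 hS.
have nS : ~ S (sup S + e).
  by move=> /(ub_le_sup (proj2 hS)); rewrite gerDl leNgt e0.
have [//|Ue] := in_ultra_setVsetC [set k | sup S + e <= u k] UU.
near=> k; rewrite distrC ler_distl; apply/andP; split.
  apply: (le_trans (ltW xe)); near: k; exact: Sx.
have : (~` [set k | sup S + e <= u k]) k by near: k.
by move=> /= /negP; rewrite -ltNge => /ltW.
Unshelve. all: by end_near. Qed.

End ultrafilter_limits.

(** * Positive functionals and staircase approximation *)

Section positive_functionals.
Context (R : realType) (d : measure_display) (Z : measurableType d).
Implicit Types (L : (Z -> R) -> R) (f g : Z -> R).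

Record plin L : Prop := Plin {
  plinD : forall f g, bmeas f -> bmeas g -> L (fun z => f z + g z) = L f + L g;
  plinZ : forall c f, bmeas f -> L (fun z => c * f z) = c * L f;
  plin_ge0 : forall f, bmeas f -> (forall z, 0 <= f z) -> 0 <= L f }.

Section theory.
Context L (pL : plin L).

Lemma plinB f g : bmeas f -> bmeas g -> L (fun z => f z - g z) = L f - L g.
Proof.
move=> bf bg; rewrite -mulN1r -(plinZ pL)//.
under eq_fun do rewrite -mulN1r; rewrite (plinD pL)//; exact: bmeasZ.
Qed.

Lemma plin_le f g : bmeas f -> bmeas g -> (forall z, f z <= g z) -> L f <= L g.
Proof.
move=> bf bg fg; rewrite -subr_ge0 -plinB//; apply: (plin_ge0 pL); first exact: bmeasB.
by move=> z; rewrite subr_ge0.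
Qed.

Lemma plin_norm f g : bmeas f -> bmeas g -> (forall z, `|f z| <= g z) -> `|L f| <= L g.
Proof.
move=> bf bg fg; rewrite ler_norml; apply/andP; split.
  rewrite -mulN1r -(plinZ pL)//; apply: plin_le => //; first exact: bmeasZ.
  by move=> z; rewrite mulN1r; have := fg z; rewrite ler_norml => /andP[].
by apply: plin_le => // z; have := fg z; rewrite ler_norml => /andP[].
Qed.

Lemma plin_sum (I : Type) (r : seq I) (F : I -> Z -> R) : (forall i, bmeas (F i)) ->
  L (fun z => \sum_(i <- r) F i z) = \sum_(i <- r) L (F i).
Proof.
move=> bF; elim: r => [|i r ih].
  under eq_fun do rewrite big_nil; rewrite big_nil.
  by have := plinZ pL 0 (bmeas_cst _ (0 : R)); under eq_fun do rewrite mul0r; rewrite mul0r.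
under eq_fun do rewrite big_cons; rewrite big_cons (plinD pL)// ?ih//.
exact: bmeas_sum.
Qed.

Lemma plin_cst (c : R) : L (fun=> c) = c * L (fun=> 1).
Proof.
rewrite -(plinZ pL); last exact: bmeas_cst.
by congr L; apply/funext => z; rewrite mulr1.
Qed.

(** On the layer between H j and H (j + 1) the function is within e of a j; outside H n the
    staircase is 0 and f is at most B. The estimate is applied to the functionals [L k] and to the
    Lebesgue side of the Helly theorem with the same values a j. *)
Lemma plin_step (H : nat -> set Z) (a : nat -> R) (f : Z -> R) (e B : R) n :
  (forall j, measurable (H j)) -> {homo H : i j / (i <= j)%N >-> i `<=` j} ->
  H 0%N = set0 -> bmeas f -> 0 <= e -> (forall z, `|f z| <= B) ->
  (forall j z, (j < n)%N -> H j.+1 z -> ~ H j z -> `|f z - a j| <= e) ->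
  `|L f - \sum_(j < n) a j * (L (\1_(H j.+1)) - L (\1_(H j)))| <=
    e * L (fun=> 1) + B * (L (fun=> 1) - L (\1_(H n))).
Proof.
move=> mH ndH H0 bf e0 fB fa.
have bH j : bmeas (\1_(H j) : Z -> R) by exact: bmeas_indic.
have bS : bmeas (fun z => \sum_(j < n) a j * (\1_(H j.+1) z - \1_(H j) z)).
  by apply: bmeas_sum => j; apply: bmeasZ; exact: bmeasB.
have -> : \sum_(j < n) a j * (L (\1_(H j.+1)) - L (\1_(H j))) =
    L (fun z => \sum_(j < n) a j * (\1_(H j.+1) z - \1_(H j) z)).
  rewrite plin_sum; last by move=> j; apply: bmeasZ; exact: bmeasB.
  apply: eq_bigr => j _; rewrite (plinZ pL) ?plinB//; exact: bmeasB.
have b1 : bmeas (fun _ : Z => 1 : R) by exact: bmeas_cst.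
have bB : bmeas (fun z => 1 - \1_(H n) z : R) by exact: bmeasB.
have -> : e * L (fun=> 1) + B * (L (fun=> 1) - L (\1_(H n))) =
    L (fun z => e * 1 + B * (1 - \1_(H n) z)).
  by rewrite (plinD pL) ?(plinZ pL) ?plinB//; exact: bmeasZ.
rewrite -plinB//; apply: plin_norm.
- exact: bmeasB.
- by apply: bmeasD; apply: bmeasZ.
move=> z.
have B0 : 0 <= B by apply: le_trans (fB z).
suff [hin hout] : (H n z -> `|f z - \sum_(j < n) a j * (\1_(H j.+1) z - \1_(H j) z)| <= e) /\
    (~ H n z -> \sum_(j < n) a j * (\1_(H j.+1) z - \1_(H j) z) = 0).
  have [Hn|Hn] := pselect (H n z).
    by rewrite indicE mem_set//= subrr mulr0 addr0 mulr1 hin.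
  by rewrite indicE memNset//= hout// !subr0 !mulr1 (le_trans (fB z))// lerDr.
elim: n fa {bS bB B0 fB} => [|n ih] fa.
  by rewrite H0; split => // _; rewrite big_ord0.
have {ih}[|hin hout] := ih; first by move=> j z' jn; apply: fa; exact: ltnW.
rewrite big_ord_recr /= !indicE; split => Hn.
  rewrite mem_set//; have [Hn'|Hn'] := pselect (H n z).
    by rewrite mem_set// subrr mulr0 addr0 hin.
  by rewrite memNset// hout// add0r subr0 mulr1 fa.
have Hn' : ~ H n z by move=> /(ndH _ _ (leqnSn n)).
by rewrite !memNset// hout// subrr mulr0 addr0.
Qed.

End theory.

Lemma plin_Rintegral (dT : measure_display) (T : measurableType dT)
    (mu : {measure set T -> \bar R}) (D : set T) (v : T -> Z) (k : T -> R) :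
  measurable D -> measurable_fun D v -> mu.-integrable D (EFin \o k) ->
  (forall x, D x -> 0 <= k x) ->
  plin (fun f : Z -> R => \int[mu]_(x in D) (f (v x) * k x)).
Proof.
move=> mD mv ik k0; have [bD bZ _] := bint_Rintegral mD mv ik; split => //.
move=> f bf f0; apply: Rintegral_ge0 => x Dx.
by rewrite mulr_ge0// k0.
Qed.

End positive_functionals.

(** * Helly's theorem on the half-line *)

Section heine.
Context {R : realType}.

(** Only x is confined to the segment, y is free: compactness is applied to the set of x at which a
    given dl works against every y. *)
Lemma heine_segment (g : R -> R) (a b e : R) : continuous g -> 0 < e ->
  exists2 dl : R, 0 < dl & forall x y, a <= x <= b -> `|x - y| <= dl -> `|g x - g y| <= e.
Proof.
move=> cg e0.
pose P (dl x : R) := forall y, `|x - y| <= dl -> `|g x - g y| <= e.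
have : \forall dl \near (0 : R)^'+, `[a, b]%classic `<=` P dl.
  have /compact_near_coveringP := @segment_compact R a b.
  apply; move=> x _; have e20 : 0 < e / 2 by rewrite divr_gt0.
  have /cvgrPdist_le/(_ _ e20) /nbhs_ballP[/= r r0 xr] := cg x.
  have r20 : 0 < r / 2 by rewrite divr_gt0.
  exists (ball x (r / 2), [set dl | dl < r / 2]).
    by split => /=; [exact: nbhsx_ballx|exact: nbhs_right_lt].
  move=> [x' dl] /= [bx dlr] y xy.
  have -> : g x' - g y = (g x - g y) - (g x - g x') by ring.
  rewrite (le_trans (ler_normB _ _))// (splitr e) lerD//; apply: xr => /=.
    rewrite /ball/= (_ : x - y = (x - x') + (x' - y)); last by ring.
    by rewrite (le_lt_trans (ler_normD _ _))// (splitr r) ltrD// (le_lt_trans xy).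
  by move: bx; rewrite /ball/= => /lt_trans; apply; rewrite ltr_pdivrMr// ltr_pMr// ltr1n.
move=> H; have /filter_ex[dl [dl0 dlP]] :
    \forall dl \near (0 : R)^'+, 0 < dl /\ `[a, b]%classic `<=` P dl.
  by near=> dl; split; near: dl => //; exact: nbhs_right_gt.
exists dl => // x y xab; apply: dlP.
by rewrite /= in_itv.
Unshelve. all: by end_near. Qed.

End heine.

Lemma integrable_itv_cst (R : realType) (a b r : R) :
  (@lebesgue_measure R).-integrable `[a, b[ (EFin \o (fun=> r)).
Proof.
apply: measurable_bounded_integrable => //.
- rewrite /= lebesgue_measure_itv /=; case: ifP => // _; exact: ltry.
- by exists `|r|; split => // x /ltW x1 y _.
Qed.

Section helly_real.
Context (R : realType) (U : set_system nat) {UU : UltraFilter U}.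
Context (d : measure_display) (Z : measurableType d).
Context (L : nat -> (Z -> R) -> R) (C : R) (c : Z -> R).
Hypothesis pL : forall k, plin (L k).
Hypothesis L1C : \forall k \near U, L k (fun=> 1) <= C.
Hypotheses (mc : measurable_fun setT c) (c0 : forall z, 0 <= c z).
Hypothesis tight : forall e : R, 0 < e ->
  exists T : R, \forall k \near U, L k (\1_[set z | T < c z]) <= e.

Let le_set t : measurable [set z | c z <= t].
Proof.
rewrite (_ : [set _ | _] = c @^-1` `]-oo, t]).
  by rewrite -[X in measurable X]setTI; exact: mc.
by apply/seteqP; split => z /=; rewrite in_itv.
Qed.

Let bm_le t : bmeas (\1_[set z | c z <= t] : Z -> R).
Proof. exact: bmeas_indic. Qed.

Let bm1 : bmeas (fun _ : Z => 1 : R).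
Proof. exact: bmeas_cst. Qed.

Let G_ex t : exists l : R, (fun k => L k (\1_[set z | c z <= t])) @ U --> l.
Proof.
apply: (@ultra_cvg_bounded R U UU _ C); apply: filterS L1C => k.
by apply: le_trans; rewrite plin_norm// => z; rewrite ger0_norm.
Qed.

Let M_ex : exists l : R, (fun k => L k (fun=> 1)) @ U --> l.
Proof.
apply: (@ultra_cvg_bounded R U UU _ C); apply: filterS L1C => k.
by apply: le_trans; rewrite plin_norm// => z; rewrite normr1.
Qed.

Let G t := projT1 (cid (G_ex t)).
Let GE t : (fun k => L k (\1_[set z | c z <= t])) @ U --> G t.
Proof. exact: (projT2 (cid (G_ex t))). Qed.

Let M := projT1 (cid M_ex).
Let ME : (fun k => L k (fun=> 1)) @ U --> M.
Proof. exact: (projT2 (cid M_ex)). Qed.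

Let cvg_le (u v : nat -> R) (x y : R) : u @ U --> x -> v @ U --> y ->
  (\forall k \near U, u k <= v k) -> x <= y.
Proof. by move=> ux vy uv; exact: (ler_cvg_to ux vy). Qed.

Let G_homo s t : s <= t -> G s <= G t.
Proof.
move=> st; apply: (cvg_le (@GE s) (@GE t)); apply: nearW => k.
apply: plin_le => // z; rewrite !indicE ler_nat.
have [h|h] := pselect (c z <= s).
  by rewrite mem_set// mem_set//=; exact: le_trans st.
by rewrite memNset.
Qed.

Let G_lt0 (t : R) : t < 0 -> G t = 0.
Proof.
move=> t0; apply: (cvg_unique (@Rhausdorff R) (@GE t)).
apply: cvg_near_cst; apply: nearW => k.
rewrite (_ : [set z | c z <= t] = set0).
  rewrite -[RHS](mul0r (L k (fun=> 1))) -plin_cst//.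
  by congr (L k); apply/funext => z; rewrite indicE in_set0.
by apply/seteqP; split => z //=; rewrite leNgt (lt_le_trans t0).
Qed.

Let G_ge0 t : 0 <= G t.
Proof.
apply: (cvg_le (u := fun=> 0) _ (@GE t)); first exact: cvg_cst.
by apply: nearW => k; apply: (plin_ge0 (pL k)) => // z; rewrite indicE.
Qed.

Let G_leM t : G t <= M.
Proof. by apply: (cvg_le (@GE t) ME); apply: nearW => k; exact: plin_le. Qed.

Let M_ge0 : 0 <= M. Proof. exact: le_trans (G_ge0 0) (G_leM 0). Qed.

Let M_leC : M <= C.
Proof. by apply: (cvg_le ME (v := fun=> C)) => //; exact: cvg_cst. Qed.

Let G_tight (e : R) : 0 < e -> exists2 T : R, 0 < T & M - e <= G T.
Proof.
move=> e0; have [T hT] := tight e0.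
exists (Num.max T 1); first by rewrite lt_max ltr01 orbT.
apply: le_trans (G_homo (_ : T <= _)); last by rewrite le_max lexx.
rewrite lerBlDr -lerBlDl.
apply: (cvg_le (u := fun k => L k (fun=> 1) - L k (\1_[set z | c z <= T])) (v := fun=> e)).
- by apply: cvgB.
- exact: cvg_cst.
- near=> k; rewrite -plinB//.
  rewrite (_ : (fun _ => _) = \1_[set z | T < c z]); first by near: k.
  apply/funext => z; rewrite !indicE; case: (leP (c z) T) => h.
    by rewrite mem_set// memNset ?subrr//= => /lt_geF; rewrite h.
  by rewrite memNset ?mem_set ?subr0//= => /le_gtF; rewrite h.
Unshelve. all: by end_near. Qed.

(* The quantile function of the limit distribution function G. *)
Let Q w := [set t | 0 <= t /\ w < G t].
Let q w := if w < M then inf (Q w) else 0.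

Let Q_inf w : w < M -> has_inf (Q w).
Proof.
move=> wM; have [|T T0 MT] := @G_tight ((M - w) / 2).
  by rewrite divr_gt0// subr_gt0.
split; last by exists 0 => t [].
by exists T; split; [exact: ltW|lra].
Qed.

Let q_le w (t : R) : 0 <= t -> w < G t -> q w <= t.
Proof.
move=> t0 wG; rewrite /q (lt_le_trans wG (G_leM t)).
by apply: inf_lbound => //; exists 0 => x [].
Qed.

Let q_ge w t : G t <= w -> w < M -> t <= q w.
Proof.
move=> Gw wM; rewrite /q wM; apply: lb_le_inf; first by case: (Q_inf wM).
move=> s [_ ws]; rewrite leNgt; apply/negP => st.
by have := G_homo (ltW st); lra.
Qed.

Let q_homo v w : v <= w -> w < M -> q v <= q w.
Proof.
move=> vw wM; rewrite {2}/q wM; apply: lb_le_inf; first by case: (Q_inf wM).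
by move=> s [s0 ws]; apply: q_le => //; exact: le_lt_trans ws.
Qed.

(** q is nondecreasing below M and constant from M on, so a ray has as preimage the union of two
    intervals. *)
Let q_measurable : measurable_fun setT q.
Proof.
move=> _; apply: (measurability _ (RGenOInfty.measurableE R)) => //.
move=> /= _ [_ [x ->] <-]; rewrite setTI.
rewrite (_ : q @^-1` _ = (`]-oo, M[ `&` q @^-1` `]x, +oo[) `|`
                         (`[M, +oo[ `&` q @^-1` `]x, +oo[)); last first.
  rewrite -setIUl; apply/esym/setIidr => w _ /=; rewrite !in_itv /= andbT.
  by have [] := leP M w; [right|left].
apply: measurableU.
  apply: is_interval_measurable => u v /= [uM qu] [vM qv] w /andP[uw wv].
  move: uM vM qu qv; rewrite /= !in_itv /= !andbT => uM vM qu qv.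
  have wM : w < M := le_lt_trans wv vM.
  by split=> //; apply: lt_le_trans qu _; exact: q_homo.
apply: is_interval_measurable => u v /= [uM qu] [vM qv] w /andP[uw wv].
move: uM vM qu qv; rewrite /= !in_itv /= !andbT => uM vM qu qv.
have wM : M <= w := le_trans uM uw.
by split=> //; move: qu; rewrite /q !ltNge uM wM.
Qed.

Let LQ (f : R -> R) := \int[lebesgue_measure]_(w in `[0, M[) (f w * 1).

Let pLQ : plin LQ.
Proof. by apply: plin_Rintegral => //; exact: integrable_itv_cst. Qed.

Let LQ_itv (t : R) : 0 <= t -> t <= M -> LQ (\1_(`[0, t[%classic)) = t.
Proof.
move=> t0 tM; rewrite /LQ.
under eq_Rintegral do rewrite mulr1.
rewrite /Rintegral integral_indic// setIidl.
  rewrite /= lebesgue_measure_itv /= lte_fin; have [|] := ltP 0 t; first by rewrite oppr0 adde0.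
  by move=> t0'; apply/eqP; rewrite eq_le t0 t0'.
by move=> x /=; rewrite !in_itv /= => /andP[-> /= /lt_le_trans]; apply.
Qed.

(** The distribution functions of c under [L k] converge along U at every point, to a nondecreasing
    G which need not be right-continuous. No measure is built from G: the layer s < c <= t weighs G
    t - G s in the limit, and so does the interval [G s, G t[, on which q lies in [s, t]. One
    staircase serves both sides, and closed layers make atoms at grid points harmless. *)
Lemma helly_real : exists (M' : R) (q' : R -> R),
  [/\ 0 <= M', measurable_fun setT q' &
    forall g : R -> R, continuous g -> bounded_fun g ->
    L k (g \o c) @[k --> U] -->
      \int[lebesgue_measure]_(w in `[0, M'[) g (q' w)].
Proof.
exists M, q; split => // g cg [B0 [_ gB0]].
have [B B1 gB] : exists2 B : R, 0 < B & forall x, `|g x| <= B.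
  exists (`|B0| + 1); first by rewrite ltr_wpDl.
  by move=> x; apply: gB0 => //; rewrite (le_lt_trans (ler_norm B0))// ltrDl.
have -> : \int[lebesgue_measure]_(w in `[0, M[) g (q w) = LQ (g \o q).
  by apply: eq_Rintegral => w _; rewrite mulr1.
have mg : measurable_fun setT g by exact: continuous_measurable_fun.
have bgc : bmeas (g \o c) by split; [exact: measurableT_comp|exists B => z; exact: gB].
have bgq : bmeas (g \o q) by split; [exact: measurableT_comp|exists B => z; exact: gB].
have C0 : 0 <= C by exact: le_trans M_leC.
apply/cvgrPdist_le => eps eps0.
(* The final count is e C + B e on the Lebesgue side, e between the two staircases, and e C + 3 B e
   for [L k]. *)
pose e := eps / (2 * C + 4 * B + 1).
have D0 : 0 < 2 * C + 4 * B + 1 by lra.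
have e0 : 0 < e by rewrite divr_gt0.
have epsE : eps = e * (2 * C + 4 * B + 1) by rewrite /e divfK// gt_eqF.
have [T T0 GT] := G_tight e0.
have [dl dl0 hdl] := @heine_segment R g 0 T e cg e0.
pose n := (Num.truncn (T / dl)).+1.
have n0 : 0 < n%:R :> R by rewrite ltr0n.
pose h := T / n%:R.
have h0 : 0 < h by rewrite divr_gt0.
have hdl' : h <= dl.
  rewrite /h ler_pdivrMr// mulrC -ler_pdivrMr//; apply/ltW; exact: truncnS_gt.
(* The grid starts one step below 0, so that the layer of index 0 is empty because c >= 0, and it
   reaches T at index n + 1. *)
pose t (j : nat) := (j%:R - 1) * h.
have t_homo i j : (i <= j)%N -> t i <= t j.
  by move=> ij; rewrite /t ler_pM2r// lerD2r ler_nat.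
have tn : t n.+1 = T by rewrite /t -natr1 addrK /h mulrC divfK// gt_eqF.
have tS j : t j.+1 = j%:R * h by rewrite /t -natr1 addrK.
have t0 : t 0%N < 0 by rewrite /t sub0r mulN1r oppr_lt0.
have tSE j : t j.+1 - t j = h by rewrite /t -natr1; ring.
have close j x : (j < n.+1)%N -> t j <= x <= t j.+1 -> `|g x - g (t j.+1)| <= e.
  move=> jn /andP[tx xt]; rewrite distrC; apply: hdl.
    by rewrite tS mulr_ge0 ?(ltW h0)//= -tS -tn t_homo.
  by rewrite (le_trans _ hdl')// -(tSE j) ger0_norm ?subr_ge0// lerD2l lerN2.
pose S := \sum_(j < n.+1) g (t j.+1) * (G (t j.+1) - G (t j)).
have SQ : `|LQ (g \o q) - S| <= e * M + B * (M - G T).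
  have LQ1 : LQ (fun=> 1) = M.
    rewrite -[RHS](LQ_itv M_ge0 (lexx _)); apply: eq_Rintegral => w; rewrite inE /= => wM.
    by rewrite indicE mem_set.
  have := @plin_step _ _ _ LQ pLQ (fun j => `[0, G (t j)[%classic) (fun j => g (t j.+1))
    (g \o q) e B n.+1.
  under eq_bigr do rewrite !LQ_itv//.
  rewrite LQ_itv// LQ1 tn; apply => //.
  - move=> i j ij x /=; rewrite !in_itv /= => /andP[-> /= xG].
    by apply: lt_le_trans xG _; apply: G_homo; exact: t_homo.
  - rewrite G_lt0//; apply/seteqP; split => x //=; rewrite in_itv /= => /andP[x0].
    by rewrite ltNge x0.
  - exact: ltW.
  - by move=> z; exact: gB.
  - move=> j w jn /=; rewrite !in_itv /= => /andP[w0 wG] /negP; rewrite w0 /= -leNgt => Gw.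
    apply: close => //; rewrite q_ge ?q_le//=.
      by rewrite tS mulr_ge0// ltW.
    exact: lt_le_trans wG _.
pose Sk k := \sum_(j < n.+1) g (t j.+1) *
  (L k (\1_[set z | c z <= t j.+1]) - L k (\1_[set z | c z <= t j])).
have SkS : Sk @ U --> S.
  rewrite /Sk /S; apply: cvg_big => [|j _]; first exact: add_continuous.
  apply: cvgMr; apply: cvgB; exact: (@GE).
have LkE k : `|L k (g \o c) - Sk k| <=
    e * L k (fun=> 1) + B * (L k (fun=> 1) - L k (\1_[set z | c z <= T])).
  have := @plin_step _ _ _ (L k) (pL k) (fun j => [set z | c z <= t j]) (fun j => g (t j.+1))
    (g \o c) e B n.+1.
  rewrite tn; apply => //.
  - by move=> i j ij x /= xt; apply: le_trans xt _; exact: t_homo.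
  - by apply/seteqP; split => x //=; rewrite leNgt (lt_le_trans t0).
  - exact: ltW.
  - by move=> z; exact: gB.
  - move=> j z jn /= zt /negP; rewrite -ltNge => tz.
    by apply: close => //; rewrite zt ltW.
near=> k.
have H1 : `|S - Sk k| <= e by near: k; move: e e0 {epsE GT hdl close SQ LkE}; exact/cvgrPdist_le.
have H2 : `|M - L k (fun=> 1)| <= e.
  by near: k; move: e e0 {epsE GT hdl close SQ LkE}; exact/cvgrPdist_le.
have H3 : `|G T - L k (\1_[set z | c z <= T])| <= e.
  by near: k; move: (@GE T) => /cvgrPdist_le; exact.
have LkC : L k (fun=> 1) <= C by near: k; exact: L1C.
have -> : LQ (g \o q) - L k (g \o c) =
  (LQ (g \o q) - S) + (S - Sk k) - (L k (g \o c) - Sk k) by ring.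
rewrite (le_trans (ler_normB _ _))//.
apply: (@le_trans _ _ ((e * M + B * (M - G T)) + e +
   (e * L k (fun=> 1) + B * (L k (fun=> 1) - L k (\1_[set z | c z <= T]))))).
  apply: lerD => //; rewrite (le_trans (ler_normD _ _))//; exact: lerD.
have K1 : e * M <= e * C by rewrite ler_wpM2l// ltW.
have K2 : e * L k (fun=> 1) <= e * C by rewrite ler_wpM2l// ltW.
have K3 : B * (M - G T) <= B * e.
  by rewrite ler_wpM2l ?(ltW B1)// lerBlDr addrC -lerBlDr.
have K4 : B * (L k (fun=> 1) - L k (\1_[set z | c z <= T])) <= B * (3 * e).
  rewrite ler_wpM2l ?(ltW B1)//.
  by move: H2 H3 GT; rewrite !ler_norml => /andP[? ?] /andP[? ?] ?; lra.
rewrite epsE; lra.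
Unshelve. all: by end_near. Qed.

End helly_real.

(** * Geometric series, digits and Schoenberg's curve *)

Section geometric_sums.
Context {R : realType} (r : R).
Hypothesis r01 : 0 <= r < 1.
Implicit Types a : nat -> R.

(** The weights (1 - r) r^k sum to 1. For digits 0 and 1, r = 1/2 gives binary expansions, and r =
    1/3 gives ternary expansions with digits 0 and 2. *)
Definition geosum a n := \sum_(k < n) a k * ((1 - r) * r ^+ k).
Definition geolim a := limn (geosum a).

Let r0 : 0 <= r. Proof. by case/andP: r01. Qed.
Let r1 : 0 <= 1 - r. Proof. by rewrite subr_ge0; case/andP: r01 => _ /ltW. Qed.

Context {a : nat -> R}.
Hypothesis a01 : forall k, 0 <= a k <= 1.

Let geosum_step n m : geosum a (n + m) <= geosum a n + r ^+ n - r ^+ (n + m).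
Proof.
elim: m => [|m ih]; first by rewrite addn0 addrK.
rewrite addnS /geosum big_ord_recr /= -/(geosum a (n + m)) -/(geosum a n).
have /andP[a0 a1] := a01 (n + m).
have w0 : 0 <= (1 - r) * r ^+ (n + m) by rewrite mulr_ge0// exprn_ge0.
by have := ler_piMl w0 a1; rewrite exprS; lra.
Qed.

Lemma geosum_nd : nondecreasing_seq (geosum a).
Proof.
apply/nondecreasing_seqP => n; rewrite /geosum big_ord_recr /= lerDl.
by have /andP[a0 _] := a01 n; rewrite !mulr_ge0// exprn_ge0.
Qed.

Lemma is_cvg_geosum : cvgn (geosum a).
Proof.
apply: nondecreasing_is_cvgn; first exact: geosum_nd.
exists 1 => _ [n _ <-]; have := geosum_step 0 n.
rewrite add0n /geosum big_ord0 expr0 add0r => /le_trans; apply.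
by rewrite gerDl oppr_le0 exprn_ge0.
Qed.

Lemma geosum_bounds n : geosum a n <= geolim a <= geosum a n + r ^+ n.
Proof.
rewrite nondecreasing_cvgn_le//=; [|exact: geosum_nd|exact: is_cvg_geosum].
apply: limr_le; first exact: is_cvg_geosum.
near=> m; have nm : (n <= m)%N by near: m; exact: nbhs_infty_ge.
rewrite -(subnKC nm); apply: (le_trans (geosum_step _ _)).
by rewrite gerDl oppr_le0 exprn_ge0.
Unshelve. all: by end_near. Qed.

Lemma geolim01 : 0 <= geolim a <= 1.
Proof. by have := geosum_bounds 0; rewrite /geosum big_ord0 expr0 add0r. Qed.

End geometric_sums.

Lemma continuousT_comp (R : realType) (f g : R -> R) :
  continuous f -> continuous g -> continuous (fun x => g (f x)).
Proof. by move=> cf cg x; apply: continuous_comp; [exact: cf|exact: cg]. Qed.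

Section digits.
Context {R : realType}.

Lemma geolimS (r : R) (a : nat -> R) : 0 <= r < 1 -> (forall k, 0 <= a k <= 1) ->
  geolim r a = a 0%N * (1 - r) + r * geolim r (a \o succn).
Proof.
move=> r01 a01; apply: (cvg_lim (@Rhausdorff R)).
rewrite -cvg_shiftS /=.
have -> : (fun n => geosum r a n.+1) = fun n => a 0%N * (1 - r) + r * geosum r (a \o succn) n.
  apply/funext => n; rewrite /geosum big_ord_recl /= expr0 mulr1; congr (_ + _).
  by rewrite big_distrr /=; apply: eq_bigr => k _; rewrite exprS; ring.
apply: cvgD; first exact: cvg_cst.
by apply: cvgMr; apply: is_cvg_geosum => // k; exact: a01.
Qed.

(** Iterating y -> 2 y - [1/2 <= y] keeps the remainder in [0, 1], and x minus its n-th partial sum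
    is 2^-n times the n-th remainder. *)
Lemma binary_digits (x : R) : 0 <= x <= 1 ->
  exists b : nat -> bool, geolim 2^-1 (fun k => (b k)%:R) = x.
Proof.
move=> x01.
pose dbl (y : R) : R := 2 * y - (2^-1 <= y)%R%:R.
pose rem k := iter k dbl x.
have rem01 k : 0 <= rem k <= 1.
  elim: k => // k /andP[h0 h1]; rewrite /rem iterS -/(rem k) /dbl.
  by case: (leP 2^-1 (rem k)) => h /=; apply/andP; split; lra.
exists (fun k => 2^-1 <= rem k); apply: (cvg_lim (@Rhausdorff R)).
have E n : x = geosum 2^-1 (fun k => (2^-1 <= rem k)%R%:R) n + 2^-1 ^+ n * rem n.
  elim: n => [|n ih]; first by rewrite /geosum big_ord0 add0r expr0 mul1r.
  rewrite /geosum big_ord_recr /= {1}ih /geosum -addrA; congr (_ + _).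
  by rewrite /dbl exprS; field.
have h01 : 0 <= (2^-1 : R) < 1 by apply/andP; split; lra.
have g0 : (2^-1 : R) ^+ n @[n --> \oo] --> (0 : R).
  by apply: cvg_expr; rewrite ger0_norm; lra.
apply/cvgrPdist_le => e e0; near=> n.
rewrite {1}(E n) addrAC subrr add0r.
have /andP[h0 h1] := rem01 n.
have q0 : 0 <= (2^-1 : R) ^+ n by rewrite exprn_ge0// invr_ge0.
rewrite ger0_norm ?mulr_ge0//.
apply: (@le_trans _ _ (2^-1 ^+ n)); first by rewrite ler_piMr.
near: n; move/cvgrPdist_le: g0 => /(_ _ e0); apply: filterS => n.
by rewrite sub0r normrN; apply: le_trans; exact: ler_norm.
Unshelve. all: by end_near. Qed.

End digits.

(* Schoenberg's curve: reading the ternary digits (0 or 2) of t, the k-th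
   digit is recovered as [pulse (3 ^ k t)], where pulse has period 2, vanishes
   on [0, 1/3] and is 1 on [2/3, 1]. *)
Section schoenberg.
Context {R : realType}.
Implicit Types s t : R.

Definition clamp t : R := Num.min 1 (Num.max 0 t).

Lemma continuous_clamp : continuous (clamp : R -> R).
Proof.
move=> x; rewrite /clamp; apply: continuous_min; first exact: cvg_cst.
by apply: continuous_max; [exact: cvg_cst|exact: cvg_id].
Qed.

Lemma clamp01 t : 0 <= clamp t <= 1.
Proof.
by rewrite /clamp le_min ler01 le_max lexx /= ge_min lexx.
Qed.

Lemma clamp_le0 t : t <= 0 -> clamp t = 0.
Proof. by move=> t0; rewrite /clamp max_l// min_r. Qed.

Lemma clamp_ge1 t : 1 <= t -> clamp t = 1.
Proof. by move=> t1; rewrite /clamp max_r ?min_l// (le_trans ler01). Qed.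

Definition pulse t : R := clamp (2^-1 - 5 * cos (pi * t)).

Lemma continuous_pulse : continuous (pulse : R -> R).
Proof.
move=> x.
apply: (@continuous_comp _ _ _ (fun t => 2^-1 - 5 * cos (pi * t)) clamp);
  last exact: continuous_clamp.
apply: cvgB; first exact: cvg_cst.
apply: cvgMr; apply: (@continuous_comp _ _ _ (fun t => pi * t) cos); last exact: continuous_cos.
by apply: cvgMr; exact: cvg_id.
Qed.

(** The crude bounds 1 - cos u <= u^2 / 2 and pi <= 4 give cos >= 1 - 8/9. This fixes the factor 5
    in [pulse]: 1/2 - 5/9 <= 0 and 1/2 + 5/9 >= 1, so the clamp saturates on both outer thirds. *)
Lemma cos_pi_third s : 0 <= s <= 3^-1 -> 9^-1 <= cos (pi * s).
Proof.
move=> /andP[s0 s1]; have := oneBcos_sqr (pi * s).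
have p0 : 0 <= pi :> R by exact: pi_ge0.
have p4 : pi <= 4 :> R by have [/andP[_]] := @pihalf_02_cos_pihalf R; lra.
have h0 : 0 <= pi * s by rewrite mulr_ge0.
have h1 : pi * s <= 4 / 3 by apply: ler_pM.
have h2 : (pi * s) ^+ 2 <= (4 / 3) ^+ 2 by rewrite lerXn2r// nnegrE; lra.
lra.
Qed.

Lemma pulse_digit (m : nat) s (b : bool) : 0 <= s <= 1 ->
  pulse (2 * m%:R + (2 / 3 * b%:R + s / 3)) = b%:R.
Proof.
move=> s01; rewrite /pulse.
set u := 2 / 3 * _ + _.
have -> : cos (pi * (2 * m%:R + u)) = cos (pi * u).
  have -> : pi * (2 * m%:R + u) = pi * u + (pi *+ 2) *+ m.
    by rewrite -[_ *+ m]mulr_natr -[pi *+ 2]mulr_natr; ring.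
  by rewrite (periodicn (@cosD2pi R)).
case: b @u => u.
  have uE : u = 1 - (1 - s) / 3 by rewrite /u mulr1; field.
  rewrite clamp_ge1// uE mulrBr mulr1 -cosN opprB.
  have := @cos_pi_third ((1 - s) / 3); rewrite -cosN => H.
  suff -> : pi * ((1 - s) / 3) - pi = - (pi - pi * ((1 - s) / 3)) by
    rewrite cosN cosB cospi sinpi mul0r addr0 mulN1r; have := @cos_pi_third ((1 - s) / 3) _; lra.
  by rewrite opprB.
have uE : u = s / 3 by rewrite /u mulr0 add0r.
by rewrite clamp_le0// uE; have := @cos_pi_third (s / 3) _; lra.
Qed.

Let h01 : 0 <= (2^-1 : R) < 1. Proof. by apply/andP; split; lra. Qed.
Let t01 : 0 <= (3^-1 : R) < 1. Proof. by apply/andP; split; lra. Qed.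

Definition schoenberg (i : nat) t := geolim 2^-1 (fun k => pulse (3 ^+ (2 * k + i) * t)).

(** A uniform limit of continuous functions: the tail after n terms is at most 2^-n whatever the
    argument. *)
Lemma continuous_schoenberg i : continuous (schoenberg i : R -> R).
Proof.
move=> x; apply/cvgrPdist_le => e e0.
have g0 : (2^-1 : R) ^+ n @[n --> \oo] --> (0 : R).
  by apply: cvg_expr; rewrite ger0_norm; lra.
have e3 : 0 < e / 3 by rewrite divr_gt0.
have /filter_ex[n ne] : \forall n \near \oo, (2^-1 : R) ^+ n <= e / 3.
  move/cvgrPdist_le: g0 => /(_ _ e3); apply: filterS => n.
  by rewrite sub0r normrN; apply: le_trans; exact: ler_norm.
pose p y := geosum 2^-1 (fun k => pulse (3 ^+ (2 * k + i) * y)) n.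
have ck (k : nat) : continuous (fun y : R => pulse (3 ^+ (2 * k + i) * y)).
  apply: (@continuousT_comp R (fun y => 3 ^+ (2 * k + i) * y) pulse).
    by move=> y; apply: cvgMr; exact: cvg_id.
  exact: continuous_pulse.
have cp : {for x, continuous p}.
  rewrite /p /geosum; apply: cvg_big => [|k _]; first exact: add_continuous.
  by apply: cvgMl; exact: ck.
have B y : p y <= schoenberg i y <= p y + 2^-1 ^+ n.
  by apply: geosum_bounds => // k; exact: clamp01.
move/cvgrPdist_le: cp => /(_ _ e3); apply: filterS => y.
have /andP[] := B x; have /andP[] := B y; move: ne.
set g := 2^-1 ^+ n; rewrite !ler_norml => ? ? ? ? ? /andP[? ?]; lra.
Qed.

Lemma schoenbergD2 i t (m : nat) : schoenberg i (t + 2 * m%:R) = schoenberg i t.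
Proof.
rewrite /schoenberg; congr geolim; apply/funext => k; rewrite /pulse; congr (clamp (_ - 5 * _)).
have -> : pi * (3 ^+ (2 * k + i) * (t + 2 * m%:R)) =
    pi * (3 ^+ (2 * k + i) * t) + (pi *+ 2) *+ (3 ^ (2 * k + i) * m).
  by rewrite -[pi *+ 2 *+ _]mulr_natr -[pi *+ 2]mulr_natr natrM natrX; ring.
by rewrite (periodicn (@cosD2pi R)).
Qed.

(** The parameter t is the point of the Cantor set whose ternary digits interleave, up to doubling,
    the binary digits of x and y. *)
Lemma schoenberg_surj x y : 0 <= x <= 1 -> 0 <= y <= 1 ->
  exists t, [/\ 0 <= t <= 1, schoenberg 0 t = x & schoenberg 1 t = y].
Proof.
move=> /binary_digits[bx <-] /binary_digits[by_ <-].
pose e k := if odd k then by_ k./2 else bx k./2.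
pose tail k : R := geolim 3^-1 (fun j => (e (k + j)%N)%:R).
have e01 k j : 0 <= ((e (k + j)%N)%:R : R) <= 1 by case: (e _); rewrite /= ?lexx ?ler01.
have tailS k : tail k = 2 / 3 * (e k)%:R + tail k.+1 / 3.
  rewrite /tail geolimS// addn0.
  have -> : (fun j => (e (k + j)%N)%:R : R) \o succn = (fun j => (e (k.+1 + j)%N)%:R : R).
    by apply/funext => j /=; rewrite addnS.
  by field.
have tail01 k : 0 <= tail k <= 1 by exact: geolim01.
(* Multiplication by 3^k shifts the expansion; since ternary digits are 0 or 2, the integer part is
   even and the period 2 of [pulse] removes it. *)
have E k : exists m : nat, 3 ^+ k * tail 0 = 2 * m%:R + tail k.
  elim: k => [|k [m ih]]; first by exists 0%N; rewrite expr0 mul1r mulr0 add0r.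
  exists (3 * m + e k)%N; rewrite exprS -mulrA ih tailS natrD natrM; by field.
have P k : pulse (3 ^+ k * tail 0) = (e k)%:R.
  by have [m ->] := E k; rewrite tailS pulse_digit.
exists (tail 0%N); split => //; rewrite /schoenberg; congr geolim; apply/funext => k.
  by rewrite P /e addn0 mul2n odd_double doubleK.
by rewrite P /e addn1 mul2n /= odd_double /= uphalf_double.
Qed.

End schoenberg.

(** * Borel sets and continuous functions on the plane *)

Section borel_plane.
Context {R : realType}.

(** Measurable sets of the plane are those of the product sigma-algebra; an open set is the
    countable union of the boxes with rational centre and radius 1 / (n + 1) that it contains. *)
Lemma open_measurable2 (A : set (R * R)) : open A -> measurable A.
Proof.
move=> oA.
pose box (i : rat * rat * nat) : set (R * R) :=
  ball (ratr i.1.1 : R) i.2.+1%:R^-1 `*` ball (ratr i.1.2 : R) i.2.+1%:R^-1.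
pose F i := if `[< box i `<=` A >] then box i else set0.
rewrite (_ : A = \bigcup_i F i).
  apply: countable_bigcupT_measurable => //= i; rewrite /F; case: asboolP => // _.
  by apply: measurableX; rewrite ball_itv; exact: measurable_itv.
apply/seteqP; split => z; last by move=> [i _]; rewrite /F; case: asboolP => [bA /bA|].
move=> Az; have /nbhs_ballP[e /= e0 eA] : nbhs z A by exact: open_nbhs_nbhs.
pose n := Num.truncn (2 / e).
have n0 : 0 < n.+1%:R :> R by rewrite ltr0n.
have ne : n.+1%:R^-1 + n.+1%:R^-1 <= e.
  have : 2 / e < n.+1%:R by exact: truncnS_gt.
  rewrite ltr_pdivrMr// => /ltW h.
  have -> : n.+1%:R^-1 + n.+1%:R^-1 = 2 / n.+1%:R :> R by rewrite mulr_natl mulr2n.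
  by rewrite ler_pdivrMr// mulrC.
have [p pz] := @rat_in_itvoo R (z.1 - n.+1%:R^-1) (z.1 + n.+1%:R^-1) ltac:(
  by rewrite ltrBlDr -addrA ltrDl addr_gt0// invr_gt0).
have [q qz] := @rat_in_itvoo R (z.2 - n.+1%:R^-1) (z.2 + n.+1%:R^-1) ltac:(
  by rewrite ltrBlDr -addrA ltrDl addr_gt0// invr_gt0).
have zbox : box (p, q, n) z.
  by split; rewrite /ball /= ltr_distl; [move: pz|move: qz]; rewrite in_itv.
exists (p, q, n) => //; rewrite /F asboolT// => y [y1 y2]; apply: eA.
have [z1 z2] := zbox; split; move: y1 y2 z1 z2; rewrite /ball /= => y1 y2 z1 z2.
- rewrite (_ : _ - _ = (ratr p - y.1) - (ratr p - z.1)); last by ring.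
  by rewrite (le_lt_trans (ler_normB _ _))// (lt_le_trans _ ne)// ltrD.
- rewrite (_ : _ - _ = (ratr q - y.2) - (ratr q - z.2)); last by ring.
  by rewrite (le_lt_trans (ler_normB _ _))// (lt_le_trans _ ne)// ltrD.
Qed.

Lemma closed_measurable2 (A : set (R * R)) : closed A -> measurable A.
Proof. by move=> /closed_openC /open_measurable2 /measurableC; rewrite setCK. Qed.

Lemma continuous_measurable_fun2 (f : R * R -> R) : continuous f -> measurable_fun setT f.
Proof.
move=> cf _; apply: (measurability _ (RGenOInfty.measurableE R)) => //.
move=> /= _ [_ [x ->] <-]; rewrite setTI; apply: open_measurable2.
by apply: open_comp; [move=> z _; exact: cf|exact: interval_open].
Qed.

Lemma measurable_norm_gt (K : R) : measurable [set z : R * R | K < `|z.1| \/ K < `|z.2|].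
Proof.
rewrite (_ : mkset _ = (Num.norm \o fst) @^-1` `]K, +oo[ `|` (Num.norm \o snd) @^-1` `]K, +oo[).
  apply: measurableU; rewrite -[X in measurable X]setTI;
    exact: (measurableT_comp (@normr_measurable R setT)).
by apply/seteqP; split => z /=; rewrite !in_itv /= !andbT.
Qed.

Lemma bmeas_continuous2 (f : R * R -> R) : continuous f -> bounded_fun f -> bmeas f.
Proof.
move=> cf [B [_ fB]]; split; first exact: continuous_measurable_fun2.
by exists (`|B| + 1) => z; apply: fB => //; rewrite (le_lt_trans (ler_norm B))// ltrDl.
Qed.

End borel_plane.

(** * A curve covering the plane and a Borel right inverse *)

Section plane_filling_curve.
Context {R : realType}.
Implicit Types t : R.

(* [amplitude] equals m on [2m, 2m + 1], an interval on which the curve below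
   covers the square [-m, m]^2. *)
Definition amplitude t : R := \sum_(m < (Num.truncn t).+1) clamp (t - 2 * m%:R - 1).

(** Terms of index m >= t vanish, so the number of terms can be frozen near any point; continuity
    follows from this. *)
Lemma amplitudeE t (N : nat) : t <= N%:R -> amplitude t = \sum_(m < N) clamp (t - 2 * m%:R - 1).
Proof.
have H (N' : nat) : t <= N'%:R -> forall j,
    \sum_(m < N' + j) clamp (t - 2 * m%:R - 1) = \sum_(m < N') clamp (t - 2 * m%:R - 1).
  move=> tN; elim=> [|j ih]; first by rewrite addn0.
  rewrite addnS big_ord_recr /= ih clamp_le0 ?addr0// natrD.
  by have := ler0n R j; have := ler0n R N'; lra.
move=> tN; have tN' : t <= (Num.truncn t).+1%:R by apply/ltW; exact: truncnS_gt.
rewrite /amplitude -(H N tN (Num.truncn t).+1) -(H _ tN' N).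
by rewrite addnC.
Qed.

Lemma continuous_amplitude : continuous (amplitude : R -> R).
Proof.
move=> x; pose N := (Num.truncn x).+1.
have xN : x < N%:R by exact: truncnS_gt.
have ck (k : nat) : continuous (fun y : R => clamp (y - 2 * k%:R - 1)).
  apply: (@continuousT_comp R (fun y => y - 2 * k%:R - 1) clamp); last exact: continuous_clamp.
  by move=> y; apply: cvgB; [apply: cvgB; [exact: cvg_id|exact: cvg_cst]|exact: cvg_cst].
have cS : continuous (fun y : R => \sum_(m < N) clamp (y - 2 * m%:R - 1)).
  move=> y; apply: cvg_big => [|k _]; first exact: add_continuous.
  exact: ck.
rewrite /continuous_at (amplitudeE (ltW xN)).
apply: cvg_trans (cS x); apply: near_eq_cvg.
near=> y; rewrite (@amplitudeE y N)//; apply/ltW; near: y.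
exact: lt_nbhsl.
Unshelve. all: by end_near. Qed.

Lemma amplitude_nat (m : nat) t : 0 <= t <= 1 -> amplitude (t + 2 * m%:R) = m%:R.
Proof.
move=> /andP[t0 t1].
have tN : t + 2 * m%:R <= (m + m.+1)%:R by rewrite natrD -natr1; lra.
rewrite (amplitudeE tN) big_split_ord /= [X in _ + X]big1 ?addr0.
  rewrite -[RHS](mulr1 m%:R) -[in RHS](card_ord m) -sumr_const mulr_suml.
  apply: eq_bigr => i _; rewrite mul1r clamp_ge1//.
  have : (i.+1%:R : R) <= m%:R by rewrite ler_nat.
  by rewrite -natr1; lra.
move=> i _; rewrite clamp_le0//= natrD; have := ler0n R i; lra.
Qed.

Definition curve t : R * R :=
  (amplitude t * (2 * schoenberg 0 t - 1), amplitude t * (2 * schoenberg 1 t - 1)).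

Let continuous_coordinate i : continuous (fun t => amplitude t * (2 * schoenberg i t - 1)).
Proof.
move=> x; apply: cvgM; first exact: continuous_amplitude.
apply: cvgB; last exact: cvg_cst.
by apply: cvgMr; exact: continuous_schoenberg.
Qed.

Lemma continuous_curve : continuous curve.
Proof.
move=> x; exact: (cvg_pair (@continuous_coordinate 0%N x) (@continuous_coordinate 1%N x)).
Qed.

Lemma measurable_curve : measurable_fun setT curve.
Proof.
apply: measurable_fun_pair; apply: continuous_measurable_fun; exact: continuous_coordinate.
Qed.

Lemma curve_surj (m : nat) (z : R * R) : (0 < m)%N -> `|z.1| <= m%:R -> `|z.2| <= m%:R ->
  exists t, [/\ 0 <= t, t <= 2 * m%:R + 1 & curve t = z].
Proof.
move=> m0 z1 z2; have mR : 0 < m%:R :> R by rewrite ltr0n.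
have H (x : R) : `|x| <= m%:R -> 0 <= (x / m%:R + 1) / 2 <= 1.
  move=> xm; have : `|x / m%:R| <= 1.
    by rewrite normrM normfV (gtr0_norm mR) ler_pdivrMr// mul1r.
  by rewrite ler_norml => /andP[? ?]; apply/andP; split; lra.
have [t [t01 tx ty]] := schoenberg_surj (H _ z1) (H _ z2).
exists (t + 2 * m%:R); split.
- by case/andP: t01 => ? _; rewrite addr_ge0// mulr_ge0.
- by case/andP: t01 => _ ?; lra.
- rewrite /curve !schoenbergD2 amplitude_nat// tx ty [RHS]surjective_pairing.
  by congr (_, _); field; rewrite gt_eqF.
Qed.

Let above (z : R * R) := [set t : R | 0 <= t /\ curve t = z].

Let above_nonempty z : above z !=set0.
Proof.
pose m := (Num.truncn (`|z.1| + `|z.2|)).+1.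
have zm : `|z.1| + `|z.2| < m%:R by exact: truncnS_gt.
have [|||t [t0 _ tz]] := @curve_surj m z => //.
- by have := normr_ge0 z.2; lra.
- by have := normr_ge0 z.1; lra.
- by exists t.
Qed.

Let above_inf z : has_inf (above z).
Proof. by split; [exact: above_nonempty|exists 0 => t []]. Qed.

(** A Borel right inverse of [curve]: it carries functionals on the plane to the half-line, and
    [curve] brings the limit back. *)
Definition first_time (z : R * R) : R := inf (above z).

Lemma first_time_le z t : 0 <= t -> curve t = z -> first_time z <= t.
Proof. by move=> t0 tz; apply: inf_lbound => //; case: (above_inf z). Qed.

Lemma first_time_ge0 z : 0 <= first_time z.
Proof. by apply: lb_le_inf; [exact: above_nonempty|move=> t []]. Qed.

(** The infimum is attained: times above z that approach it are all mapped to z, and the curve is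
    continuous. *)
Lemma curve_first_time z : curve (first_time z) = z.
Proof.
have H (n : nat) : exists t, above z t /\ `|first_time z - t| <= n.+1%:R^-1.
  have n0 : 0 < (n.+1%:R^-1 : R) by rewrite invr_gt0 ltr0n.
  have [t [t0 tz] tlt] := inf_adherent n0 (above_inf z).
  exists t; split => //; have := first_time_le t0 tz => tge.
  by rewrite distrC ger0_norm ?subr_ge0// lerBlDr addrC ltW.
pose u n := projT1 (cid (H n)).
have uz n : curve (u n) = z by have [[]] := projT2 (cid (H n)).
have uc : u @ \oo --> first_time z.
  apply/cvgrPdist_le => e e0; near=> n.
  have [_ h] := projT2 (cid (H n)); apply: le_trans h _.
  by apply/ltW; near: n; exact: (near_infty_natSinv_lt (PosNum e0)).
have cu : curve \o u @ \oo --> curve (first_time z).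
  by apply: continuous_cvg => //; exact: continuous_curve.
have e : curve \o u = fun=> z by apply/funext => n; exact: uz.
rewrite e in cu.
by apply: (cvg_unique _ cu (cvg_cst _)); exact: norm_hausdorff.
Unshelve. all: by end_near. Qed.

(** The set where the first time is at most x is the image of the segment [0, x], hence compact and
    closed. *)
Lemma measurable_first_time : measurable_fun setT first_time.
Proof.
move=> _; apply: (measurability _ (RGenOInfty.measurableE R)) => //.
move=> /= _ [_ [x ->] <-]; rewrite setTI.
rewrite (_ : _ @^-1` _ = ~` (curve @` `[0, x])); last first.
  apply/seteqP; split => z /=; rewrite in_itv /= andbT.
    move=> xz [t]; rewrite in_itv /= => /andP[t0 tx] tz.
    by have := first_time_le t0 tz; lra.
  move=> nz; rewrite ltNge; apply/negP => zx; apply: nz; exists (first_time z).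
    by rewrite /= in_itv /= first_time_ge0.
  exact: curve_first_time.
apply: measurableC; apply: closed_measurable2; apply: compact_closed.
  exact: norm_hausdorff.
apply: continuous_compact; last exact: segment_compact.
apply: continuous_subspaceT; exact: continuous_curve.
Qed.

End plane_filling_curve.

(** * Helly's theorem in the plane *)

Section helly_plane.
Context (R : realType) (U : set_system nat) {UU : UltraFilter U}.

(** Every f factors as (f o curve) o first_time with f o curve continuous. Tightness transfers
    because the square of half-side m is covered before time 2 m + 1. *)
Lemma helly_plane (L : nat -> (R * R -> R) -> R) (C : R) :
  (forall k, plin (L k)) -> (\forall k \near U, L k (fun=> 1) <= C) ->
  (forall e : R, 0 < e -> exists K : R,
    \forall k \near U, L k (\1_[set z | K < `|z.1| \/ K < `|z.2|]) <= e) ->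
  exists (M : R) (V : R -> R * R), [/\ 0 <= M, measurable_fun setT V &
    forall f : R * R -> R, continuous f -> bounded_fun f ->
    L k f @[k --> U] --> \int[lebesgue_measure]_(w in `[0, M[) f (V w)].
Proof.
move=> pL L1 tight.
have [|M [q [M0 mq H]]] :=
    helly_real pL L1 measurable_first_time first_time_ge0.
  move=> e /tight[K hK].
  pose m := (Num.truncn K).+1.
  have Km : K < m%:R by exact: truncnS_gt.
  exists (2 * m%:R + 1); apply: filterS hK => k; apply: le_trans.
  apply: (plin_le (pL k)).
  - apply: bmeas_indic; rewrite -[X in measurable X]setTI.
    rewrite (_ : [set _ | _] = first_time @^-1` `]2 * m%:R + 1, +oo[).
      exact: measurable_first_time.
    by apply/seteqP; split => z /=; rewrite in_itv /= andbT.
  - by apply: bmeas_indic; exact: measurable_norm_gt.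
  - move=> z; rewrite !indicE ler_nat.
    have [h|h] := pselect (K < `|z.1| \/ K < `|z.2|).
      by rewrite [X in (_ <= nat_of_bool X)%N]mem_set ?leq_b1.
    rewrite memNset// => zt; apply: h.
    have [h1|h1] := ltP K `|z.1|; first by left.
    have [h2|h2] := ltP K `|z.2|; first by right.
    have [|||t [t0 tm tz]] := @curve_surj R m z => //.
    + exact: le_trans h1 (ltW Km).
    + exact: le_trans h2 (ltW Km).
    + by have := first_time_le t0 tz; move: zt => /=; lra.
exists M, (fun w => curve (q w)); split => //.
  exact: (measurableT_comp measurable_curve).
move=> f cf [B [Breal fB]].
have -> : (fun k => L k f) = fun k => L k ((f \o curve) \o first_time).
  apply/funext => k; congr (L k); apply/funext => z /=.
  by rewrite curve_first_time.
apply: (H (f \o curve)).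
  by move=> x; apply: continuous_comp; [exact: continuous_curve|exact: cf].
by exists B; split => // x Bx y _; exact: fB.
Qed.

End helly_plane.

(** * Complex exponential and the limit of powers *)

Section complex_exponential.
Context {R : realType}.
Implicit Types (z : R[i]) (x y : R).
Local Open Scope complex_scope.

Lemma cexpE x y : cexp (x +i* y) = (expR x * cos y) +i* (expR x * sin y).
Proof. by rewrite /cexp /=; apply/eqP; rewrite eq_complex /=; apply/andP; split; apply/eqP; ring. Qed.

Lemma cexp_i x : cexp ('i%C * x%:C) = cos x +i* sin x.
Proof.
have -> : 'i%C * x%:C = 0 +i* x :> R[i].
  by apply/eqP; rewrite eq_complex /=; apply/andP; split; apply/eqP; ring.
by rewrite cexpE expR0 !mul1r.
Qed.

Lemma cexpD z1 z2 : cexp (z1 + z2) = cexp z1 * cexp z2.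
Proof.
case: z1 z2 => [x1 y1] [x2 y2]; rewrite !cexpE.
rewrite expRD cosD sinD.
by apply/eqP; rewrite eq_complex /=; apply/andP; split; apply/eqP; ring.
Qed.

Lemma cexp0 : cexp 0 = 1 :> R[i].
Proof. by rewrite (_ : 0 = 0 +i* 0)// cexpE expR0 cos0 sin0 !mul1r. Qed.

Lemma cexpX z n : cexp z ^+ n = cexp (z *+ n).
Proof.
elim: n => [|n ih]; first by rewrite expr0 mulr0n cexp0.
by rewrite exprS mulrS cexpD ih.
Qed.

Lemma cexp_sum (I : Type) (r : seq I) (F : I -> R[i]) :
  cexp (\sum_(i <- r) F i) = \prod_(i <- r) cexp (F i).
Proof.
elim: r => [|i r ih]; first by rewrite !big_nil cexp0.
by rewrite !big_cons cexpD ih.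
Qed.

Lemma normc_cexp z : `|cexp z| = (expR (complex.Re z))%:C.
Proof.
case: z => x y; rewrite cexpE normc_def /=.
have -> : (expR x * cos y) ^+ 2 + (expR x * sin y) ^+ 2 = expR x ^+ 2.
  by rewrite !exprMn -mulrDr cos2Dsin2 mulr1.
by rewrite sqrtr_sqr ger0_norm// expR_ge0.
Qed.

Lemma normc_le_add z : `|z| <= (`|complex.Re z| + `|complex.Im z|)%:C.
Proof.
case: z => x y /=.
have -> : x +i* y = x%:C + 'i%C * y%:C.
  by apply/eqP; rewrite eq_complex /=; apply/andP; split; apply/eqP; ring.
rewrite (le_trans (ler_normD _ _))// rmorphD /= lerD//.
  by rewrite normc_def /= expr0n addr0 sqrtr_sqr.
have -> : 'i%C * y%:C = 0 +i* y.
  by apply/eqP; rewrite eq_complex /=; apply/andP; split; apply/eqP; ring.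
by rewrite normc_def /= expr0n add0r sqrtr_sqr.
Qed.

Lemma abs_Re_le z (x : R) : `|z| <= x%:C -> `|complex.Re z| <= x.
Proof. by move=> zx; rewrite -lecR (le_trans (normc_ge_Re z)). Qed.

Lemma abs_Im_le z (x : R) : `|z| <= x%:C -> `|complex.Im z| <= x.
Proof.
case: z => a b; rewrite normc_def lecR /=; apply: le_trans.
by rewrite -sqrtr_sqr ler_wsqrtr// lerDr sqr_ge0.
Qed.

Lemma complexMn x y n : (x +i* y) *+ n = (n%:R * x) +i* (n%:R * y).
Proof.
elim: n => [|n ih]; first by rewrite mulr0n !mul0r.
by rewrite mulrS ih -natr1; apply/eqP; rewrite eq_complex /=; apply/andP; split; apply/eqP; ring.
Qed.

Lemma norm_subX_le (K : numDomainType) (a b : K) n : `|a| <= 1 -> `|b| <= 1 ->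
  `|a ^+ n - b ^+ n| <= `|a - b| *+ n.
Proof.
move=> a1 b1; elim: n => [|n ih]; first by rewrite !expr0 subrr normr0 mulr0n.
have -> : a ^+ n.+1 - b ^+ n.+1 = a * (a ^+ n - b ^+ n) + (a - b) * b ^+ n.
  by rewrite !exprS; ring.
rewrite mulrS [leRHS]addrC (le_trans (ler_normD _ _))// lerD//.
  by rewrite normrM (le_trans _ ih)// ler_piMl.
by rewrite normrM ler_piMr// normrX exprn_ile1.
Qed.

Lemma expR_sub_le x : x <= 0 -> expR x - 1 - x <= x ^+ 2.
Proof.
move=> x0; have h := expR_ge1Dx (- x).
have p : 0 < expR x by exact: expR_gt0.
have e1 : expR x * expR (- x) = 1 by rewrite -expRD subrr expR0.
have h2 : expR x * (1 - x) <= 1 by rewrite -[leRHS]e1 ler_wpM2l// ltW.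
have h3 := expR_ge1Dx x; nra.
Qed.

Lemma cexp_sub_le x y : x <= 0 ->
  `|(1 + x) +i* y - cexp (x +i* y)| <= (3 * (x ^+ 2 + y ^+ 2))%:C.
Proof.
move=> x0; apply: le_trans (normc_le_add _) _; rewrite cexpE /= lecR.
have p : 0 < expR x by exact: expR_gt0.
have p1 : expR x <= 1 by rewrite -expR0 ler_expR.
have h1 := expR_sub_le x0; have h1' := expR_ge1Dx x.
have h2 := oneBcos_sqr y; have h2' := oneBcos_ge0 y.
have h3 := abs_sin_sub_le y; have h4 := abs_sin_le y.
have A : `|1 + x - expR x * cos y| <= x ^+ 2 + y ^+ 2 / 2.
  have -> : 1 + x - expR x * cos y = expR x * (1 - cos y) - (expR x - 1 - x) by ring.
  have h5 : expR x * (1 - cos y) <= 1 - cos y by rewrite ler_piMl.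
  have h6 : 0 <= expR x * (1 - cos y) by rewrite mulr_ge0// ltW.
  by rewrite ler_norml; apply/andP; split; lra.
have B : `|y - expR x * sin y| <= y ^+ 2 + (x ^+ 2 + y ^+ 2) / 2.
  have -> : y - expR x * sin y = - (sin y - y) + (1 - expR x) * sin y by ring.
  rewrite (le_trans (ler_normD _ _))// normrN lerD// normrM.
  apply: (@le_trans _ _ (`|x| * `|y|)).
    by apply: ler_pM => //; rewrite ger0_norm ?ler0_norm//; lra.
  rewrite -[x ^+ 2]real_normK ?num_real// -[y ^+ 2]real_normK ?num_real//.
  by have := sqr_ge0 (`|x| - `|y|); rewrite sqrrB; lra.
by lra.
Qed.

(** The complex form of (1 + c / N)^N -> exp c, without logarithm. Since |z| <= 1 forces x = Re z -
    1 <= 0, both z and exp (x + i y) lie in the unit disk, and telescoping bounds the difference of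
    N-th powers by 3 N (x^2 + y^2), which is of order 1 / N. *)
Lemma cvg_complex_power (U : set_system nat) {FU : ProperFilter U}
    (z : nat -> R[i]) (N : nat -> nat) (xi eta : R) :
  (forall k, `|z k| <= 1) -> ((N k)%:R : R) @[k --> U] --> +oo ->
  (N k)%:R * (complex.Re (z k) - 1) @[k --> U] --> xi ->
  (N k)%:R * complex.Im (z k) @[k --> U] --> eta ->
  complex.Re (z k ^+ N k) @[k --> U] --> complex.Re (cexp (xi +i* eta)) /\
  complex.Im (z k ^+ N k) @[k --> U] --> complex.Im (cexp (xi +i* eta)).
Proof.
move=> z1 Noo zx zy.
pose x k := complex.Re (z k) - 1; pose y k := complex.Im (z k).
have zE k : z k = (1 + x k) +i* y k.
  by rewrite /x /y; case: (z k) => a b /=; congr (_ +i* _); ring.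
have x0 k : x k <= 0.
  rewrite subr_le0 (le_trans (ler_norm _))//; apply: abs_Re_le; exact: z1.
pose d k : R := (N k)%:R * (3 * (x k ^+ 2 + y k ^+ 2)).
have dE k : `|z k ^+ N k - cexp (((N k)%:R * x k) +i* ((N k)%:R * y k))| <= (d k)%:C.
  rewrite -complexMn -cexpX; apply: le_trans (norm_subX_le _ (z1 k) _) _.
    by rewrite normc_cexp -[leRHS]/((1 : R)%:C) lecR -[leRHS]expR0 ler_expR /=.
  rewrite -mulr_natl /d rmorphM rmorph_nat ler_wpM2l// {1}zE.
  exact: cexp_sub_le.
have d0 : d k @[k --> U] --> 0.
  have iN : ((N k)%:R^-1 : R) @[k --> U] --> (0 : R).
    by apply/(gtr0_cvgV0 (f := fun k => (N k)%:R)) => //; move/cvgryPgt: Noo => /(_ 0).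
  have : 3 * (((N k)%:R * x k) ^+ 2 + ((N k)%:R * y k) ^+ 2) * (N k)%:R^-1 @[k --> U] -->
         3 * (xi ^+ 2 + eta ^+ 2) * 0.
    apply: cvgM => //; apply: cvgMr; apply: cvgD.
      by under eq_fun do rewrite expr2; rewrite expr2; apply: cvgM.
    by under eq_fun do rewrite expr2; rewrite expr2; apply: cvgM.
  rewrite mulr0; apply: cvg_trans; apply: near_eq_cvg; near=> k.
  rewrite /d; field; have : 0 < (N k)%:R :> R by near: k; move/cvgryPgt: Noo; exact.
  by move=> /gt_eqF ->.
have cRe : expR ((N k)%:R * x k) * cos ((N k)%:R * y k) @[k --> U] --> expR xi * cos eta.
  apply: cvgM; apply: continuous_cvg => //; [exact: continuous_expR|exact: continuous_cos].
have cIm : expR ((N k)%:R * x k) * sin ((N k)%:R * y k) @[k --> U] --> expR xi * sin eta.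
  apply: cvgM; apply: continuous_cvg => //; [exact: continuous_expR|exact: continuous_sin].
have sq (u v : nat -> R) (l : R) : (forall k, `|u k - v k| <= d k) -> v @ U --> l -> u @ U --> l.
  move=> uv vl; have -> : u = fun k => v k + (u k - v k) by apply/funext => k; ring.
  rewrite -(addr0 l); apply: cvgD => //.
  apply/cvgrPdist_le => e e0; near=> k.
  rewrite sub0r normrN (le_trans (uv k))//.
  have : `|0 - d k| <= e by near: k; move/cvgrPdist_le: d0; exact.
  by rewrite sub0r normrN; apply: le_trans; exact: ler_norm.
rewrite cexpE /=; split.
- apply: sq cRe => k; have := dE k; rewrite cexpE => /abs_Re_le.
  by case: (_ ^+ _) => a b; rewrite /=.
- apply: sq cIm => k; have := dE k; rewrite cexpE => /abs_Im_le.
  by case: (_ ^+ _) => a b; rewrite /=.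
Unshelve. all: by end_near. Qed.

End complex_exponential.

(** * Laws and expectations of bounded functions *)

Section laws.
Context (R : realType).

Lemma bmeas_integrable (d : measure_display) (T : measurableType d) (P : probability T R)
    (f : T -> R) : bmeas f -> P.-integrable setT (EFin \o f).
Proof.
move=> [mf [M fM]]; apply: measurable_bounded_integrable => //; first by rewrite fin_num_fun_lty.
exists M; split; first exact: num_real.
by move=> x /ltW Mx z _; exact: le_trans (fM z) Mx.
Qed.

Lemma bint_expectation (d dE : measure_display) (T : measurableType d) (E : measurableType dE)
    (P : probability T R) (X : T -> E) : measurable_fun setT X ->
  bint (fun f : E -> R => \int[P]_w f (X w)).
Proof.
move=> mX; have := @bint_Rintegral R _ E _ T P setT X (fun=> 1) measurableT mX
  (finite_measure_integrable_cst P 1 measurableT).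
by congr bint; apply/funext => f; apply: eq_Rintegral => w _; rewrite mulr1.
Qed.

Lemma bint_mean (d : measure_display) (T : measurableType d) (P : probability T R) :
  bint (fun f : T -> R => \int[P]_w f w).
Proof. by apply: (@bint_expectation _ _ T T P idfun); exact: measurable_id. Qed.

Lemma Rintegral_probability_cst (d : measure_display) (T : measurableType d) (P : probability T R) (c : R) :
  \int[P]_w c = c.
Proof.
have e : P setT = 1%E by exact: probability_setT.
by rewrite Rintegral_cst// [X in fine X]e mulr1.
Qed.

Lemma norm_expectation_le (d : measure_display) (T : measurableType d) (P : probability T R)
    (f : T -> R) (M : R) : bmeas f -> (forall w, `|f w| <= M) -> `|\int[P]_w f w| <= M.
Proof.
move=> bf fM; apply: (le_trans (le_normr_Rintegral measurableT (bmeas_integrable P bf))).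
rewrite -[leRHS](Rintegral_probability_cst P); apply: le_Rintegral => //.
- exact: (integrable_norm (bmeas_integrable P bf)).
- by apply: bmeas_integrable; exact: bmeas_cst.
Qed.

Lemma expectation_indic (d dE : measure_display) (T : measurableType d) (E : measurableType dE)
    (P : probability T R) (X : T -> E) (A : set E) : measurable_fun setT X -> measurable A ->
  \int[P]_w (\1_A (X w) : R) = fine (P (X @^-1` A)).
Proof.
move=> mX mA; rewrite /Rintegral; congr fine.
have mXA : measurable (X @^-1` A) by rewrite -[X in measurable X]setTI; exact: mX.
by have := integral_indic P measurableT mXA; rewrite setIT.
Qed.

Lemma same_law_Rintegral (d1 d2 d : measure_display) (S : measurableType d1)
    (T : measurableType d2) (E : measurableType d) (P : probability S R) (Q : probability T R)
    (X : S -> E) (Y : T -> E) : measurable_fun setT X -> measurable_fun setT Y ->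
  same_law P Q X Y -> forall f, bmeas f -> \int[P]_w f (X w) = \int[Q]_w f (Y w).
Proof.
move=> mX mY XY; apply: (bint_eq (bint_expectation P mX) (bint_expectation Q mY)) => A mA.
by rewrite !expectation_indic// XY.
Qed.

Lemma Rintegral_same_law (d1 d2 d : measure_display) (S : measurableType d1)
    (T : measurableType d2) (E : measurableType d) (P : probability S R) (Q : probability T R)
    (X : S -> E) (Y : T -> E) : measurable_fun setT X -> measurable_fun setT Y ->
  (forall f, bmeas f -> \int[P]_w f (X w) = \int[Q]_w f (Y w)) -> same_law P Q X Y.
Proof.
move=> mX mY XY A mA; have := XY _ (@bmeas_indic R _ _ A mA).
rewrite !expectation_indic// => e; have := congr1 EFin e.
have mXA : measurable (X @^-1` A) by rewrite -[X in measurable X]setTI; exact: mX.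
have mYA : measurable (Y @^-1` A) by rewrite -[X in measurable X]setTI; exact: mY.
by rewrite !fineK// fin_num_measure.
Qed.

End laws.

(** * Expectations of products of independent variables *)

Definition independent_upto (R : realType) (d dE : measure_display) (T : measurableType d)
    (E : measurableType dE) (P : probability T R) (Z : nat -> T -> E) (N : nat) :=
  forall B : nat -> set E, (forall i, measurable (B i)) ->
    P (\bigcap_(i in [set` iota 0 N]) Z i @^-1` B i) =
    (\prod_(i <- iota 0 N) P (Z i @^-1` B i))%E.

Lemma mutually_independent_upto (R : realType) (d dE : measure_display) (T : measurableType d)
    (E : measurableType dE) (P : probability T R) (Z : nat -> T -> E) (N : nat) :
  mutually_independent P Z -> independent_upto P Z N.
Proof. by move=> iZ B mB; apply: iZ => //; exact: iota_uniq. Qed.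

Section complex_expectation.
Context (R : realType) (d : measure_display) (T : measurableType d) (P : probability T R).
Local Open Scope complex_scope.
Implicit Types h k : T -> R[i].

Definition cbmeas (dE : measure_display) (E : measurableType dE) (h : E -> R[i]) :=
  bmeas (fun z => complex.Re (h z)) /\ bmeas (fun z => complex.Im (h z)).

Lemma cbmeasM (dE : measure_display) (E : measurableType dE) (h k : E -> R[i]) :
  cbmeas h -> cbmeas k -> cbmeas (fun z => h z * k z).
Proof.
move=> [h1 h2] [k1 k2]; split.
  have -> : (fun z => complex.Re (h z * k z)) = fun z =>
      complex.Re (h z) * complex.Re (k z) - complex.Im (h z) * complex.Im (k z).
    by apply/funext => z; case: (h z) (k z) => ? ? [].
  by apply: bmeasB; exact: bmeasM.
have -> : (fun z => complex.Im (h z * k z)) = fun z =>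
    complex.Re (h z) * complex.Im (k z) + complex.Im (h z) * complex.Re (k z).
  by apply/funext => z; case: (h z) (k z) => ? ? [].
by apply: bmeasD; exact: bmeasM.
Qed.

Lemma cbmeas_real (dE : measure_display) (E : measurableType dE) (f : E -> R) :
  bmeas f -> cbmeas (fun z => (f z)%:C).
Proof. by move=> bf; split => //; exact: bmeas_cst. Qed.

Lemma cbmeas_prod (dE : measure_display) (E : measurableType dE) (I : Type) (r : seq I)
    (Q : pred I) (h : I -> E -> R[i]) : (forall i, cbmeas (h i)) ->
  cbmeas (fun z => \prod_(i <- r | Q i) h i z).
Proof.
move=> bh; elim: r => [|i r ih].
  by under eq_fun do rewrite big_nil; split; exact: bmeas_cst.
have [Qi|Qi] := boolP (Q i).
  by under eq_fun do rewrite big_cons Qi; exact: cbmeasM.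
by under eq_fun do rewrite big_cons (negbTE Qi).
Qed.

Lemma bmeas_comp (dE : measure_display) (E : measurableType dE) (Z : T -> E) (f : E -> R) :
  measurable_fun setT Z -> bmeas f -> bmeas (fun w => f (Z w)).
Proof.
by move=> mZ [mf [M fM]]; split; [exact: measurableT_comp|exists M].
Qed.

Lemma cbmeas_comp (dE : measure_display) (E : measurableType dE) (Z : T -> E) (h : E -> R[i]) :
  measurable_fun setT Z -> cbmeas h -> cbmeas (fun w => h (Z w)).
Proof. by move=> mZ [h1 h2]; split; [exact: (bmeas_comp mZ h1)|exact: (bmeas_comp mZ h2)]. Qed.

Notation cE := (cintegral P setT).

Lemma Re_scale (c : R) (z : R[i]) : complex.Re (c%:C * z) = c * complex.Re z.
Proof. by case: z => x y /=; ring. Qed.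

Lemma Im_scale (c : R) (z : R[i]) : complex.Im (c%:C * z) = c * complex.Im z.
Proof. by case: z => x y /=; ring. Qed.

Lemma cintegral_real (f : T -> R) : cE (fun w => (f w)%:C) = (\int[P]_w f w)%:C.
Proof. by rewrite /cintegral /= Rintegral_cst// mul0r. Qed.

Let bE : bint (fun f : T -> R => \int[P]_w f w).
Proof. exact: bint_mean. Qed.

(** For fixed W and K both sides are, by real and imaginary parts, [bint] functionals of a real
    function of Z, so agreement on indicators extends to all bounded functions. *)
Lemma cintegral_factor (dE : measure_display) (E : measurableType dE) (Z : T -> E)
    (W : T -> R[i]) (K : R[i]) : measurable_fun setT Z -> cbmeas W ->
  (forall B, measurable B -> cE (fun w => (\1_B (Z w))%:C * W w) =
    cE (fun w => (\1_B (Z w))%:C) * K) ->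
  forall f, cbmeas f -> cE (fun w => f (Z w) * W w) = cE (fun w => f (Z w)) * K.
Proof.
move=> mZ [W1 W2] H f [f1 f2].
pose J (V : T -> R) (u : E -> R) := \int[P]_w (u (Z w) * V w).
have bJ V : bmeas V -> bint (J V).
  move=> bV; apply: bint_Rintegral => //.
  have [mV [M VM]] := bV.
  by have := integrable_bmeasM measurableT (@measurable_id _ _ setT)
    (finite_measure_integrable_cst P (1 : R) measurableT) bV;
  congr (_.-integrable _ _); apply/funext => w /=; rewrite mulr1.
pose J1 (c : R) (u : E -> R) := (\int[P]_w u (Z w)) * c.
have bJ1 c : bint (J1 c).
  have [aD aZ aL] := bint_expectation P mZ.
  split; rewrite /J1.
  - by move=> g h bg bh; rewrite aD// mulrDl.
  - by move=> e g bg; rewrite aZ// mulrA.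
  - by move=> f_ g M bf fM ff; apply: cvgMl; exact: (aL _ _ M).
have JE (u : E -> R) : bmeas u ->
    J (fun w => complex.Re (W w)) u = J1 (complex.Re K) u /\
    J (fun w => complex.Im (W w)) u = J1 (complex.Im K) u.
  move=> bu; split.
    apply: (bint_eq (bJ _ W1) (bJ1 _)) => // B mB; have /(congr1 (@complex.Re _)) := H B mB.
    rewrite cintegral_real Re_scale /cintegral [LHS]/=.
    by under eq_Rintegral do rewrite Re_scale.
  apply: (bint_eq (bJ _ W2) (bJ1 _)) => // B mB; have /(congr1 (@complex.Im _)) := H B mB.
  rewrite cintegral_real Im_scale /cintegral [LHS]/=.
  by under eq_Rintegral do rewrite Im_scale.
have bf1 := bmeas_comp mZ f1; have bf2 := bmeas_comp mZ f2.
have [e11 e12] := JE _ f1; have [e21 e22] := JE _ f2.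
have ReE : (fun w => complex.Re (f (Z w) * W w)) = fun w =>
    complex.Re (f (Z w)) * complex.Re (W w) - complex.Im (f (Z w)) * complex.Im (W w).
  by apply/funext => w; case: (f (Z w)) (W w) => ? ? [].
have ImE : (fun w => complex.Im (f (Z w) * W w)) = fun w =>
    complex.Re (f (Z w)) * complex.Im (W w) + complex.Im (f (Z w)) * complex.Re (W w).
  by apply/funext => w; case: (f (Z w)) (W w) => ? ? [].
rewrite {1}/cintegral ReE ImE.
have -> : \int[P]_w (complex.Re (f (Z w)) * complex.Re (W w) -
    complex.Im (f (Z w)) * complex.Im (W w)) =
    J1 (complex.Re K) (fun z => complex.Re (f z)) - J1 (complex.Im K) (fun z => complex.Im (f z)).
  rewrite -e11 -e22 -mulN1r -(bintZ bE (-1)); last exact: bmeasM.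
  rewrite -(bintD bE); [|exact: bmeasM|by apply: bmeasZ; exact: bmeasM].
  by apply: eq_Rintegral => w _; rewrite mulN1r.
have -> : \int[P]_w (complex.Re (f (Z w)) * complex.Im (W w) +
    complex.Im (f (Z w)) * complex.Re (W w)) =
    J1 (complex.Im K) (fun z => complex.Re (f z)) + J1 (complex.Re K) (fun z => complex.Im (f z)).
  by rewrite -e12 -e21 -(bintD bE)//; exact: bmeasM.
by rewrite /cintegral /J1; case: K {H JE e11 e12 e21 e22}.
Qed.

(** Induction on the number j of arbitrary factors, the others being indicators. For j = 0 the claim
    is independence; each step frees one indicator by [cintegral_factor]. *)
Lemma cintegral_prod (dE : measure_display) (E : measurableType dE) (Z : nat -> T -> E) :
  (forall i, measurable_fun setT (Z i)) -> forall N, independent_upto P Z N ->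
  forall (h : nat -> E -> R[i]), (forall i, cbmeas (h i)) ->
  cE (fun w => \prod_(i < N) h i (Z i w)) = \prod_(i < N) cE (fun w => h i (Z i w)).
Proof.
move=> mZ N iZ.
have mZB i (B : set E) : measurable B -> measurable (Z i @^-1` B).
  by move=> mB; rewrite -[X in measurable X]setTI; exact: mZ.
suff H j : (j <= N)%N -> forall h : nat -> E -> R[i], (forall i, cbmeas (h i)) ->
    (forall i, (j <= i)%N -> exists2 B, measurable B & h i = fun z => (\1_B z)%:C) ->
    cE (fun w => \prod_(i < N) h i (Z i w)) = \prod_(i < N) cE (fun w => h i (Z i w)).
  (* Beyond N the functions are replaced by the indicator of the whole space, as the auxiliary
     statement asks for j = N. *)
  move=> h bh; pose h' i := if (i < N)%N then h i else fun z => (\1_(setT : set E) z)%:C.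
  have e (i : 'I_N) : h' i = h i by rewrite /h' ltn_ord.
  have -> : (fun w => \prod_(i < N) h i (Z i w)) = fun w => \prod_(i < N) h' i (Z i w).
    by apply/funext => w; apply: eq_bigr => i _; rewrite e.
  under [RHS]eq_bigr do rewrite -e.
  apply: (H N) => //.
    move=> i; rewrite /h'; case: ifP => // _; apply: cbmeas_real; exact: bmeas_indic.
  by move=> i Ni; exists setT => //; rewrite /h' ltnNge Ni.
elim: j => [_|j ih jN] h bh hj.
  have {}hj i : {B | measurable B & h i = fun z => (\1_B z)%:C} by apply: cid2; exact: hj.
  pose B i := s2val (hj i).
  have mB i : measurable (B i) := s2valP (hj i).
  have hE i : h i = fun z => (\1_(B i) z)%:C := s2valP' (hj i).
  have cE1 (A : set T) : measurable A -> cE (fun w => (\1_A w)%:C) = (fine (P A))%:C.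
    move=> mA; rewrite cintegral_real; congr (_%:C).
    exact: (expectation_indic P (@measurable_id _ _ setT) mA).
  have -> : (fun w => \prod_(i < N) h i (Z i w)) =
      fun w => (\1_(\bigcap_(i in [set` iota 0 N]) Z i @^-1` B i) w)%:C.
    apply/funext => w; under eq_bigr do rewrite hE.
    rewrite -rmorph_prod /=; congr (_%:C).
    have [Hw|Hw] := pselect ((\bigcap_(i in [set` iota 0 N]) Z i @^-1` B i) w).
      rewrite indicE mem_set// big1// => i _; rewrite indicE mem_set//.
      by apply: Hw; rewrite /= mem_iota add0n ltn_ord.
    rewrite indicE memNset//.
    have [i iN nB] : exists2 i, (i < N)%N & ~ B i (Z i w).
      apply: contrapT => nH; apply: Hw => i /=; rewrite mem_iota add0n => iN.
      by apply: contrapT => nB; apply: nH; exists i.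
    by rewrite (bigD1 (Ordinal iN))//= indicE memNset// mul0r.
  rewrite cE1; last first.
    by rewrite bigcap_seq; apply: bigsetI_measurable => i _; exact: mZB.
  under [RHS]eq_bigr do rewrite hE (cE1 (Z _ @^-1` B _) (mZB _ _ (mB _))).
  rewrite -rmorph_prod iZ//; congr (_%:C).
  rewrite -[in iota 0 N](subn0 N) -/(index_iota 0 N) big_mkord.
  have : forall i : 'I_N, true -> P (Z i @^-1` B i) = (fine (P (Z i @^-1` B i)))%:E.
    by move=> i _; rewrite fineK// fin_num_measure//; exact: mZB.
  by move=> /(eq_bigr _) ->; rewrite prodEFin.
pose o := Ordinal jN.
pose W w := \prod_(i < N | i != o) h i (Z i w).
pose K := \prod_(i < N | i != o) cE (fun w => h i (Z i w)).
have bW : cbmeas W.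
  by apply: (@cbmeas_prod _ T) => i; exact: cbmeas_comp.
rewrite (bigD1 o)//=.
have -> : (fun w => \prod_(i < N) h i (Z i w)) = fun w => h j (Z j w) * W w.
  by apply/funext => w; rewrite (bigD1 o).
apply: (@cintegral_factor _ E (Z j) W K) => // B mB.
(* An indicator at rank j leaves only j free factors, so the induction hypothesis applies to g. *)
pose g i := if i == j then fun z => (\1_B z)%:C else h i.
have gj : g j = fun z => (\1_B z)%:C by rewrite /g eqxx.
have gi (i : 'I_N) : i != o -> g i = h i by move=> io; rewrite /g ifN.
have -> : K = \prod_(i < N | i != o) cE (fun w => g i (Z i w)).
  by apply: eq_bigr => i io; rewrite gi.
have -> : (fun w => (\1_B (Z j w))%:C * W w) = fun w => \prod_(i < N) g i (Z i w).
  apply/funext => w; rewrite (bigD1 o)//= gj; congr (_ * _).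
  by apply: eq_bigr => i io; rewrite gi.
have <- : \prod_(i < N) cE (fun w => g i (Z i w)) =
    cE (fun w => (\1_B (Z j w))%:C) * \prod_(i < N | i != o) cE (fun w => g i (Z i w)).
  by rewrite (bigD1 o)//= gj.
apply: ih => //; first exact: ltnW.
  move=> i; rewrite /g; case: ifP => // _; apply: cbmeas_real; exact: bmeas_indic.
move=> i ji; rewrite /g; case: ifPn => [_|ij]; first by exists B.
by apply: hj; rewrite ltn_neqAle eq_sym ij.
Qed.

End complex_expectation.

(** * Independent pairs and Fubini's theorem *)

Lemma bmeas_partial_mean (R : realType) (d1 d2 : measure_display) (E1 : measurableType d1)
    (E2 : measurableType d2) (mu : probability E1 R) (g : E1 * E2 -> R) :
  bmeas g -> bmeas (fun y => \int[mu]_x g (x, y)).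
Proof.
move=> bg; have [mg [M gM]] := bg.
have bgy y : bmeas (fun x => g (x, y)) by split; [exact: measurableT_comp|exists M].
split; last by exists M => y; exact: norm_expectation_le.
(* Tonelli's theorem needs a nonnegative integrand, hence the shift by the bound M, undone at the
   end. *)
have mf : measurable_fun setT (fun z => (g z + M)%:E) by apply/measurable_EFinP; exact: measurable_funD.
have f0 z : (0 <= (g z + M)%:E)%E.
  by rewrite lee_fin -lerBlDr sub0r; have := gM z; rewrite ler_norml => /andP[].
have := @measurable_fun_fubini_tonelli_G _ _ _ _ _ mu _ mf f0.
have -> : fubini_G mu (fun z => (g z + M)%:E) = EFin \o (fun y => \int[mu]_x g (x, y) + M).
  apply/funext => y; rewrite /fubini_G /= -[X in (_ + X)%:E](Rintegral_probability_cst mu).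
  rewrite -RintegralD//; [|exact: bmeas_integrable|by apply: bmeas_integrable; exact: bmeas_cst].
  rewrite /Rintegral fineK//; apply: integrable_fin_num => //.
  by apply: bmeas_integrable; apply: bmeasD => //; exact: bmeas_cst.
move/measurable_EFinP => h.
rewrite (_ : (fun y => _) = fun y => (\int[mu]_x g (x, y) + M) - M); last first.
  by apply/funext => y; rewrite addrK.
exact: measurable_funB.
Qed.

Section independent_pairs.
Context (R : realType) (d d1 d2 : measure_display) (T : measurableType d)
  (E1 : measurableType d1) (E2 : measurableType d2).
Context (P : probability T R) (X : {RV P >-> E1}) (Y : {RV P >-> E2}).

(** The law of the pair agrees with the product measure on rectangles. Integrating X first leaves a
    function of Y alone, to which the jump functionals apply. *)
Lemma independent_Rintegral (g : E1 * E2 -> R) : independent P X Y -> bmeas g ->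
  \int[P]_w g (X w, Y w) = \int[P]_w (\int[distribution P X]_x g (x, Y w)).
Proof.
move=> iXY bg.
have mXY : measurable_fun setT (fun w => (X w, Y w)).
  by apply: measurable_fun_pair; exact: measurable_funPT.
pose mu := (distribution P X \x distribution P Y)%E.
have bmu : bint (fun g : E1 * E2 -> R => \int[mu]_z g z).
  by apply: (@bint_expectation R _ _ _ _ mu idfun); exact: measurable_id.
have law (A : set (E1 * E2)) : measurable A ->
    mu A = P ((fun w => (X w, Y w)) @^-1` A).
  move=> mA; apply: (product_measure_unique (m' := pushforward P (fun w => (X w, Y w)))) => //.
rewrite (bint_eq (bint_expectation P mXY) bmu _ bg); last first.
  move=> A mA; rewrite expectation_indic//.
  rewrite [RHS](expectation_indic mu (@measurable_id _ _ setT) mA); congr fine.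
  exact: esym (law _ mA).
have [mg [M gM]] := bg.
have ig : mu.-integrable setT (EFin \o g) by exact: bmeas_integrable.
rewrite /Rintegral -(integral21_prod_meas1 ig).
have bgy y : bmeas (fun x => g (x, y)) by split; [exact: measurableT_comp|exists M].
have gf y : fubini_G (distribution P X) (EFin \o g) y \is a fin_num.
  by rewrite /fubini_G; apply: integrable_fin_num => //; exact: bmeas_integrable.
have GE : fubini_G (distribution P X) (EFin \o g) =
    EFin \o (fun y => \int[distribution P X]_x g (x, y)).
  by apply/funext => y /=; rewrite fineK// gf.
have bG := bmeas_partial_mean (distribution P X) bg.
congr fine; rewrite integral_distribution//; last 2 first.
- by rewrite GE; apply/measurable_EFinP; case: bG.
- have -> : fubini_G (distribution P X) (EFin \o g) \o Y =
      EFin \o (fun w => \int[distribution P X]_x g (x, Y w)).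
    by rewrite GE.
  apply: bmeas_integrable; apply: (@bmeas_comp _ _ _ _ _ Y _ _ bG); exact: measurable_funPT.
- by apply: eq_integral => w _ /=; rewrite fineK// gf.
Qed.

End independent_pairs.

(** * Finite families of independent copies *)

Section iid.
Context (R : realType).

(** The n-fold product space is built by recursion, one factor in front at each step. The family is
    indexed by all naturals, but only its first n members are controlled. *)
Lemma iid_copies (d dE : measure_display) (T : measurableType d) (E : measurableType dE)
    (P : probability T R) (Z : T -> E) : measurable_fun setT Z -> forall n,
  exists (d' : measure_display) (S : measurableType d') (Q : probability S R) (Zs : nat -> S -> E),
    (forall i, measurable_fun setT (Zs i)) /\
    forall B : nat -> set E, (forall i, measurable (B i)) ->
      Q (\bigcap_(i in `I_n) Zs i @^-1` B i) = (\prod_(i < n) P (Z @^-1` B i))%E.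
Proof.
move=> mZ; elim=> [|n [d' [S [Q [Zs [mZs ih]]]]]].
  exists d, T, P, (fun=> Z); split => // B mB.
  by rewrite II0 bigcap_set0 big_ord0 probability_setT.
exists _, (T * S)%type, (P \x Q)%E,
  (fun i z => if i is j.+1 then Zs j z.2 else Z z.1); split.
  move=> [|i]; first exact: measurableT_comp.
  by apply: (measurableT_comp (mZs i)).
move=> B mB.
have mb (d1 : measure_display) (S1 : measurableType d1) (f : S1 -> E) (A : set E) :
    measurable_fun setT f -> measurable A -> measurable (f @^-1` A).
  by move=> mf mA; rewrite -[X in measurable X]setTI; exact: mf.
rewrite (_ : \bigcap_(i in _) _ =
    (Z @^-1` B 0%N) `*` (\bigcap_(i in `I_n) Zs i @^-1` B i.+1)).
  etransitivity.
    apply: product_measure1E; first exact: mb.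
    by apply: bigcap_measurableType => i _; exact: mb.
  rewrite big_ord_recl; congr (_ * _)%E.
  exact: (ih (fun i => B i.+1) (fun i => mB i.+1)).
apply/seteqP; split => [[t s] /= H|[t s] /= [Ht Hs] [|i] //= iN]; last exact: Hs.
split; first exact: (H 0%N).
by move=> i /= iN; exact: (H i.+1).
Qed.

Lemma iid_copies_ord (d dE : measure_display) (T : measurableType d) (E : measurableType dE)
    (P : probability T R) (Z : T -> E) : measurable_fun setT Z -> forall n,
  exists (d' : measure_display) (S : measurableType d') (Q : probability S R) (Zs : nat -> S -> E),
    [/\ forall i, measurable_fun setT (Zs i),
        independent_upto Q Zs n,
        mutually_independent Q (fun i : 'I_n => Zs i) &
        forall i, (i < n)%N -> same_law Q P (Zs i) Z].
Proof.
move=> mZ n; have [d' [S [Q [Zs [mZs H]]]]] := iid_copies P mZ n.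
exists d', S, Q, Zs.
have law (i : nat) : (i < n)%N -> same_law Q P (Zs i) Z.
  move=> ni A mA; have := H (fun j => if j == i then A else setT) _.
  rewrite (bigD1 (Ordinal ni))//= eqxx big1 ?mule1; last first.
    by move=> j; rewrite -val_eqE /= => /negbTE ->; rewrite preimage_setT probability_setT.
  move=> <-; last by move=> j; case: ifP.
  congr (Q _); apply/seteqP; split => s /=.
    by move=> As j _; case: eqP => // ->.
  by move=> /(_ i ni); rewrite eqxx.
split => //.
- move=> B mB; rewrite [LHS](_ : _ = Q (\bigcap_(i in `I_n) Zs i @^-1` B i)); last first.
    rewrite (_ : [set` iota 0 n] = `I_n)//.
    by apply/seteqP; split => i /=; rewrite mem_iota.
  rewrite H// -[in iota 0 n](subn0 n) -/(index_iota 0 n) big_mkord.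
  by apply: eq_bigr => i _; rewrite law.
- move=> J B uJ mB.
  (* Indices outside J receive the whole space, which turns a condition on J into one on all n
     coordinates. *)
  pose B' (i : nat) := if insub i is Some o then (if o \in J then B o else setT) else setT.
  have B'E (o : 'I_n) : B' o = if o \in J then B o else setT.
    by rewrite /B' valK.
  rewrite [LHS](_ : _ = Q (\bigcap_(i in `I_n) Zs i @^-1` B' i)); last first.
    congr (Q _); apply/seteqP; split => s /=; last first.
      by move=> Hs o /= oJ; have := Hs o (ltn_ord o); rewrite /preimage/= B'E oJ.
    move=> Hs i /= ni; have := B'E (Ordinal ni); rewrite /preimage /= => ->.
    by case: ifP => // oJ; exact: (Hs (Ordinal ni)).
  rewrite H; last by move=> i; rewrite /B'; case: insubP => // o _ _; case: ifP.
  rewrite -(big_rmcond_in (fun i => i \in J)) /=; last first.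
    by move=> i _ iJ; rewrite B'E (negbTE iJ) preimage_setT probability_setT.
  rewrite -big_uniq//=; apply: eq_big_seq => i iJ.
  by rewrite B'E iJ law.
Qed.

End iid.

(** * The Lévy weight and the averaged kernels *)

Section kernels.
Context {R : realType}.
Implicit Types s y : R.

(** For y >= 0 it lies between min (1, y) / 2 and min (1, y), hence its integrability for Lambda,
    and below 1 - exp (- y), so Laplace transforms control it. *)
Definition levy_weight y := y / (1 + y).

Lemma levy_weight_ge0 y : 0 <= y -> 0 <= levy_weight y.
Proof. by move=> y0; rewrite divr_ge0// addr_ge0. Qed.

Lemma levy_weight_le1 y : 0 <= y -> levy_weight y <= 1.
Proof. by move=> y0; rewrite ler_pdivrMr; lra. Qed.

Lemma levy_weight_le y : 0 <= y -> levy_weight y <= y.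
Proof. by move=> y0; rewrite ler_pdivrMr; nra. Qed.

Lemma levy_weight_le_exp y : 0 <= y -> levy_weight y <= 1 - expR (- y).
Proof.
move=> y0; have y1 : 0 < 1 + y by lra.
rewrite /levy_weight expRN lerBrDr -lerBrDl.
have -> : 1 - y / (1 + y) = (1 + y)^-1 by field; rewrite gt_eqF.
by rewrite lef_pV2 ?posrE ?expR_gt0// expR_ge1Dx.
Qed.

Lemma measurable_levy_weight_abs : measurable_fun setT (fun y : R => levy_weight `|y|).
Proof.
apply: continuous_measurable_fun => y; apply: cvgM; first exact: norm_continuous.
apply: cvgV; first by rewrite gt_eqF// ltr_wpDr.
by apply: cvgD; [exact: cvg_cst|exact: norm_continuous].
Qed.

Lemma bmeas_levy_weight_abs : bmeas (fun y : R => levy_weight `|y|).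
Proof.
split; first exact: measurable_levy_weight_abs.
by exists 1 => y; rewrite ger0_norm ?levy_weight_ge0 ?levy_weight_le1.
Qed.

(** What the real and imaginary parts of (exp (i s) - 1) / s share: the bound 1 serves small
    arguments, the bound on s k(s) large ones. *)
Record kernel (k : R -> R) : Prop := Kernel {
  kernel_continuous : continuous k;
  kernel_le1 : forall s, `|k s| <= 1;
  kernel_mul_le2 : forall s, `|s * k s| <= 2 }.

(* At 0 the quotient takes the junk value 0, which is also its limit. *)
Definition kcos s := (cos s - 1) / s.
Definition ksin s := if s == 0 then 1 else sin s / s.

Lemma kcos_mul s : s * kcos s = cos s - 1.
Proof.
have [->|s0] := eqVneq s 0; first by rewrite mul0r cos0 subrr.
by rewrite /kcos mulrC divfK.
Qed.

Lemma ksin_mul s : s * ksin s = sin s.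
Proof.
rewrite /ksin; case: eqP => [->|/eqP s0]; first by rewrite mul0r sin0.
by rewrite mulrC divfK.
Qed.

Lemma abs_kcos_le s : `|kcos s| <= `|s|.
Proof.
have [->|s0] := eqVneq s 0; first by rewrite /kcos invr0 mulr0 normr0.
have s1 : 0 < `|s| by rewrite normr_gt0.
rewrite -(ler_pM2l s1) -normrM kcos_mul distrC ger0_norm ?oneBcos_ge0//.
have := oneBcos_sqr s; rewrite -[s ^+ 2]real_normK ?num_real// expr2.
by have : 0 <= `|s| * `|s| by []; lra.
Qed.

Lemma abs_ksin_sub_le s : `|ksin s - 1| <= `|s|.
Proof.
rewrite /ksin; case: eqP => [->|/eqP s0]; first by rewrite subrr normr0.
have s1 : 0 < `|s| by rewrite normr_gt0.
rewrite -(ler_pM2l s1) -normrM mulrBr mulr1 [s * _]mulrC divfK//.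
by have := abs_sin_sub_le s; rewrite -[s ^+ 2]real_normK ?num_real// expr2.
Qed.

Lemma kernel_kcos : kernel kcos.
Proof.
split.
- move=> x; have [->|x0] := eqVneq x 0.
    rewrite /continuous_at {2}/kcos invr0 mulr0.
    apply/cvgrPdist_le => e e0; have := @nbhs0_le R R e e0; apply: filterS => y ye.
    by rewrite sub0r normrN (le_trans (abs_kcos_le y)).
  apply: cvgM; last by apply: cvgV.
  by apply: cvgB; [exact: continuous_cos|exact: cvg_cst].
- move=> s; have [->|s0] := eqVneq s 0; first by rewrite /kcos invr0 mulr0 normr0.
  have s1 : 0 < `|s| by rewrite normr_gt0.
  rewrite -(ler_pM2l s1) -normrM kcos_mul distrC ger0_norm ?oneBcos_ge0// mulr1.
  exact: oneBcos_abs.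
- move=> s; rewrite kcos_mul distrC ger0_norm ?oneBcos_ge0//; exact: oneBcos_le2.
Qed.

Lemma kernel_ksin : kernel ksin.
Proof.
split.
- move=> x; have [->|x0] := eqVneq x 0.
    rewrite /continuous_at {2}/ksin eqxx.
    apply/cvgrPdist_le => e e0; have := @nbhs0_le R R e e0; apply: filterS => y ye.
    by rewrite distrC (le_trans (abs_ksin_sub_le y)).
  rewrite /continuous_at {2}/ksin (negbTE x0).
  have : sin y / y @[y --> x] --> sin x / x.
    by apply: cvgM; [exact: continuous_sin|apply: cvgV].
  apply: cvg_trans; apply: near_eq_cvg.
  have /(_ (nbhs_filter x)) := @cvgr_neq0 R R R (nbhs x) _ idfun x cvg_id x0.
  by apply: filterS => y /negbTE y0; rewrite /ksin y0.
- move=> s; rewrite /ksin; case: eqP => [_|/eqP s0]; first by rewrite normr1.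
  have s1 : 0 < `|s| by rewrite normr_gt0.
  by rewrite normrM normfV ler_pdivrMr// mul1r abs_sin_le.
- by move=> s; rewrite ksin_mul (le_trans (sin_max s))// ler1n.
Qed.

Section averages.
Context (F : probability R R) (k : R -> R) (t1 t2 : R).
Hypotheses (iF : F.-integrable setT (EFin \o (fun x : R => x))) (hk : kernel k).

Definition kernel_mean y := \int[F]_x ((t1 * x + t2) * k ((t1 * x + t2) * y)).
(** As 1 + |y| is |y| divided by the weight, this is on y >= 0 the real or imaginary part of E exp
    (i (t1 X + t2) y) - 1 over the weight, with the singularity at 0 removed, extended evenly to the
    line. *)
Definition levy_kernel y := (1 + `|y|) * kernel_mean `|y|.

Let iT : F.-integrable setT (EFin \o (fun x : R => t1 * x + t2)).
Proof.
have -> : EFin \o (fun x : R => t1 * x + t2) =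
    (fun x => (t1%:E * (EFin \o (fun x : R => x)) x + (EFin \o cst t2) x)%E) by [].
apply: integrableD => //; first exact: integrableZl.
exact: finite_measure_integrable_cst.
Qed.

Let mT : measurable_fun setT (fun x : R => t1 * x + t2).
Proof. by apply: measurable_funD => //; exact: measurable_funM. Qed.

Let iTk y : F.-integrable setT (EFin \o (fun x => (t1 * x + t2) * k ((t1 * x + t2) * y))).
Proof.
apply: (le_integrable measurableT _ _ iT).
  apply/measurable_EFinP; apply: measurable_funM => //.
  apply: (measurableT_comp (continuous_measurable_fun (kernel_continuous hk))).
  exact: measurable_funM.
by move=> x _; rewrite /= lee_fin normrM ler_piMr// kernel_le1.
Qed.

(** Integrability of F enters here: |t1 x + t2| dominates the integrand uniformly in y. *)
Lemma continuous_kernel_mean : continuous kernel_mean.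
Proof.
move=> y; have := @continuity_under_integral R _ _ F
  (fun y x => (t1 * x + t2) * k ((t1 * x + t2) * y)) setT measurableT (y - 1) (y + 1) _ _
  (fun x => `|t1 * x + t2|).
move=> H; apply: H.
- by move=> ? _; exact: iTk.
- apply: nearW => x _ z _; apply: cvgMr.
  apply: (@continuousT_comp R (fun y => (t1 * x + t2) * y) k); last exact: kernel_continuous.
  by move=> ?; apply: cvgMr; exact: cvg_id.
- exact: (integrable_norm iT).
- by move=> z _; apply: nearW => x _; rewrite normrM ler_piMr// kernel_le1.
- by rewrite inE /= in_itv /=; apply/andP; split; lra.
Qed.

Lemma continuous_levy_kernel : continuous levy_kernel.
Proof.
move=> y; apply: cvgM.
  by apply: cvgD; [exact: cvg_cst|exact: norm_continuous].
by apply: (@continuousT_comp R Num.norm kernel_mean);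
  [exact: norm_continuous|exact: continuous_kernel_mean].
Qed.

Lemma kernel_mean_mul y :
  y * kernel_mean y = \int[F]_x (((t1 * x + t2) * y) * k ((t1 * x + t2) * y)).
Proof.
by rewrite /kernel_mean -RintegralZl//; apply: eq_Rintegral => x _; ring.
Qed.

Lemma levy_kernel_weight y :
  levy_kernel y * levy_weight `|y| =
  \int[F]_x (((t1 * x + t2) * `|y|) * k ((t1 * x + t2) * `|y|)).
Proof.
rewrite -kernel_mean_mul /levy_kernel /levy_weight.
by field; rewrite gt_eqF// ltr_wpDr.
Qed.

Lemma levy_kernel_bounded : exists C : R, forall y, `|levy_kernel y| <= C.
Proof.
(* The first term covers |y| <= 1, where |k| <= 1; the constant 4 covers |y| > 1, where 1 + |y| <= 2
   |y| and |s k(s)| <= 2. *)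
exists (2 * \int[F]_x `|t1 * x + t2| + 4) => y.
have m0 : 0 <= \int[F]_x `|t1 * x + t2| by apply: Rintegral_ge0.
have y0 := normr_ge0 y.
rewrite /levy_kernel normrM ger0_norm ?addr_ge0//.
have [y1|y1] := leP `|y| 1.
  apply: (@le_trans _ _ (2 * \int[F]_x `|t1 * x + t2|)); last by lra.
  have y2 : 1 + `|y| <= 2 by lra.
  have y3 : 0 <= 1 + `|y| by lra.
  apply: ler_pM => //.
  apply: (le_trans (le_normr_Rintegral measurableT (iTk _))).
  apply: le_Rintegral => //.
  - exact: (integrable_norm (iTk _)).
  - exact: (integrable_norm iT).
  - by move=> x _; rewrite normrM ler_piMr// kernel_le1.
have : `|y| * `|kernel_mean `|y| | <= 2.
  rewrite -{1}(normr_id y) -normrM kernel_mean_mul.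
  have ib : F.-integrable setT
      (EFin \o (fun x => (t1 * x + t2) * `|y| * k ((t1 * x + t2) * `|y|))).
    apply: bmeas_integrable; split; last by exists 2 => x; exact: kernel_mul_le2.
    have mTy : measurable_fun setT (fun x : R => (t1 * x + t2) * `|y|) by exact: measurable_funM.
    apply: measurable_funM => //.
    exact: (measurableT_comp (continuous_measurable_fun (kernel_continuous hk))).
  apply: (le_trans (le_normr_Rintegral measurableT ib)).
  have -> : (2 : R) = \int[F]_x (2 : R).
    by rewrite Rintegral_probability_cst.
  apply: le_Rintegral => //.
  - exact: (integrable_norm ib).
  - exact: finite_measure_integrable_cst.
  - by move=> x _; exact: kernel_mul_le2.
have := normr_ge0 (kernel_mean `|y|); nra.
Qed.

(** This value multiplies the atom alpha at 0: it vanishes for [kcos] and is t1 E X + t2 for [ksin],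
    which produces the drift of the limit. *)
Lemma levy_kernel0 : levy_kernel 0 = k 0 * (t1 * \int[F]_x x + t2).
Proof.
rewrite /levy_kernel normr0 addr0 mul1r /kernel_mean.
under eq_Rintegral do rewrite mulr0.
rewrite RintegralZr// mulrC RintegralD//; last 2 first.
- exact: (integrableZl measurableT t1 iF).
- exact: finite_measure_integrable_cst.
by rewrite RintegralZl// Rintegral_probability_cst.
Qed.

End averages.
End kernels.

(** * Compactness of the weighted jump measures *)

Section small_jumps.
Context (R : realType) (U : set_system nat) {UU : UltraFilter U}.
Hypothesis ooU : \oo `<=` U.
Context (d0 d2 : measure_display) (T0 : measurableType d0) (T2 : measurableType d2).
Context (P0 : probability T0 R) (P2 : probability T2 R).
Context (Y : T0 -> R) (W : T2 -> R) (n_ : nat -> nat) (a : nat -> R).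
Hypotheses (mY : measurable_fun setT Y) (mW : measurable_fun setT W).
Hypothesis W0 : forall w, 0 <= W w.
Hypothesis a0 : forall k, 0 < a k.

(** Y is nonnegative only almost surely; with the absolute value the jumps are nonnegative at every
    point. *)
Definition jump k w := `|Y w| / a k.

Hypothesis laplace : forall u : R, 0 < u ->
  (\int[P0]_w expR (- (u * jump k w))) ^+ n_ k @[k --> \oo] -->
  \int[P2]_w expR (- (u * W w)).

Definition jump_integral k (f : R -> R) :=
  \int[P0]_w (f (jump k w) * ((n_ k)%:R * levy_weight (jump k w))).

Lemma jump_ge0 k w : 0 <= jump k w.
Proof. by rewrite /jump divr_ge0// ltW. Qed.

Lemma measurable_jump k : measurable_fun setT (jump k).
Proof. by apply: measurable_funM => //; exact: measurableT_comp. Qed.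

Lemma bmeas_jump_weight k : bmeas (fun w => (n_ k)%:R * levy_weight (jump k w)).
Proof.
apply: bmeasZ.
have := bmeas_comp (measurable_jump k) (@bmeas_levy_weight_abs R).
by congr bmeas; apply/funext => w; rewrite ger0_norm// jump_ge0.
Qed.

Let bexp u k : 0 <= u -> bmeas (fun w => expR (- (u * jump k w))).
Proof.
move=> u0; split.
  apply: (measurableT_comp (f := expR)); first exact: measurable_expR.
  by apply: measurableT_comp => //; apply: measurable_funM => //; exact: measurable_jump.
exists 1 => w; rewrite ger0_norm ?expR_ge0// -expR0 ler_expR oppr_le0.
by rewrite mulr_ge0// jump_ge0.
Qed.

(** From x^n <= exp (- n (1 - x)): a Laplace transform of the sum above exp (- e) forces n (1 - x)
    <= e. The scale K is taken so large that the limit transform E exp (- W / K) exceeds exp (-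
    e). *)
Let tail_bound (e : R) : 0 < e -> exists2 K : nat, (0 < K)%N &
  \forall k \near U, (n_ k)%:R * (1 - \int[P0]_w expR (- (K%:R^-1 * jump k w))) <= e.
Proof.
move=> e0.
have lim1 : \int[P2]_w expR (- (K.+1%:R^-1 * W w)) @[K --> \oo] --> (1 : R).
  rewrite -[X in _ --> X](Rintegral_probability_cst P2).
  apply: (bint_lim (bint_mean P2) (f_ := fun K w => expR (- (K.+1%:R^-1 * W w))) (M := 1)).
  - move=> K; split.
      apply: (measurableT_comp (f := expR)); first exact: measurable_expR.
      by apply: measurableT_comp => //; exact: measurable_funM.
    exists 1 => w; rewrite ger0_norm ?expR_ge0// -expR0 ler_expR oppr_le0.
    by rewrite mulr_ge0// invr_ge0.
  - move=> K w; rewrite ger0_norm ?expR_ge0// -expR0 ler_expR oppr_le0.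
    by rewrite mulr_ge0// invr_ge0.
  - move=> w; rewrite -[X in _ --> X]expR0; apply: continuous_cvg; first exact: continuous_expR.
    rewrite -oppr0; apply: cvgN; rewrite -[X in _ --> X](mul0r (W w)); apply: cvgMl.
    exact: cvg_harmonic.
have e1 : expR (- e) < 1 by rewrite -expR0 ltr_expR oppr_lt0.
have /filter_ex[K lK] : \forall K \near \oo,
    expR (- e) < \int[P2]_w expR (- (K.+1%:R^-1 * W w)).
  exact: (cvgr_gt _ lim1).
exists K.+1 => //; apply: ooU.
have K0 : 0 < K.+1%:R^-1 :> R by rewrite invr_gt0 ltr0n.
have lk : \forall k \near \oo,
    expR (- e) < (\int[P0]_w expR (- (K.+1%:R^-1 * jump k w))) ^+ n_ k.
  exact: (cvgr_gt _ (laplace K0)).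
apply: filterS lk => k.
set x := Rintegral _ _ _ => xe.
have x0 : 0 <= x by apply: Rintegral_ge0 => w _; exact: expR_ge0.
have xn : x ^+ n_ k <= expR (- ((n_ k)%:R * (1 - x))).
  have -> : - ((n_ k)%:R * (1 - x)) = (n_ k)%:R * (x - 1) by ring.
  rewrite expRM_natl lerXn2r ?nnegrE ?expR_ge0//.
  by have := expR_ge1Dx (x - 1); rewrite addrC subrK.
by have := lt_le_trans xe xn; rewrite ltr_expR ltrN2 => /ltW.
Qed.

(** The half-line is embedded as a half-axis of the plane, so that [helly_plane] applies. *)
Let L k (g : R * R -> R) :=
  \int[P0]_w (g (jump k w, 0) * ((n_ k)%:R * levy_weight (jump k w))).

Let pL k : plin (L k).
Proof.
apply: plin_Rintegral => //.
- by apply: measurable_fun_pair; [exact: measurable_jump|exact: measurable_cst].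
- by apply: bmeas_integrable; exact: bmeas_jump_weight.
- by move=> w _; rewrite mulr_ge0// levy_weight_ge0// jump_ge0.
Qed.

Let L_le k (g : R * R -> R) (u c : R) : 0 <= u -> bmeas g ->
  (forall y : R, 0 <= y -> g (y, 0) * levy_weight y <= c * (1 - expR (- (u * y)))) ->
  L k g <= c * ((n_ k)%:R * (1 - \int[P0]_w expR (- (u * jump k w)))).
Proof.
move=> u0 bg gc.
have ie := bmeas_integrable P0 (@bexp _ k u0).
have i1 := bmeas_integrable P0 (@bmeas_cst R _ T0 1).
have ib : P0.-integrable setT (EFin \o (fun w => 1 - expR (- (u * jump k w)))).
  by apply: bmeas_integrable; apply: bmeasB; [exact: bmeas_cst|exact: bexp].
have e : c * ((n_ k)%:R * (1 - \int[P0]_w expR (- (u * jump k w)))) =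
    \int[P0]_w (c * ((n_ k)%:R * (1 - expR (- (u * jump k w))))).
  rewrite -[X in X - _](Rintegral_probability_cst P0 1) -RintegralB// -RintegralZl//.
  rewrite -RintegralZl//.
  by apply: bmeas_integrable; apply: bmeasZ; apply: bmeasB; [exact: bmeas_cst|exact: bexp].
rewrite e; apply: le_Rintegral => //.
- apply: bmeas_integrable; apply: bmeasM; last exact: bmeas_jump_weight.
  have [mg [Cg gC]] := bg; split; last by exists Cg.
  apply: (measurableT_comp mg).
  by apply: measurable_fun_pair; [exact: measurable_jump|exact: measurable_cst].
- apply: bmeas_integrable; apply: bmeasZ; apply: bmeasZ.
  by apply: bmeasB; [exact: bmeas_cst|exact: bexp].
- move=> w _; rewrite mulrCA [leRHS]mulrCA ler_wpM2l//.
  by apply: gc; exact: jump_ge0.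
Qed.

(** Since w(y) <= K w(y / K) for K >= 1. This bounds the total mass, and [tail_ge] the mass beyond
    K, where 1 - exp (- y / K) is at least 1/2. *)
Let oneBexp_ge (K : nat) (y : R) : (0 < K)%N -> 0 <= y ->
  levy_weight y <= K%:R * (1 - expR (- (K%:R^-1 * y))).
Proof.
move=> K0 y0; have KR : 1 <= K%:R :> R by rewrite ler1n.
have := @levy_weight_le_exp R (K%:R^-1 * y); rewrite mulr_ge0 ?invr_ge0// => /(_ isT) h.
have h' : levy_weight y <= K%:R * levy_weight (K%:R^-1 * y).
  rewrite /levy_weight.
  have -> : K%:R * (K%:R^-1 * y / (1 + K%:R^-1 * y)) = y / (1 + K%:R^-1 * y).
    by field; rewrite ?gt_eqF//; have := mulr_ge0 (ltW (lt_le_trans ltr01 KR)) y0; lra.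
  rewrite ler_wpM2l// lef_pV2 ?posrE; try lra.
    by rewrite lerD2l ler_piMl// invf_le1// (lt_le_trans ltr01).
  by rewrite ltr_wpDr// mulr_ge0// invr_ge0.
by apply: le_trans h' _; rewrite ler_wpM2l.
Qed.

Let tail_ge (K : nat) (y : R) : (0 < K)%N -> K%:R < y ->
  levy_weight y <= 2 * (1 - expR (- (K%:R^-1 * y))).
Proof.
move=> K0 Ky; have KR : 0 < K%:R :> R by rewrite ltr0n.
have y0 : 0 < y := lt_trans KR Ky.
apply: (le_trans (levy_weight_le1 (ltW y0))).
have s1 : 1 <= K%:R^-1 * y by rewrite mulrC ler_pdivlMr// mul1r ltW.
suff : expR (- (K%:R^-1 * y)) <= 2^-1 by lra.
rewrite expRN lef_pV2 ?posrE ?expR_gt0//.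
by apply: le_trans (expR_ge1Dx _); lra.
Qed.

(** The planar limit V is tested only against functions of |z.1|, and the functionals charge only
    z.1 >= 0, so |(V w).1| may serve as v. *)
Lemma jump_integral_helly : exists (M : R) (v : R -> R),
  [/\ 0 <= M, measurable_fun setT v, forall w, 0 <= v w &
    forall f : R -> R, continuous f -> (exists C : R, forall y, `|f y| <= C) ->
    jump_integral k f @[k --> U] --> \int[lebesgue_measure]_(w in `[0, M[) f (v w)].
Proof.
have [K1 K10 hK1] := tail_bound ltr01.
have [||M [V [M0 mV HV]]] := @helly_plane R U UU L K1%:R pL.
- apply: filterS hK1 => k hk; apply: (le_trans (@L_le k _ K1%:R^-1 K1%:R _ _ _)).
  + by rewrite invr_ge0.
  + exact: bmeas_cst.
  + by move=> y y0; rewrite mul1r oneBexp_ge.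
  + by rewrite ler_piMr.
- move=> e e0; have [|K K0 hK] := @tail_bound (e / 2); first by rewrite divr_gt0.
  exists K%:R; apply: filterS hK => k hk.
  apply: (le_trans (@L_le k _ K%:R^-1 2 _ _ _)).
  + by rewrite invr_ge0.
  + by apply: bmeas_indic; exact: measurable_norm_gt.
  + move=> y y0; rewrite indicE.
    have e1 : 0 <= 1 - expR (- (K%:R^-1 * y)).
      by rewrite subr_ge0 -expR0 ler_expR oppr_le0 mulr_ge0// invr_ge0.
    case: (boolP (_ \in _)) => /=; last by rewrite mul0r mulr_ge0.
    rewrite inE /= ger0_norm// normr0 => -[Ky|]; first by rewrite mul1r tail_ge.
    by rewrite ltNge ler0n.
  + by rewrite mulrC -ler_pdivlMr.
exists M, (fun w => `|(V w).1|); split => //.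
  apply: (measurableT_comp (@normr_measurable R setT)).
  exact: (measurableT_comp measurable_fst).
move=> f cf [C fC].
have := HV (fun z => f `|z.1|).
have -> : (fun k => L k (fun z => f `|z.1|)) = fun k => jump_integral k f.
  apply/funext => k; apply: eq_Rintegral => w _ /=.
  by rewrite (ger0_norm (jump_ge0 k w)).
apply.
  move=> z; apply: continuous_comp; last exact: cf.
  by apply: cvg_norm; exact: cvg_fst.
by exists C; split; [exact: num_real|move=> x /ltW Cx z _; exact: le_trans (fC _) Cx].
Qed.

End small_jumps.

Lemma levy_integrandE (R : realType) (x y : R) :
  cexp ('i%C * x%:C%C) - 1 - 'i%C * y%:C%C = ((cos x - 1) +i* (sin x - y))%C.
Proof. by rewrite cexp_i; simpc; rewrite ?(mul0r, mul1r, addr0, subr0). Qed.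

(** * Integrals against the weighted Lévy measure *)

Section levy_integrals.
Context (R : realType) (L : {measure set R -> \bar R}).
Hypotheses (hL : levy_measure_pos L) (hL1 : (\int[L]_(s in `]0%R, 1%R]) s%:E < +oo)%E).

Let D : set R := `]0, +oo[.
Let mD : measurable D. Proof. exact: measurable_itv. Qed.

Lemma measurable_levy_weight : measurable_fun D (@levy_weight R).
Proof.
apply: (@eq_measurable_fun _ _ _ _ D (fun y : R => levy_weight `|y|)).
  by move=> x; rewrite inE /D /= in_itv /= andbT => x0; rewrite gtr0_norm.
by apply: (measurable_funS measurableT _ (@measurable_levy_weight_abs R)).
Qed.

Let iDsmall : L.-integrable D (EFin \o (fun x : R => x * (x <= 1)%R%:R)).
Proof.
have e : EFin \o (fun x : R => x * (x <= 1)%R%:R) = (EFin \o id) \_ [set x : R | x <= 1].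
  apply/funext => x; rewrite /patch /=; case: ifPn; rewrite ?inE /=.
    by move=> /= ->; rewrite mulr1.
  by move=> /negP; rewrite inE /= => /negP /negbTE ->; rewrite mulr0.
rewrite e; apply/integrable_restrict => //.
  by rewrite (_ : mkset _ = `]-oo, 1]%classic)//; apply/seteqP; split => x /=; rewrite in_itv.
have -> : D `&` [set x : R | x <= 1] = `]0, 1]%classic.
  by apply/seteqP; split => x /=; rewrite /D /= !in_itv /= andbT => /andP.
apply/integrableP; split; first exact/measurable_EFinP.
rewrite (eq_integral (fun s => s%:E))//= => x; rewrite inE /= in_itv /= => /andP[x0 _].
by rewrite gtr0_norm.
Qed.

(** On ]0, 1] the weight is at most x, integrable by [hL1]; beyond 1 it is at most min (1, x^2) = 1,
    integrable by [hL]. *)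
Lemma integrable_levy_weight : L.-integrable D (EFin \o @levy_weight R).
Proof.
have [_ h2] := hL.
have i2 : L.-integrable D (EFin \o (fun x : R => Num.min 1 (x ^+ 2))).
  apply/integrableP; split.
    by apply/measurable_EFinP; apply: measurable_minr => //.
  rewrite (eq_integral (fun x : R => (Num.min 1 (x ^+ 2))%:E))//= => x _.
  by rewrite ger0_norm// le_min ler01 sqr_ge0.
have := integrableD mD iDsmall i2.
apply: le_integrable => //; first by apply/measurable_EFinP; exact: measurable_levy_weight.
move=> x; rewrite /D /= in_itv /= andbT => x0; rewrite lee_fin.
rewrite ger0_norm ?levy_weight_ge0 ?(ltW x0)//.
rewrite ger0_norm; last first.
  by apply: addr_ge0; [rewrite mulr_ge0// ltW|rewrite le_min ler01 sqr_ge0].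
have [x1|x1] := leP x 1; rewrite ?mulr1 ?mulr0 ?add0r.
  by rewrite (le_trans (levy_weight_le (ltW x0)))// lerDl le_min ler01 sqr_ge0.
rewrite min_l; first exact: levy_weight_le1 (ltW x0).
by rewrite exprn_ege1// ltW.
Qed.

Definition levy_integral (f : R -> R) := \int[L]_(x in `]0%R, +oo[) (f x * levy_weight x).

Lemma bint_levy_integral : bint levy_integral.
Proof. by apply: bint_Rintegral => //; exact: integrable_levy_weight. Qed.

Lemma integrable_levy_integral (f : R -> R) : bmeas f ->
  L.-integrable D (EFin \o (fun x => f x * levy_weight x)).
Proof.
move=> bf; apply: (integrable_bmeasM mD (v := idfun)) => //; first exact: measurable_id.
exact: integrable_levy_weight.
Qed.

Context (F : probability R R) (iF : F.-integrable setT (EFin \o (fun x : R => x))).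

Lemma levy_kernel_weight0 (k : R -> R) (u y : R) : kernel k -> 0 <= y ->
  levy_kernel F k 0 u y * levy_weight y = (u * y) * k (u * y).
Proof.
move=> hk y0; rewrite -{2}(ger0_norm y0) levy_kernel_weight//.
rewrite (ger0_norm y0).
by under eq_Rintegral do rewrite mul0r add0r; rewrite Rintegral_probability_cst.
Qed.

Lemma bmeas_levy_kernel (k : R -> R) (t1 t2 : R) : kernel k -> bmeas (levy_kernel F k t1 t2).
Proof.
move=> hk; split; last exact: levy_kernel_bounded.
by apply: continuous_measurable_fun; exact: continuous_levy_kernel.
Qed.

Context (b : R).
Let alpha := b - \int[L]_(x in `]0%R, 1%R]) x.

Let levy_exponentE u : levy_exponent b L u =
  ((\int[L]_(x in D) (cos (u * x) - 1)) +i*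
  (u * b + \int[L]_(x in D) (sin (u * x) - u * x * (x <= 1)%R%:R)))%C.
Proof.
rewrite /levy_exponent (_ : (fun x => _ - _) = fun x : R =>
  ((cos (u * x) - 1) +i* (sin (u * x) - u * x * (x <= 1)%R%:R))%C); last first.
  by apply/funext => x; exact: levy_integrandE.
rewrite /cintegral.
by simpc; rewrite ?(mul0r, mul1r, addr0, subr0, add0r).
Qed.

Lemma Re_levy_exponent u :
  complex.Re (levy_exponent b L u) = levy_integral (levy_kernel F kcos 0 u).
Proof.
rewrite levy_exponentE /=.
apply: eq_Rintegral => x; rewrite inE /D /= in_itv /= andbT => x0.
by rewrite (levy_kernel_weight0 _ (@kernel_kcos R) (ltW x0)) kcos_mul.
Qed.

(** The compensator u x on ]0, 1] is integrable by itself; moved into the drift it changes b into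
    alpha. *)
Lemma Im_levy_exponent u :
  complex.Im (levy_exponent b L u) = u * alpha + levy_integral (levy_kernel F ksin 0 u).
Proof.
rewrite levy_exponentE /=.
have -> : \int[L]_(x in D) (sin (u * x) - u * x * (x <= 1)%R%:R) =
    \int[L]_(x in `]0, +oo[) (levy_kernel F ksin 0 u x * levy_weight x -
      u * (x * (x <= 1)%R%:R)).
  apply: eq_Rintegral => x; rewrite inE /D /= in_itv /= andbT => x0.
  by rewrite (levy_kernel_weight0 _ (@kernel_ksin R) (ltW x0)) ksin_mul mulrA.
rewrite RintegralB//; last 2 first.
- by apply: integrable_levy_integral; apply: bmeas_levy_kernel; exact: kernel_ksin.
- exact: (integrableZl mD u iDsmall).
rewrite RintegralZl// -/(levy_integral _).
have -> : \int[L]_(x in `]0, +oo[) (x * (x <= 1)%R%:R) = \int[L]_(x in `]0%R, 1%R]) x.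
  rewrite [LHS](_ : _ = \int[L]_(x in D) ((id : R -> R) \_ [set x | x <= 1]) x); last first.
    apply: eq_Rintegral => x _; rewrite /patch; case: ifPn; rewrite ?inE /=.
      by move=> /= ->; rewrite mulr1.
    by move=> /negP; rewrite inE /= => /negP /negbTE ->; rewrite mulr0.
  rewrite -Rintegral_mkcondr; congr (Rintegral L _ _).
  by apply/seteqP; split => x /=; rewrite /D /= !in_itv /= andbT => /andP.
by rewrite /alpha; ring.
Qed.

End levy_integrals.

(** * Identification of the limit measure *)

Section identification.
Context (R : realType) (L : {measure set R -> \bar R}).
Hypotheses (hL : levy_measure_pos L) (hL1 : (\int[L]_(s in `]0%R, 1%R]) s%:E < +oo)%E).
Context (F : probability R R) (iF : F.-integrable setT (EFin \o (fun x : R => x))).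
Context (b M : R) (v : R -> R).
Hypotheses (M0 : 0 <= M) (mv : measurable_fun setT v) (v0 : forall w, 0 <= v w).

Let alpha := b - \int[L]_(x in `]0%R, 1%R]) x.
Let J (f : R -> R) := \int[lebesgue_measure]_(w in `[0, M[) f (v w).
Local Notation I := (levy_integral L).
Local Notation K u := (levy_kernel F kcos 0 u).

Hypothesis exponents : forall u : R,
  cexp ((J (levy_kernel F kcos 0 u)) +i* (J (levy_kernel F ksin 0 u)))%C =
  cexp (levy_exponent b L u).

Let bJ : bint J.
Proof.
have := @bint_Rintegral R _ _ _ _ (@lebesgue_measure R) `[0, M[%classic v (fun=> 1)
  (measurable_itv _) (measurable_funS measurableT (@subsetT _ _) mv) (integrable_itv_cst _ _ _).
by congr bint; apply/funext => f; apply: eq_Rintegral => w _; rewrite mulr1.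
Qed.

Let bI : bint I. Proof. exact: bint_levy_integral. Qed.

Let bK u : bmeas (K u). Proof. by apply: bmeas_levy_kernel => //; exact: kernel_kcos. Qed.

Let JK u : J (K u) = I (K u).
Proof.
have := congr1 Num.norm (exponents u); rewrite !normc_cexp => /(@complexI _ _ _).
by move/expR_inj; rewrite (Re_levy_exponent L iF).
Qed.

(** Multiplying cos (h y) - 1 by cos (u y) gives a combination of functions cos (w y) - 1. Hence J
    and I, reweighted by [K h], agree on every cosine. *)
Let K_mul_cos h u y : cos (u * y) * K h y = 2^-1 * (K (u + h) y + K (u - h) y) - K u y.
Proof.
have Kabs w : K w y = K w `|y| by rewrite /levy_kernel normr_id.
have -> : cos (u * y) = cos (u * `|y|).
  have [y0|y0] := leP 0 y; first by rewrite ger0_norm.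
  by rewrite ltr0_norm// mulrN cosN.
rewrite !Kabs; have := normr_ge0 y; move: `|y| => {Kabs}y y0.
have [->|y1] := eqVneq y 0.
  by rewrite !levy_kernel0//; [|exact: kernel_kcos..]; rewrite /kcos invr0; ring.
have w0 : levy_weight y != 0.
  by rewrite gt_eqF// divr_gt0 ?ltr_wpDr// lt_neqAle eq_sym y1.
apply: (mulIf w0).
rewrite -mulrA mulrBl -[in RHS](mulrA 2^-1) [(_ + _) * levy_weight y]mulrDl.
rewrite !(levy_kernel_weight0 _ _ kernel_kcos y0)// !kcos_mul.
by rewrite mulrDl mulrBl cosD cosB; field.
Qed.

(** On the compact set [S j] the function [K h] stays away from 0, so it can be divided out after
    [cosine_unique]; j then goes to infinity. *)
Let J_eq_off_zero (f : R -> R) : bmeas f -> J (fun y => f y * (0 < y)%R%:R) = I f.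
Proof.
move=> bf.
pose S (j : nat) : set R := `[j.+1%:R^-1, j.+1%:R]%classic.
have jS (j : nat) : J (fun y => f y * \1_(S j) y) = I (fun y => f y * \1_(S j) y).
  (* For y in [S j] the product h y lies in [h^2, 1], inside ]0, pi[, where the cosine decreases;
     hence 1 - cos (h y) >= c. *)
  pose h : R := j.+1%:R^-1.
  have j0 : 0 < j.+1%:R :> R by rewrite ltr0n.
  have h0 : 0 < h by rewrite invr_gt0.
  have j1 : 1 <= j.+1%:R :> R by rewrite ler1n.
  pose c := 1 - cos (h * h).
  have c0 : 0 < c.
    rewrite subr_gt0 -cos0 ltr_cos ?in_itv /= ?lexx ?pi_ge0 ?mulr_gt0//.
    rewrite mulr_ge0 ?(ltW h0)//= (@le_trans _ _ 1)//; last by have := pi_ge2 R; lra.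
    by rewrite mulr_ile1 ?(ltW h0)// invf_le1.
  have Kc y : S j y -> c <= - K h y.
    rewrite /S /= in_itv /= => /andP[hy yj].
    have y0 : 0 < y by exact: lt_le_trans hy.
    have w0 : 0 < levy_weight y by rewrite divr_gt0 ?ltr_wpDr// ltW.
    have w1 := levy_weight_le1 (ltW y0).
    have Kw : - K h y * levy_weight y = 1 - cos (h * y).
      by rewrite mulNr (levy_kernel_weight0 _ _ kernel_kcos (ltW y0))// kcos_mul opprB.
    have cc : c <= 1 - cos (h * y).
      rewrite lerD2l lerN2; have [->//|hhy] := eqVneq (h * y) (h * h).
      apply: ltW; rewrite ltr_cos ?in_itv /= ?mulr_ge0 ?(ltW h0) ?(ltW y0)//=.
      + by rewrite lt_neqAle eq_sym hhy ler_pM2l.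
      + rewrite (@le_trans _ _ 1)//; last by have := pi_ge2 R; lra.
        by rewrite mulr_ile1 ?(ltW h0)// invf_le1.
      + rewrite (@le_trans _ _ 1)//; last by have := pi_ge2 R; lra.
        by rewrite /h mulrC ler_pdivrMr// mul1r.
    have Kpos : 0 < - K h y by rewrite -(pmulr_lgt0 _ w0) Kw (lt_le_trans c0).
    by rewrite (le_trans cc)// -Kw ler_piMr// ltW.
  (* The quotient of f by [K h] on [S j]; cutting the denominator at c makes it bounded and
     measurable on the whole line. *)
  pose g y := f y * \1_(S j) y * (- Num.max c (- K h y))^-1.
  have bmax : bmeas (fun y => (- Num.max c (- K h y))^-1).
    have mc (y : R) : 0 < Num.max c (- K h y) by rewrite lt_max c0.
    split.
      apply: continuous_measurable_fun => y.
      apply: cvgV; first by rewrite oppr_eq0 gt_eqF.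
      apply: cvgN.
      apply: (@continuous_max R R^o (fun=> c) (fun y => - K h y) y); first exact: cvg_cst.
      apply: cvgN; apply: continuous_levy_kernel => //; exact: kernel_kcos.
    exists c^-1 => y; rewrite normfV normrN gtr0_norm// lef_pV2 ?posrE//.
    by rewrite le_max lexx.
  have bS : bmeas (\1_(S j) : R -> R) by apply: bmeas_indic; exact: measurable_itv.
  have bg : bmeas g by do 2?[apply: bmeasM => //].
  have gE y : g `|y| * K h y = f `|y| * \1_(S j) `|y|.
    have -> : K h y = K h `|y| by rewrite /levy_kernel normr_id.
    rewrite /g indicE; case: (boolP (_ \in _)) => /=; last by rewrite !mulr0 !mul0r.
    rewrite inE => Sy; rewrite max_r ?Kc// opprK mulr1 divfK//.
    by have := Kc _ Sy; rewrite -oppr_eq0 => /(lt_le_trans c0) /gt_eqF ->.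
  have bintK (L' : (R -> R) -> R) : bint L' -> bint (fun f => L' (fun y => f y * K h y)).
    move=> bL'; have [_ [C KC]] := bK h; split.
    - move=> p q bp bq; rewrite -(bintD bL') //; [|exact: bmeasM..].
      by congr L'; apply/funext => y; rewrite mulrDl.
    - move=> e p bp; rewrite -(bintZ bL') //; last exact: bmeasM.
      by congr L'; apply/funext => y; rewrite mulrA.
    - move=> f_ p B bf_ fB ff.
      apply: (bint_lim bL' (f_ := fun n y => f_ n y * K h y) (M := B * C)).
      + by move=> n; exact: bmeasM.
      + by move=> n y; rewrite normrM ler_pM.
      + by move=> y; apply: cvgMl; exact: ff.
  have := cosine_unique (bintK _ bJ) (bintK _ bI) _ bg.
  have E (L' : (R -> R) -> R) : (fun y => g `|y| * K h y) = (fun y => f `|y| * \1_(S j) `|y|).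
    by apply/funext => y; exact: gE.
  rewrite (E J) => H.
  have -> : J (fun y => f y * \1_(S j) y) = J (fun y => f `|y| * \1_(S j) `|y|).
    by apply: eq_Rintegral => w _; rewrite (ger0_norm (v0 w)).
  have -> : I (fun y => f y * \1_(S j) y) = I (fun y => f `|y| * \1_(S j) `|y|).
    by apply: eq_Rintegral => w; rewrite inE /= in_itv /= andbT => w0; rewrite gtr0_norm.
  apply: H => u.
  have EK : (fun y => cos (u * y) * K h y) =
      (fun y => 2^-1 * (K (u + h) y + K (u - h) y) + -1 * K u y).
    by apply/funext => y; rewrite K_mul_cos mulN1r.
  have bKK : bmeas (fun y => K (u + h) y + K (u - h) y) by exact: bmeasD.
  rewrite EK !(bintD bJ, bintD bI, bintZ bJ, bintZ bI) ?JK//; exact: bmeasZ.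
have [mf [C fC]] := bf.
have bfS j : bmeas (fun y => f y * \1_(S j) y).
  by apply: bmeasM => //; apply: bmeas_indic; exact: measurable_itv.
have fSC j y : `|f y * \1_(S j) y| <= C.
  rewrite normrM (le_trans _ (fC y))// ler_piMr// indicE.
  by case: (_ \in _); rewrite /= ?normr1 ?normr0.
have fS y : (fun j => f y * \1_(S j) y) @ \oo --> f y * (0 < y)%R%:R.
  apply: cvgMr; apply: cvg_near_cst.
  have [y0|y0] := ltP 0 y => /=.
    near=> j; rewrite indicE mem_set// /S /= in_itv /=; apply/andP; split.
      rewrite invf_ple ?posrE// -?natr1; rewrite (@le_trans _ _ j%:R) ?lerDl//.
      by near: j; exact: nbhs_infty_ger.
    rewrite -natr1 (@le_trans _ _ j%:R) ?lerDl//.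
    by near: j; exact: nbhs_infty_ger.
  apply: nearW => j; rewrite indicE memNset// /S /= in_itv /= => /andP[jy _].
  by have := lt_le_trans (_ : 0 < j.+1%:R^-1) jy; rewrite invr_gt0 ltr0n ltNge y0 => /(_ isT).
have lJ := bint_lim bJ bfS fSC fS.
have lI := bint_lim bI bfS fSC fS.
have e : J \o (fun j y => f y * \1_(S j) y) = I \o (fun j y => f y * \1_(S j) y).
  by apply/funext => j; exact: jS.
rewrite e in lJ.
have -> : I f = I (fun y => f y * (0 < y)%R%:R).
  by apply: eq_Rintegral => w; rewrite inE /= in_itv /= andbT => ->; rewrite mulr1.
exact: (cvg_unique (@Rhausdorff R) lJ lI).
Unshelve. all: by end_near. Qed.

Let m0 := J (\1_[set 0]).

Let JE (f : R -> R) : bmeas f -> J f = m0 * f 0 + I f.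
Proof.
move=> bf; have b0 : bmeas (\1_[set (0 : R)] : R -> R) by exact: bmeas_indic.
have bp : bmeas (fun y : R => (0 < y)%R%:R : R).
  have := @bmeas_indic R _ R `]0%R, +oo[%classic (measurable_itv _); congr bmeas.
  apply/funext => y; rewrite indicE; congr (_%:R); congr nat_of_bool.
  by apply/idP/idP; rewrite inE /= in_itv /= andbT.
rewrite -(J_eq_off_zero bf) mulrC -(bintZ bJ)// -(bintD bJ) //; [|exact: bmeasZ|exact: bmeasM].
apply: eq_Rintegral => w _; rewrite indicE.
have := v0 w; rewrite le_eqVlt => /orP[/eqP e|vw].
  by rewrite -e ltxx mulr0 addr0 mem_set// mulr1.
rewrite vw memNset ?mulr0 ?add0r ?mulr1//= => e.
by rewrite e ltxx in vw.
Qed.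

(** Off 0 the two sides agree, so the exponents differ by i u (m0 - alpha). Their exponentials being
    equal, cos (u (m0 - alpha)) = 1 for every u, and u = pi / (m0 - alpha) would give -1. *)
Lemma levy_identification : 0 <= alpha /\
  forall f, bmeas f -> J f = alpha * f 0 + levy_integral L f.
Proof.
have m00 : 0 <= m0 by apply: Rintegral_ge0 => w _; rewrite indicE.
suff e : m0 = alpha by rewrite -e; split.
have bs u : bmeas (levy_kernel F ksin 0 u).
  by apply: bmeas_levy_kernel => //; exact: kernel_ksin.
have cos1 u : cos (u * (m0 - alpha)) = 1.
  have := exponents u; rewrite (JE (bs u)) levy_kernel0//.
  rewrite (_ : ksin 0 = 1) ?[in LHS]/ksin ?eqxx// mul1r mul0r add0r JK.
  case E : (levy_exponent b L u) => [x y].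
  have ex := Re_levy_exponent L iF b u; have ey := Im_levy_exponent hL hL1 iF b u.
  rewrite E /= in ex ey; rewrite -ex ey !cexpE => -[].
  have p : expR x != 0 by rewrite gt_eqF// expR_gt0.
  move=> /(mulfI p) c1 /(mulfI p) c2.
  have -> : u * (m0 - alpha) = (m0 * u + I (levy_kernel F ksin 0 u)) -
      (u * alpha + I (levy_kernel F ksin 0 u)) by ring.
  by rewrite cosB c1 c2 -!expr2 cos2Dsin2.
apply/eqP; rewrite -subr_eq0; apply/negPn/negP => d0.
have := cos1 (pi / (m0 - alpha)); rewrite divfK// cospi => /eqP.
by rewrite eq_sym -subr_eq0 opprK (_ : 1 + 1 = 2%:R)// pnatr_eq0.
Qed.

End identification.

(** * Almost sure identities and the modulus of a characteristic function *)

Lemma expectation_Rintegral (R : realType) (d : measure_display) (T : measurableType d)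
    (P : probability T R) (f : T -> R) : bmeas f -> ('E_P[f] = (\int[P]_w f w)%:E)%E.
Proof.
move=> bf; rewrite unlock fineK//.
by apply: integrable_fin_num => //; exact: bmeas_integrable.
Qed.

Lemma ae_eq_Rintegral (R : realType) (d : measure_display) (T : measurableType d)
    (P : probability T R) (f g : T -> R) : bmeas f -> bmeas g ->
  {ae P, forall w, f w = g w} -> \int[P]_w f w = \int[P]_w g w.
Proof.
move=> [mf _] [mg _] fg; congr fine; apply: ae_eq_integral => //; try exact/measurable_EFinP.
by apply: filterS fg => w /= -> _.
Qed.

Lemma nonneg_ae (R : realType) (d : measure_display) (T : measurableType d)
    (P : probability T R) (Y : {RV P >-> R}) :
  P [set w | 0 <= Y w] = 1%E -> {ae P, forall w, 0 <= Y w}.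
Proof.
move=> h; exists (~` [set w | 0 <= Y w]); split.
- by apply: measurableC; rewrite -[X in measurable X]setTI; apply: measurable_fun_le.
- rewrite probability_setC ?h ?subee//.
  by rewrite -[X in measurable X]setTI; apply: measurable_fun_le.
- by move=> w.
Qed.

Section characteristic_bounds.
Context (R : realType) (d : measure_display) (T : measurableType d) (P : probability T R).
Context (X : T -> R) (mX : measurable_fun setT X).

Let bc : bmeas (fun w => cos (X w)). Proof. exact: bmeas_cos. Qed.
Let bs : bmeas (fun w => sin (X w)). Proof. exact: bmeas_sin. Qed.

Lemma char_funE : cintegral P setT (fun w => cexp ('i%C * (X w)%:C%C)) =
  ((\int[P]_w cos (X w)) +i* (\int[P]_w sin (X w)))%C.
Proof.
rewrite (_ : (fun w => _) = fun w => (cos (X w) +i* sin (X w))%C)//.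
by apply/funext => w; rewrite cexp_i.
Qed.

(** With p + i q the value and r its modulus, r^2 is the mean of p cos X + q sin X, which is at most
    r by Cauchy-Schwarz; so r^2 <= r. *)
Lemma norm_char_fun_le1 : `|cintegral P setT (fun w => cexp ('i%C * (X w)%:C%C))| <= 1.
Proof.
rewrite char_funE normc_def; set p := \int[P]_w cos _; set q := \int[P]_w sin _.
rewrite [X in Num.sqrt X]/=; set r := Num.sqrt _.
have r0 : 0 <= r by exact: sqrtr_ge0.
have r2 : r ^+ 2 = p ^+ 2 + q ^+ 2 by rewrite sqr_sqrtr// addr_ge0 ?sqr_ge0.
have bpq : bmeas (fun w => p * cos (X w) + q * sin (X w)) by apply: bmeasD; exact: bmeasZ.
have : r ^+ 2 <= r.
  have -> : r ^+ 2 = \int[P]_w (p * cos (X w) + q * sin (X w)).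
    by rewrite r2 (bintD (bint_mean P)) ?(bintZ (bint_mean P))//; exact: bmeasZ.
  apply: (le_trans (ler_norm _)); apply: norm_expectation_le => // w.
  rewrite -(ger0_norm r0) -sqrtr_sqr -[leRHS]sqrtr_sqr ler_wsqrtr// r2.
  have := cos2Dsin2 (X w); move: (cos _) (sin _) => c s cs.
  have := sqr_ge0 (p * s - q * c); nra.
by rewrite lecR -/r; move: r0; rewrite le_eqVlt => /orP[/eqP<-//|r0]; nra.
Qed.

End characteristic_bounds.

(** * One summand of the array *)

Section summand.
Context (R : realType) (d0 : measure_display) (T0 : measurableType d0) (P0 : probability T0 R).
Context (X Y : {RV P0 >-> R}).
Hypotheses (hXY : independent P0 X Y) (hY : P0 [set w | 0 <= Y w] = 1%E)
  (hX : ('E_P0[fun w => `|X w|%R] < +oo)%E).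
Context (a : R) (a0 : 0 < a).
Local Notation F := (distribution P0 X).

Lemma integrable_mean : P0.-integrable setT (EFin \o X).
Proof.
apply/integrableP; split; first exact/measurable_EFinP.
by move: hX; rewrite unlock.
Qed.

Lemma integrable_distribution_id : F.-integrable setT (EFin \o (fun x : R => x)).
Proof.
apply/integrableP; split; first exact/measurable_EFinP.
rewrite (@ge0_integral_distribution _ _ _ _ _ P0 X (fun x : R => `|x|%:E))//=.
- by move: hX; rewrite unlock.
- by apply/measurable_EFinP; exact: normr_measurable.
Qed.

Lemma mean_distribution_id : \int[F]_x x = fine 'E_P0[X].
Proof.
rewrite unlock /Rintegral (@integral_distribution _ _ _ _ _ P0 X (fun x : R => x%:E))//.
  exact/measurable_EFinP.
exact: integrable_mean.
Qed.

Let summand t1 t2 w := (t1 * X w + t2) * (`|Y w| / a).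

Let msummand t1 t2 : measurable_fun setT (summand t1 t2).
Proof.
apply: measurable_funM; first by apply: measurable_funD => //; exact: measurable_funM.
by apply: measurable_funM => //; exact: measurableT_comp.
Qed.

(** Integrating X out first, given Y, yields the averaged kernel at |Y| / a times the weight. *)
Lemma summand_kernel (kr : R -> R) (t1 t2 : R) : kernel kr ->
  \int[P0]_w (summand t1 t2 w * kr (summand t1 t2 w)) =
  \int[P0]_w (levy_kernel F kr t1 t2 (`|Y w| / a) * levy_weight (`|Y w| / a)).
Proof.
move=> hk; pose g (z : R * R) := (t1 * z.1 + t2) * (`|z.2| / a) * kr ((t1 * z.1 + t2) * (`|z.2| / a)).
have bg : bmeas g.
  have m1 : measurable_fun setT (fun z : R * R => (t1 * z.1 + t2) * (`|z.2| / a)).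
    apply: measurable_funM.
      by apply: measurable_funD => //; apply: measurable_funM => //; exact: measurable_fst.
    by apply: measurable_funM => //; apply: measurableT_comp => //; exact: measurable_snd.
  split; last by exists 2 => z; exact: kernel_mul_le2.
  apply: measurable_funM => //.
  exact: (measurableT_comp (continuous_measurable_fun (kernel_continuous hk))).
rewrite (independent_Rintegral hXY bg).
apply: eq_Rintegral => w _; have y0 : 0 <= `|Y w| / a by rewrite divr_ge0// ltW.
rewrite -[X in _ = _ * levy_weight X](ger0_norm y0) levy_kernel_weight.
- by apply: eq_Rintegral => x _; rewrite /g (ger0_norm y0).
- exact: integrable_distribution_id.
- exact: hk.
Qed.

Definition summand_char (t1 t2 : R) : R[i] :=
  cintegral P0 setT (fun w => cexp ('i%C * ((t1 * X w + t2) * (`|Y w| / a))%:C%C)).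

Lemma norm_summand_char_le1 t1 t2 : `|summand_char t1 t2| <= 1.
Proof. exact: norm_char_fun_le1 (msummand t1 t2). Qed.

Lemma Re_summand_char t1 t2 : complex.Re (summand_char t1 t2) - 1 =
  \int[P0]_w (levy_kernel F kcos t1 t2 (`|Y w| / a) * levy_weight (`|Y w| / a)).
Proof.
rewrite -summand_kernel; last exact: kernel_kcos.
rewrite /summand_char char_funE /=.
under [in RHS]eq_Rintegral do rewrite kcos_mul.
rewrite RintegralB//; last 2 first.
- by apply: bmeas_integrable; apply: bmeas_cos; exact: msummand.
- by apply: bmeas_integrable; exact: bmeas_cst.
by rewrite Rintegral_probability_cst.
Qed.

Lemma Im_summand_char t1 t2 : complex.Im (summand_char t1 t2) =
  \int[P0]_w (levy_kernel F ksin t1 t2 (`|Y w| / a) * levy_weight (`|Y w| / a)).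
Proof.
rewrite -summand_kernel; last exact: kernel_ksin.
rewrite /summand_char char_funE /=.
by apply: eq_Rintegral => w _; rewrite ksin_mul.
Qed.

Lemma summand_charE (t1 t2 : R) :
  cintegral P0 setT (fun w => cexp ('i%C * ((t1 * X w + t2) * (Y w / a))%:C%C)) =
  summand_char t1 t2.
Proof.
have m1 : measurable_fun setT (fun w => (t1 * X w + t2) * (Y w / a)).
  apply: measurable_funM; first by apply: measurable_funD => //; exact: measurable_funM.
  exact: measurable_funM.
rewrite /summand_char !char_funE.
have ae := nonneg_ae hY.
congr (_ +i* _)%C; apply: ae_eq_Rintegral.
- exact: bmeas_cos m1.
- exact: bmeas_cos (msummand t1 t2).
- by apply: filterS ae => w /= Yw; rewrite ger0_norm.
- exact: bmeas_sin m1.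
- exact: bmeas_sin (msummand t1 t2).
- by apply: filterS ae => w /= Yw; rewrite ger0_norm.
Qed.

End summand.

(** * Transforms of the sums *)

Section sums.
Context (R : realType) (d0 : measure_display) (T0 : measurableType d0) (P0 : probability T0 R).
Context (X Y : {RV P0 >-> R}) (hY : P0 [set w | 0 <= Y w] = 1%E).
Context (d : measure_display) (T : measurableType d) (P : probability T R).
Context (Xs Ys : nat -> {RV P >-> R}).
Hypotheses (hindep : mutually_independent P (fun i w => (Xs i w, Ys i w)))
  (hlaw : forall i, same_law P P0 (fun w => (Xs i w, Ys i w)) (fun w => (X w, Y w))).

Let mZ i : measurable_fun setT (fun w => (Xs i w, Ys i w)).
Proof. exact: measurable_fun_pair. Qed.

Let mZ0 : measurable_fun setT (fun w => (X w, Y w)).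
Proof. exact: measurable_fun_pair. Qed.

Lemma sum_char (a : R) (N : nat) (t1 t2 : R) :
  cintegral P setT (fun w => cexp ('i%C *
    (t1 * ((\sum_(i < N) Xs i w * Ys i w) / a) + t2 * ((\sum_(i < N) Ys i w) / a))%:C%C)) =
  summand_char X Y a t1 t2 ^+ N.
Proof.
pose q (z : R * R) := (t1 * z.1 + t2) * (z.2 / a).
have mq : measurable_fun setT q.
  apply: measurable_funM; last by apply: measurable_funM => //; exact: measurable_snd.
  by apply: measurable_funD => //; apply: measurable_funM => //; exact: measurable_fst.
pose h (_ : nat) z := cexp ('i%C * (q z)%:C%C).
have bh i : cbmeas (h i).
  split; rewrite /h; under eq_fun do rewrite cexp_i /=; [exact: bmeas_cos|exact: bmeas_sin].
rewrite (_ : (fun w => cexp _) = fun w => \prod_(i < N) h i (Xs i w, Ys i w)); last first.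
  apply/funext => w; rewrite -cexp_sum -mulr_sumr; congr (cexp (_ * _)).
  rewrite -raddf_sum /= !mulr_suml !mulr_sumr -big_split /=; congr (_%:C)%C.
  by apply: eq_bigr => i _; rewrite /q /=; ring.
rewrite (cintegral_prod mZ (mutually_independent_upto N hindep) bh).
rewrite -(summand_charE X hY)// -[N in RHS]card_ord -prodr_const; apply: eq_bigr => i _.
have [b1 b2] := bh i.
rewrite /cintegral (same_law_Rintegral (mZ i) mZ0 (hlaw i) b1).
by rewrite (same_law_Rintegral (mZ i) mZ0 (hlaw i) b2).
Qed.

(** Almost surely all the Y_i are nonnegative, so the absolute value passes inside the sum; it keeps
    the exponential at most 1 everywhere. *)
Lemma sum_laplace (a u : R) (N : nat) : 0 < a -> 0 <= u ->
  \int[P]_w expR (- (u * `|(\sum_(i < N) Ys i w) / a|)) =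
  (\int[P0]_w expR (- (u * (`|Y w| / a)))) ^+ N.
Proof.
move=> a0 u0.
pose q (z : R * R) := expR (- (u * (`|z.2| / a))).
have expb (f : R) : 0 <= f -> `|expR (- f)| <= 1.
  by move=> f0; rewrite ger0_norm ?expR_ge0// -expR0 ler_expR oppr_le0.
have bq : bmeas q.
  split.
    apply: (measurableT_comp (f := expR)); first exact: measurable_expR.
    apply: measurableT_comp => //; apply: measurable_funM => //; apply: measurable_funM => //.
    by apply: measurableT_comp => //; exact: measurable_snd.
  by exists 1 => z; apply: expb; rewrite mulr_ge0// divr_ge0// ltW.
have bprod : bmeas (fun w => \prod_(i < N) q (Xs i w, Ys i w)).
  elim: N => [|N ih]; first by under eq_fun do rewrite big_ord0; exact: bmeas_cst.
  under eq_fun do rewrite big_ord_recr /=.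
  by apply: bmeasM => //; exact: (bmeas_comp (mZ N) bq).
have Yae : {ae P, forall w, forall i, 0 <= Ys i w}.
  apply: ae_foralln => i; apply: nonneg_ae.
  have mB : measurable [set z : R * R | 0 <= z.2].
    rewrite -[X in measurable X]setTI; apply: measurable_fun_le => //; exact: measurable_snd.
  by rewrite -hY; exact: (hlaw i mB).
rewrite (@ae_eq_Rintegral _ _ _ P _ (fun w => \prod_(i < N) q (Xs i w, Ys i w)))//; last 2 first.
- split; last by exists 1 => w; apply: expb; rewrite mulr_ge0.
  apply: (measurableT_comp (f := expR)); first exact: measurable_expR.
  apply: measurableT_comp => //; apply: measurable_funM => //; apply: measurableT_comp => //.
  by apply: measurable_funM => //; exact: measurable_sum.
- apply: filterS Yae => w /= Yw; rewrite -expR_sum; congr expR.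
  rewrite sumrN -mulr_sumr -mulr_suml ger0_norm ?divr_ge0 ?sumr_ge0 ?ltW//.
  by congr (- (_ * (_ / _))); apply: eq_bigr => i _; rewrite /= ger0_norm.
apply: complexI; rewrite rmorphXn /= -cintegral_real.
under eq_fun do rewrite rmorph_prod /=.
rewrite (@cintegral_prod _ _ _ P _ _ _ mZ _ (mutually_independent_upto N hindep)
  (fun _ z => (q z)%:C%C)); last by move=> i; exact: cbmeas_real.
rewrite -[N in RHS]card_ord -prodr_const; apply: eq_bigr => i _.
by rewrite cintegral_real (same_law_Rintegral (mZ i) mZ0 (hlaw i) bq).
Qed.

End sums.

(** * A subadditive truncation for tightness *)

Section truncation.
Context {R : realType}.
Implicit Types (m s x y : R).

(** Subadditive, and equal to 1 beyond m: it bounds the tail indicator of a sum by a sum of bounded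
    terms, which have means even when the summands have none. *)
Definition trunc m s := Num.min 1 (`|s| / m).

(* The density of [trunc m] with respect to [levy_weight] on the positive half-line. *)
Definition trunc_density m y := (1 + `|y|) / Num.max `|y| m.

Lemma trunc_ge0 m s : 0 <= m -> 0 <= trunc m s.
Proof. by move=> m0; rewrite le_min ler01 divr_ge0. Qed.

Lemma trunc_le1 m s : trunc m s <= 1.
Proof. by rewrite ge_min lexx. Qed.

Lemma trunc_eq1 m s : 0 < m -> m <= `|s| -> trunc m s = 1.
Proof. by move=> m0 ms; rewrite /trunc min_l// ler_pdivlMr// mul1r. Qed.

Lemma trunc_add m s1 s2 : 0 <= m -> trunc m (s1 + s2) <= trunc m s1 + trunc m s2.
Proof.
move=> m0; have h : `|s1 + s2| / m <= `|s1| / m + `|s2| / m.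
  by rewrite -mulrDl ler_wpM2r ?invr_ge0// ler_normD.
have h1 : 0 <= `|s1| / m by rewrite divr_ge0.
have h2 : 0 <= `|s2| / m by rewrite divr_ge0.
rewrite /trunc; move: h h1 h2; move: (_ / m) (_ / m) (_ / m) => p q r.
by rewrite /Order.min; do 3 case: ltP => ?; lra.
Qed.

Lemma trunc_sum m N (f : nat -> R) : 0 <= m ->
  trunc m (\sum_(i < N) f i) <= \sum_(i < N) trunc m (f i).
Proof.
move=> m0; elim: N => [|N ih].
  by rewrite !big_ord0 /trunc normr0 mul0r min_r.
by rewrite !big_ord_recr /= (le_trans (trunc_add _ _ m0))// lerD2r.
Qed.

(** If |x| <= m, then |x y| / m^2 <= |y| / m. Otherwise |x| / m >= 1 pays for the second term, whose
    mean over X is of order 1 / m. *)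
Lemma trunc_mul m x y : 1 <= m -> trunc (m ^+ 2) (x * y) <= trunc m y + `|x| / m * trunc 1 y.
Proof.
move=> m1; have m0 : 0 < m by exact: lt_le_trans m1.
have y0 := normr_ge0 y; have x0 := normr_ge0 x.
have [xm|xm] := leP `|x| m.
  rewrite (@le_trans _ _ (trunc m y))//; last first.
    by rewrite lerDl mulr_ge0 ?trunc_ge0// divr_ge0// ltW.
  rewrite /trunc le_min ge_min lexx /= ge_min; apply/orP; right.
  rewrite normrM expr2 invfM mulrACA ler_piMl ?divr_ge0 ?(ltW m0)//.
  by rewrite ler_pdivrMr// mul1r.
rewrite (@le_trans _ _ (`|x| / m * trunc 1 y))//; last first.
  by rewrite lerDr trunc_ge0// ltW.
have xm1 : 1 <= `|x| / m by rewrite ler_pdivlMr// mul1r ltW.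
rewrite {2}/trunc divr1; have [y1|y1] := leP 1 `|y|.
  by rewrite mulr1 (le_trans (trunc_le1 _ _)).
rewrite /trunc ge_min; apply/orP; right.
rewrite normrM expr2 invfM mulrACA ler_wpM2l ?divr_ge0 ?(ltW m0)//.
by rewrite ler_piMr// invf_le1.
Qed.

Lemma trunc_sqr m y : 1 <= m -> trunc (m ^+ 2) y <= trunc m y.
Proof.
move=> m1; have m0 : 0 < m by exact: lt_le_trans m1.
rewrite /trunc le_min ge_min lexx /= ge_min; apply/orP; right.
by rewrite expr2 invfM mulrA ler_piMr ?divr_ge0 ?(ltW m0)// invf_le1.
Qed.

Lemma trunc_densityE m y : 0 < m -> trunc_density m y * levy_weight `|y| = trunc m y.
Proof.
move=> m0; have y0 := normr_ge0 y.
have y1 : 1 + `|y| != 0 by rewrite gt_eqF// ltr_wpDr.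
have M0 : Num.max `|y| m != 0 by rewrite gt_eqF// lt_max m0 orbT.
rewrite /trunc_density /levy_weight.
have -> : (1 + `|y|) / Num.max `|y| m * (`|y| / (1 + `|y|)) = `|y| / Num.max `|y| m.
  by field; rewrite y1 M0.
rewrite /trunc; have [ym|ym] := leP `|y| m; first by rewrite min_r// ler_pdivrMr// mul1r.
have ny : 0 < `|y| by exact: lt_trans ym.
by rewrite divff ?gt_eqF// min_l// ler_pdivlMr// mul1r ltW.
Qed.

Lemma abs_trunc_density_le m y : 1 <= m -> `|trunc_density m y| <= 2.
Proof.
move=> m1; have m0 : 0 < m by exact: lt_le_trans m1.
have M0 : 0 < Num.max `|y| m by rewrite lt_max m0 orbT.
rewrite /trunc_density ger0_norm ?divr_ge0 ?addr_ge0 ?(ltW M0)//.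
rewrite ler_pdivrMr//; have : `|y| <= Num.max `|y| m by rewrite le_max lexx.
have : m <= Num.max `|y| m by rewrite le_max lexx orbT.
by move: (Num.max _ _) => M mM yM; lra.
Qed.

Lemma continuous_trunc_density m : 0 < m -> continuous (trunc_density m).
Proof.
move=> m0 y; apply: cvgM; first by apply: cvgD; [exact: cvg_cst|exact: norm_continuous].
apply: cvgV; first by rewrite gt_eqF// lt_max m0 orbT.
by apply: (@continuous_max R R^o (fun y => `|y|) (fun=> m) y);
  [exact: norm_continuous|exact: cvg_cst].
Qed.

Lemma cvg_trunc_density y : trunc_density j.+1%:R y @[j --> \oo] --> 0.
Proof.
rewrite -[X in _ --> X](mulr0 (1 + `|y|)); apply: cvgMr.
apply: cvg_trans (@cvg_harmonic R); apply: near_eq_cvg; near=> j.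
rewrite /= max_r//; rewrite -natr1 (@le_trans _ _ j%:R) ?lerDl//.
by near: j; exact: nbhs_infty_ger.
Unshelve. all: by end_near. Qed.

Lemma measurable_trunc m : measurable_fun setT (trunc m).
Proof.
by apply: measurable_minr => //; apply: measurable_funM.
Qed.

End truncation.

(** * The triangular array: limits, tightness and limit laws *)

Section limit_exponent.
Context {R : realType} (F : probability R R) (L : {measure set R -> \bar R}) (alpha t1 t2 : R).

Definition limit_Re := levy_integral L (levy_kernel F kcos t1 t2).

Definition limit_Im :=
  alpha * (t1 * \int[F]_x x + t2) + levy_integral L (levy_kernel F ksin t1 t2).

End limit_exponent.

Section triangular_array.
Context (R : realType) (U : set_system nat) {UU : UltraFilter U}.
Hypothesis ooU : \oo `<=` U.
Context (d0 : measure_display) (T0 : measurableType d0) (P0 : probability T0 R).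
Context (X Y : {RV P0 >-> R}).
Hypotheses (hXY : independent P0 X Y) (hY : P0 [set w | 0 <= Y w] = 1%E)
  (hX : ('E_P0[fun w => `|X w|%R] < +oo)%E).
Context (d : measure_display) (T : measurableType d) (P : probability T R).
Context (Xs Ys : nat -> {RV P >-> R}).
Hypotheses (hindep : mutually_independent P (fun i w => (Xs i w, Ys i w)))
  (hlaw : forall i, same_law P P0 (fun w => (Xs i w, Ys i w)) (fun w => (X w, Y w))).
Context (n_ : nat -> nat) (a : nat -> R).
Hypotheses (hn : {homo n_ : j k / (j < k)%N}) (a0 : forall k, 0 < a k).
Context (d2 : measure_display) (T2 : measurableType d2) (P2 : probability T2 R).
Context (W2 : {RV P2 >-> R}) (hW2 : forall w, 0 <= W2 w).
Context (b : R) (L : {measure set R -> \bar R}).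
Hypotheses (hL : levy_measure_pos L) (hL1 : (\int[L]_(s in `]0%R, 1%R]) s%:E < +oo)%E).
Hypotheses (hcf : forall u, char_fun P2 W2 u = cexp (levy_exponent b L u))
  (hcvg : cvg_in_distribution P P2 (fun k w => (\sum_(i < n_ k) Ys i w) / a k) W2).

Local Notation alpha := (b - \int[L]_(x in `]0%R, 1%R]) x).
Local Notation F := (distribution P0 X).
Local Notation J := (jump_integral P0 Y n_ a).
Local Notation phi t1 t2 k := (summand_char X Y (a k) t1 t2).

Let iF : F.-integrable setT (EFin \o (fun x : R => x)).
Proof. exact: integrable_distribution_id. Qed.

Let n_ge k : (k <= n_ k)%N.
Proof. by elim: k => // k ih; apply: (leq_ltn_trans ih); exact: hn. Qed.

Let n_gt0 : \forall k \near U, (0 < n_ k)%N.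
Proof. by apply: ooU; exists 1 => // k /= k0; exact: leq_trans (n_ge k). Qed.

Let n_infty : ((n_ k)%:R : R) @[k --> U] --> +oo.
Proof.
have h : ((n_ k)%:R : R) @[k --> \oo] --> +oo.
  by apply/cvgryPge => A; near=> k; rewrite (@le_trans _ _ k%:R) ?ler_nat//;
    near: k; exact: nbhs_infty_ger.
by move=> A /h; exact: ooU.
Unshelve. all: by end_near. Qed.

Let weak_cvg (f : R -> R) : continuous f -> (exists C : R, forall y, `|f y| <= C) ->
  \int[P]_w f ((\sum_(i < n_ k) Ys i w) / a k) @[k --> \oo] --> \int[P2]_w f (W2 w).
Proof.
move=> cf [C fC].
have bf : bmeas f by split; [exact: continuous_measurable_fun|exists C].
have mS k : measurable_fun setT (fun w => (\sum_(i < n_ k) Ys i w) / a k).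
  by apply: measurable_funM => //; exact: measurable_sum.
have /(hcvg cf) : bounded_fun f.
  by exists C; split; [exact: num_real|move=> x /ltW Cx z _; exact: le_trans (fC _) Cx].
rewrite (expectation_Rintegral P2 (bmeas_comp _ bf))// => /fine_cvg.
apply: cvg_trans; apply: near_eq_cvg; apply: nearW => k /=.
by rewrite (expectation_Rintegral P (bmeas_comp (mS k) bf)).
Qed.

Let laplace u : 0 < u ->
  (\int[P0]_w expR (- (u * jump Y a k w))) ^+ n_ k @[k --> \oo] -->
  \int[P2]_w expR (- (u * W2 w)).
Proof.
move=> u0; have := @weak_cvg (fun y => expR (- (u * `|y|))) _ _.
rewrite (_ : (fun k => _) = fun k => (\int[P0]_w expR (- (u * jump Y a k w))) ^+ n_ k); last first.
  by apply/funext => k; rewrite (sum_laplace hY hindep hlaw)// ltW.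
rewrite (_ : \int[P2]_w _ = \int[P2]_w expR (- (u * W2 w))); last first.
  by apply: eq_Rintegral => w _; rewrite ger0_norm.
apply.
  move=> y; apply: continuous_comp; last exact: continuous_expR.
  by apply: cvgN; apply: cvgMr; exact: norm_continuous.
exists 1 => y; rewrite ger0_norm ?expR_ge0// -expR0 ler_expR oppr_le0.
by rewrite mulr_ge0// ltW.
Qed.

Let J_E k f : bmeas f ->
  J k f = (n_ k)%:R * \int[P0]_w (f (`|Y w| / a k) * levy_weight (`|Y w| / a k)).
Proof.
move=> bf; rewrite -RintegralZl//; first by apply: eq_Rintegral => w _; rewrite /jump; ring.
have mJ : measurable_fun setT (fun w => `|Y w| / a k).
  by apply: measurable_funM => //; exact: measurableT_comp.
apply: bmeas_integrable; rewrite (_ : (fun w => _) = fun w => f (`|Y w| / a k) *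
    levy_weight `| `|Y w| / a k |); last first.
  by apply/funext => w; rewrite (ger0_norm (divr_ge0 _ _))// ltW.
apply: bmeasM; first exact: bmeas_comp.
exact: (bmeas_comp mJ (@bmeas_levy_weight_abs R)).
Qed.

Let bK kr t1 t2 : kernel kr -> bmeas (levy_kernel F kr t1 t2).
Proof. exact: bmeas_levy_kernel. Qed.

Let cK kr t1 t2 : kernel kr -> continuous (levy_kernel F kr t1 t2) /\
  exists C : R, forall y, `|levy_kernel F kr t1 t2 y| <= C.
Proof. by move=> hk; split; [exact: continuous_levy_kernel|exact: levy_kernel_bounded]. Qed.

Let n_Re t1 t2 k : (n_ k)%:R * (complex.Re (phi t1 t2 k) - 1) = J k (levy_kernel F kcos t1 t2).
Proof.
by rewrite (Re_summand_char hXY hX (a0 k)) J_E//; apply: bK; exact: kernel_kcos.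
Qed.

Let n_Im t1 t2 k : (n_ k)%:R * complex.Im (phi t1 t2 k) = J k (levy_kernel F ksin t1 t2).
Proof.
by rewrite (Im_summand_char hXY hX (a0 k)) J_E//; apply: bK; exact: kernel_ksin.
Qed.

(** Frequencies (0, u) suffice: they see only the sums of the Y_i, whose limit is given. The measure
    so identified does not depend on U and serves all (t1, t2). *)
Lemma array_limit : 0 <= alpha /\
  forall f, continuous f -> (exists C : R, forall y, `|f y| <= C) ->
  J k f @[k --> U] --> alpha * f 0 + levy_integral L f.
Proof.
have mY : measurable_fun setT Y by [].
have mW : measurable_fun setT W2 by [].
have [M [v [M0 mv v0 H]]] := jump_integral_helly ooU mY mW hW2 a0 laplace.
have [|al HJ] := @levy_identification R L hL hL1 F iF b M v mv v0.
  move=> u /=.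
  have [cc Cc] := @cK kcos 0 u kernel_kcos; have [cs Cs] := @cK ksin 0 u kernel_ksin.
  have hc : (n_ k)%:R * (complex.Re (phi 0 u k) - 1) @[k --> U] -->
      \int[lebesgue_measure]_(w in `[0, M[) levy_kernel F kcos 0 u (v w).
    by under eq_fun do rewrite n_Re; exact: H.
  have hs : (n_ k)%:R * complex.Im (phi 0 u k) @[k --> U] -->
      \int[lebesgue_measure]_(w in `[0, M[) levy_kernel F ksin 0 u (v w).
    by under eq_fun do rewrite n_Im; exact: H.
  have phi1 k : `|phi 0 u k| <= 1 by exact: norm_summand_char_le1.
  have [hRe hIm] := cvg_complex_power phi1 n_infty hc hs.
  have E k : phi 0 u k ^+ n_ k = cintegral P setT (fun w =>
      cexp ('i%C * (u * ((\sum_(i < n_ k) Ys i w) / a k))%:C%C)).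
    rewrite -(sum_char hY hindep hlaw); congr cintegral; apply/funext => w.
    by rewrite mul0r add0r.
  have mS k : measurable_fun setT (fun w => u * ((\sum_(i < n_ k) Ys i w) / a k)).
    by apply: measurable_funM => //; apply: measurable_funM => //; exact: measurable_sum.
  rewrite -hcf /char_fun char_funE; apply/eqP; rewrite eq_complex; apply/andP; split; apply/eqP.
    apply: (cvg_unique (@Rhausdorff R) hRe).
    rewrite (_ : (fun k => _) = fun k => \int[P]_w cos (u * ((\sum_(i < n_ k) Ys i w) / a k))).
      have h := @weak_cvg (fun x => cos (u * x)).
      move=> A hA; apply: ooU; move: A hA; apply: h.
        by apply: (@continuousT_comp R (fun x => u * x) cos);
          [move=> y; exact: mulrl_continuous|exact: continuous_cos].
      by exists 1 => x; exact: cos_max.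
    by apply/funext => k; rewrite E char_funE.
  apply: (cvg_unique (@Rhausdorff R) hIm).
  rewrite (_ : (fun k => _) = fun k => \int[P]_w sin (u * ((\sum_(i < n_ k) Ys i w) / a k))).
    have h := @weak_cvg (fun x => sin (u * x)).
    move=> A hA; apply: ooU; move: A hA; apply: h.
      by apply: (@continuousT_comp R (fun x => u * x) sin);
        [move=> y; exact: mulrl_continuous|exact: continuous_sin].
    by exists 1 => x; exact: sin_max.
  by apply/funext => k; rewrite E char_funE.
split => // f cf [C fC].
rewrite -HJ; first by apply: H => //; exists C.
by split; [exact: continuous_measurable_fun|exists C].
Qed.

Local Notation fRe t1 t2 := (limit_Re F L t1 t2).
Local Notation fIm t1 t2 := (limit_Im F L alpha t1 t2).

(** A block of N k summands carries the fraction rho of the exponent; rho = 1 / m yields m-th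
    roots. *)
Lemma sum_char_limit (N : nat -> nat) (rho : R) (t1 t2 : R) :
  ((N k)%:R : R) @[k --> U] --> +oo -> (N k)%:R / (n_ k)%:R @[k --> U] --> rho ->
  complex.Re (phi t1 t2 k ^+ N k) @[k --> U] -->
    complex.Re (cexp ((rho * fRe t1 t2) +i* (rho * fIm t1 t2))%C) /\
  complex.Im (phi t1 t2 k ^+ N k) @[k --> U] -->
    complex.Im (cexp ((rho * fRe t1 t2) +i* (rho * fIm t1 t2))%C).
Proof.
move=> Noo Nrho; have [al lim] := array_limit.
have [cc Cc] := @cK kcos t1 t2 kernel_kcos; have [cs Cs] := @cK ksin t1 t2 kernel_ksin.
have scale (x : nat -> R) (l : R) : (n_ k)%:R * x k @[k --> U] --> l ->
    (N k)%:R * x k @[k --> U] --> rho * l.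
  move=> h; apply: cvg_trans (@cvgM _ _ _ _ _ _ _ _ Nrho h); apply: near_eq_cvg.
  apply: filterS n_gt0 => k nk /=; rewrite mulrA divfK//.
  by rewrite pnatr_eq0 -lt0n.
apply: cvg_complex_power => //.
- by move=> k; exact: norm_summand_char_le1.
- apply: scale; under eq_fun do rewrite n_Re.
  have -> : fRe t1 t2 = alpha * levy_kernel F kcos t1 t2 0 +
      levy_integral L (levy_kernel F kcos t1 t2); last exact: lim.
  by rewrite levy_kernel0// /kcos invr0 mulr0 mul0r mulr0 add0r.
- apply: scale; under eq_fun do rewrite n_Im.
  have -> : fIm t1 t2 = alpha * levy_kernel F ksin t1 t2 0 +
      levy_integral L (levy_kernel F ksin t1 t2); last exact: lim.
  by rewrite levy_kernel0// (_ : ksin 0 = 1) ?[in LHS]/ksin ?eqxx// mul1r.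
Qed.

Let Z (N k : nat) w : R * R :=
  ((\sum_(i < N) Xs i w * Ys i w) / a k, (\sum_(i < N) Ys i w) / a k).

Let mZ N k : measurable_fun setT (Z N k).
Proof.
apply: measurable_fun_pair; apply: measurable_funM => //.
  by apply: measurable_sum => i; exact: measurable_funM.
exact: measurable_sum.
Qed.

Let mean_abs := \int[F]_x `|x|.

Let q m k (z : R * R) := trunc (m ^+ 2) (z.1 * (z.2 / a k)) + trunc (m ^+ 2) (z.2 / a k).

Let bq m k : bmeas (q m k).
Proof.
have m2 : 0 <= m ^+ 2 by rewrite sqr_ge0.
have bt (f : R * R -> R) : measurable_fun setT f -> bmeas (fun z => trunc (m ^+ 2) (f z)).
  move=> mf; split; first exact: (measurableT_comp (@measurable_trunc R _)).
  by exists 1 => z; rewrite ger0_norm ?trunc_ge0// trunc_le1.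
apply: bmeasD; apply: bt; last by apply: measurable_funM => //; exact: measurable_snd.
apply: measurable_funM; first exact: measurable_fst.
by apply: measurable_funM => //; exact: measurable_snd.
Qed.

Let bJ m k : 1 <= m -> bmeas (fun w => trunc m (`|Y w| / a k)).
Proof.
move=> m1; split; last first.
  by exists 1 => w; rewrite ger0_norm ?trunc_le1// trunc_ge0// (le_trans _ m1).
apply: (measurableT_comp (@measurable_trunc R _)).
by apply: measurable_funM => //; exact: measurableT_comp.
Qed.

Let J_trunc m k : 1 <= m ->
  J k (trunc_density m) = (n_ k)%:R * \int[P0]_w trunc m (`|Y w| / a k).
Proof.
move=> m1; have m0 : 0 < m by exact: lt_le_trans m1.
rewrite J_E; last first.
  split; first by apply: continuous_measurable_fun; exact: continuous_trunc_density.
  by exists 2 => y; exact: abs_trunc_density_le.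
congr (_ * _); apply: eq_Rintegral => w _; rewrite -trunc_densityE//.
by rewrite (ger0_norm (divr_ge0 _ _))// ltW.
Qed.

(** [trunc_mul] integrated over X. The factor 2 counts one [trunc m] from the product and one from Y
    itself by [trunc_sqr]. *)
Let summand_bound m k : 1 <= m ->
  \int[P0]_w q m k (X w, Y w) <=
  2 * \int[P0]_w trunc m (`|Y w| / a k) + mean_abs / m * \int[P0]_w trunc 1 (`|Y w| / a k).
Proof.
move=> m1; have m0 : 0 < m by exact: lt_le_trans m1.
rewrite (independent_Rintegral hXY (bq m k)).
have bE := bint_mean P0; have bmm := @bJ m k m1; have bm1 := @bJ 1 k (lexx 1).
rewrite -(bintZ bE)// -(bintZ bE)// -(bintD bE); [|exact: bmeasZ..].
have inner y : \int[F]_x q m k (x, y) <=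
    2 * trunc m (`|y| / a k) + mean_abs / m * trunc 1 (`|y| / a k).
  pose c2 := trunc 1 (`|y| / a k) / m.
  have abs_trunc m' (y' : R) : trunc m' (`|y'| / a k) = trunc m' (y' / a k).
    by rewrite /trunc !normrM normr_id.
  have i1 : F.-integrable setT (EFin \o (fun x : R => c2 * `|x|)).
    by apply: (integrableZl measurableT c2 (f := EFin \o (fun x : R => `|x|)));
      exact: (integrable_norm iF).
  have -> : 2 * trunc m (`|y| / a k) + mean_abs / m * trunc 1 (`|y| / a k) =
      \int[F]_x (2 * trunc m (`|y| / a k) + c2 * `|x|).
    rewrite RintegralD//; last exact: finite_measure_integrable_cst.
    rewrite Rintegral_probability_cst RintegralZl//; last exact: (integrable_norm iF).
    by rewrite /c2 -/mean_abs; ring.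
  apply: le_Rintegral => //.
  - by apply: bmeas_integrable; apply: (bmeas_comp _ (bq m k)); exact: measurable_fun_pair.
  - have := integrableD measurableT
      (finite_measure_integrable_cst F (2 * trunc m (`|y| / a k)) measurableT) i1.
    by [].
  - move=> x _; rewrite /q /= /c2 !abs_trunc.
    have h1 := trunc_mul x (y / a k) m1; have h2 := trunc_sqr (y / a k) m1.
    rewrite (_ : _ / m * `|x| = `|x| / m * trunc 1 (y / a k)); last by ring.
    by rewrite mulr2n mulrDl mul1r; lra.
have bi : bmeas (fun w => \int[F]_x q m k (x, Y w)).
  by have := bmeas_comp (measurable_funPT Y) (bmeas_partial_mean F (bq m k)).
apply: le_Rintegral => //.
- exact: bmeas_integrable.
- by apply: bmeas_integrable; apply: bmeasD; exact: bmeasZ.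
Qed.

Let tail_bound N m k : (N <= n_ k)%N -> 1 <= m ->
  \int[P]_w (\1_[set z : R * R | m ^+ 2 < `|z.1| \/ m ^+ 2 < `|z.2|] (Z N k w) : R) <=
  2 * J k (trunc_density m) + mean_abs / m * J k (trunc_density 1).
Proof.
move=> Nn m1; have m0 : 0 < m by exact: lt_le_trans m1.
have m2 : 0 < m ^+ 2 by rewrite exprn_gt0.
rewrite !J_trunc//.
have mZi i : measurable_fun setT (fun w => (Xs i w, Ys i w)) by exact: measurable_fun_pair.
have mZ0 : measurable_fun setT (fun w => (X w, Y w)) by exact: measurable_fun_pair.
have bqi i : bmeas (fun w => q m k (Xs i w, Ys i w)) by exact: bmeas_comp (bq m k).
have [bs es] : bmeas (fun w => \sum_(i < N) q m k (Xs i w, Ys i w)) /\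
    \int[P]_w (\sum_(i < N) q m k (Xs i w, Ys i w)) = N%:R * \int[P0]_w q m k (X w, Y w).
  elim: N Nn => [|M ih] Mn.
    under eq_fun do rewrite big_ord0; split; first exact: bmeas_cst.
    by rewrite Rintegral_probability_cst mul0r.
  have [b1 e1] := ih (ltnW Mn); under eq_fun do rewrite big_ord_recr /=.
  split; first exact: bmeasD.
  rewrite (bintD (bint_mean P)) // e1 -natr1 mulrDl mul1r; congr (_ + _).
  exact: same_law_Rintegral (hlaw M) _ (bq m k).
apply: (@le_trans _ _ (\int[P]_w (\sum_(i < N) q m k (Xs i w, Ys i w)))).
  apply: le_Rintegral => //.
  - by apply: bmeas_integrable; apply: bmeas_comp => //; apply: bmeas_indic; exact: measurable_norm_gt.
  - exact: bmeas_integrable.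
  - move=> w _; rewrite big_split /= indicE.
    have h1 := trunc_sum N (fun i => Xs i w * (Ys i w / a k)) (ltW m2).
    have h2 := trunc_sum N (fun i => Ys i w / a k) (ltW m2).
    rewrite (@le_trans _ _ (trunc (m ^+ 2) (Z N k w).1 + trunc (m ^+ 2) (Z N k w).2))//.
      case: (boolP (_ \in _)) => /=; last by rewrite addr_ge0// trunc_ge0// ltW.
      rewrite inE /= => -[z1|z2].
        by rewrite (trunc_eq1 m2 (ltW z1)) lerDl trunc_ge0// ltW.
      by rewrite (trunc_eq1 m2 (ltW z2)) lerDr trunc_ge0// ltW.
    rewrite /Z /= lerD//.
      by rewrite mulr_suml (eq_bigr (fun i : 'I_N => Xs i w * (Ys i w / a k)))// => i _; rewrite mulrA.
    by rewrite mulr_suml.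
rewrite es; apply: (@le_trans _ _ ((n_ k)%:R * \int[P0]_w q m k (X w, Y w))).
  rewrite ler_wpM2r ?ler_nat//; apply: Rintegral_ge0 => w _.
  by rewrite addr_ge0 ?trunc_ge0 ?ltW.
by rewrite mulrCA [_ / m * _]mulrCA -mulrDr ler_wpM2l// summand_bound.
Qed.

(** The tail bound converges along U to [B m]. As m grows, [trunc_density m] tends to 0 pointwise,
    at the atom 0 too, while staying below 2, and E|X| / m tends to 0; so [B m] becomes smaller than
    e. *)
Let tightness (N : nat -> nat) (e : R) : (forall k, (N k <= n_ k)%N) -> 0 < e ->
  exists K : R, \forall k \near U,
    \int[P]_w (\1_[set z : R * R | K < `|z.1| \/ K < `|z.2|] (Z (N k) k w) : R) <= e.
Proof.
move=> Nn e0; have [al lim] := array_limit.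
have bd (m : R) : 1 <= m -> bmeas (trunc_density m).
  move=> m1; split; last by exists 2 => y; exact: abs_trunc_density_le.
  by apply: continuous_measurable_fun; apply: continuous_trunc_density; exact: lt_le_trans m1.
have limd (m : R) : 1 <= m -> J k (trunc_density m) @[k --> U] -->
    alpha * trunc_density m 0 + levy_integral L (trunc_density m).
  move=> m1; apply: lim; last by exists 2 => y; exact: abs_trunc_density_le.
  by apply: continuous_trunc_density; exact: lt_le_trans m1.
pose B (m : R) := 2 * (alpha * trunc_density m 0 + levy_integral L (trunc_density m)) +
  mean_abs / m * (alpha * trunc_density 1 0 + levy_integral L (trunc_density 1)).
have bI : bint (levy_integral L) by exact: bint_levy_integral.
have j1 j : 1 <= j.+1%:R :> R by rewrite ler1n.
have B0 : B j.+1%:R @[j --> \oo] --> 0.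
  have -> : 0 = 2 * (alpha * 0 + levy_integral L (fun=> 0)) +
      mean_abs * 0 * (alpha * trunc_density 1 0 + levy_integral L (trunc_density 1)) :> R.
    have -> : levy_integral L (fun=> 0) = 0.
      by have := bintZ bI 0 (@bmeas_cst R _ R 0); rewrite !mul0r.
    by rewrite !mulr0 addr0 mulr0 mul0r addr0.
  apply: cvgD.
    apply: cvgMr; apply: cvgD; first by apply: cvgMr; exact: cvg_trunc_density.
    apply: (bint_lim bI (f_ := fun j => trunc_density j.+1%:R) (M := 2)).
    - by move=> j; exact: bd.
    - by move=> j y; exact: abs_trunc_density_le.
    - by move=> y; exact: cvg_trunc_density.
  by apply: cvgMl; apply: cvgMr; exact: cvg_harmonic.
have /filter_ex[j Bj] : \forall j \near \oo, B j.+1%:R < e by exact: (cvgr_lt _ B0).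
exists (j.+1%:R ^+ 2).
have limB : 2 * J k (trunc_density j.+1%:R) + mean_abs / j.+1%:R * J k (trunc_density 1)
    @[k --> U] --> B j.+1%:R.
  by apply: cvgD; apply: cvgMr; exact: limd.
have : \forall k \near U,
    2 * J k (trunc_density j.+1%:R) + mean_abs / j.+1%:R * J k (trunc_density 1) < e.
  exact: (cvgr_lt _ limB).
by apply: filterS => k /ltW; apply: le_trans; exact: tail_bound.
Qed.

Lemma limit_law (N : nat -> nat) (rho : R) :
  (forall k, (N k <= n_ k)%N) -> ((N k)%:R : R) @[k --> U] --> +oo ->
  (N k)%:R / (n_ k)%:R @[k --> U] --> rho ->
  exists V : R -> R * R, [/\ measurable_fun setT V,
    forall f : R * R -> R, continuous f -> bounded_fun f ->
      \int[P]_w f ((\sum_(i < N k) Xs i w * Ys i w) / a k, (\sum_(i < N k) Ys i w) / a k)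
        @[k --> U] --> \int[lebesgue_measure]_(w in `[0, 1[) f (V w),
    forall t1 t2, \int[lebesgue_measure]_(w in `[0, 1[) cos (t1 * (V w).1 + t2 * (V w).2) =
      complex.Re (cexp ((rho * fRe t1 t2) +i* (rho * fIm t1 t2))%C) &
    forall t1 t2, \int[lebesgue_measure]_(w in `[0, 1[) sin (t1 * (V w).1 + t2 * (V w).2) =
      complex.Im (cexp ((rho * fRe t1 t2) +i* (rho * fIm t1 t2))%C)].
Proof.
move=> Nn Noo Nrho.
have pL k : plin (fun f : R * R -> R => \int[P]_w f (Z (N k) k w)).
  have := @plin_Rintegral R _ _ _ _ P setT (Z (N k) k) (fun=> 1) measurableT (@mZ _ _)
    (finite_measure_integrable_cst P 1 measurableT) (fun _ _ => ler01).
  by congr plin; apply/funext => f; apply: eq_Rintegral => w _; rewrite mulr1.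
have [||M [V [M0 mV HV]]] := @helly_plane R U UU _ 1 pL.
- by apply: nearW => k; rewrite Rintegral_probability_cst.
- by move=> e e0; exact: tightness.
(* The constant function 1 is an admissible test function, so no mass is lost. *)
have M1 : M = 1.
  have c1 : continuous (fun _ : R * R => 1 : R) by move=> z; exact: cvg_cst.
  have eM : \int[lebesgue_measure]_(w in `[0, M[) (1 : R) = M.
    rewrite Rintegral_cst//= lebesgue_measure_itv /= lte_fin mul1r.
    by move: M0; rewrite le_eqVlt => /orP[/eqP <-|->]; rewrite ?ltxx //= oppr0 addr0.
  have := HV _ c1; rewrite eM.
  have bc : bounded_fun (fun _ : R * R => 1 : R).
    by exists 1; split; [exact: num_real|move=> x /ltW ? z _; rewrite normr1].
  move=> /(_ bc); under eq_fun do rewrite Rintegral_probability_cst.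
  by move=> h; exact: (cvg_unique (@Rhausdorff R) h (@cvg_cst _ _ _ _ _)).
have clin t1 t2 : continuous (fun z : R * R => t1 * z.1 + t2 * z.2).
  by move=> z; apply: cvgD; apply: cvgMr; [exact: cvg_fst|exact: cvg_snd].
rewrite M1 in HV; exists V; split => //.
- move=> t1 t2; have [hR _] := sum_char_limit t1 t2 Noo Nrho.
  apply: (cvg_unique (@Rhausdorff R) _ hR).
  rewrite /= (_ : (fun k => _) = fun k => \int[P]_w cos (t1 * (Z (N k) k w).1 + t2 * (Z (N k) k w).2));
    last by apply/funext => k; rewrite -(sum_char hY hindep hlaw) char_funE.
  apply: (HV (fun z => cos (t1 * z.1 + t2 * z.2))).
    by move=> z; apply: (continuous_comp (clin t1 t2 z)); exact: continuous_cos.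
  by exists 1; split; [exact: num_real|move=> x /ltW ? z _; apply: le_trans (cos_max _) _].
- move=> t1 t2; have [_ hI] := sum_char_limit t1 t2 Noo Nrho.
  apply: (cvg_unique (@Rhausdorff R) _ hI).
  rewrite /= (_ : (fun k => _) = fun k => \int[P]_w sin (t1 * (Z (N k) k w).1 + t2 * (Z (N k) k w).2));
    last by apply/funext => k; rewrite -(sum_char hY hindep hlaw) char_funE.
  apply: (HV (fun z => sin (t1 * z.1 + t2 * z.2))).
    by move=> z; apply: (continuous_comp (clin t1 t2 z)); exact: continuous_sin.
  by exists 1; split; [exact: num_real|move=> x /ltW ? z _; apply: le_trans (sin_max _) _].
Qed.

End triangular_array.

(** * The jump measure Pi and its exponent *)

Section sigma_finite_measures.
Context (R : realType) (L : {measure set R -> \bar R}).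

(** An alias carrying the proof, to which the sigma-finite structure required by Fubini's theorem is
    attached. *)
Definition sigma_finite_copy of sigma_finite setT L : set R -> \bar R := L.

Context (hL : sigma_finite setT L).

HB.instance Definition _ := Measure.copy (sigma_finite_copy hL) L.
HB.instance Definition _ :=
  Measure_isSigmaFinite.Build _ _ _ (sigma_finite_copy hL) hL.

End sigma_finite_measures.

Section product_jump.
Context (R : realType) (F : probability R R) (L : {measure set R -> \bar R}).
Hypotheses (iF : F.-integrable setT (EFin \o (fun x : R => x)))
  (hL : levy_measure_pos L) (hL1 : (\int[L]_(s in `]0%R, 1%R]) s%:E < +oo)%E).
Local Notation Pi := (product_jump_measure F L).
Local Notation iw := (integrable_levy_weight hL hL1).

(** L does not charge ]-oo, 0], and on [e, +oo[ its mass is finite because min (1, x^2) is at least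
    min (1, e^2) there. *)
Let L_sigma_finite : sigma_finite setT L.
Proof.
have [L0 L1] := hL.
exists (fun i : nat => `]-oo, 0%R] `|` `[i.+1%:R^-1, +oo[).
  apply/esym/seteqP; split => // x _.
  have [x0|x0] := leP x 0; first by exists 0 => //; left; rewrite /= in_itv.
  exists (Num.truncn x^-1) => //; right; rewrite /= in_itv /= andbT.
  by rewrite invf_ple ?posrE// ltW// truncnS_gt.
move=> i; split; first by apply: measurableU; exact: measurable_itv.
apply: (le_lt_trans (measureU2 _ _ _)); [exact: measurable_itv|exact: measurable_itv|].
have L0' : L `]-oo, 0%R]%classic = 0%E by exact: L0.
rewrite [X in (X + _)%E]L0' add0e.
set e : R := i.+1%:R^-1; have e0 : 0 < e by rewrite invr_gt0 ltr0n.
pose c := Num.min 1 (e ^+ 2); have c0 : 0 < c by rewrite lt_min ltr01 exprn_gt0.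
have h : (c%:E * L `[e, +oo[%classic <= \int[L]_(x in `]0%R, +oo[) (Num.min 1 (x ^+ 2))%:E)%E.
  rewrite -(integral_cst L (measurable_itv `[e, +oo[)).
  apply: (@le_trans _ _ (\int[L]_(x in `[e, +oo[) (Num.min 1 (x ^+ 2))%:E)%E).
    apply: ge0_le_integral => //.
    - by move=> x _; rewrite lee_fin ltW.
    - by apply/measurable_EFinP; apply: measurable_minr.
    - move=> x; rewrite /= in_itv /= andbT => ex; rewrite lee_fin le_min !ge_min lexx /=.
      by rewrite lerXn2r ?nnegrE ?(ltW e0) ?(le_trans (ltW e0))// orbT.
  apply: ge0_subset_integral => //.
  - by apply/measurable_EFinP; apply: measurable_minr.
  - by move=> x _; rewrite lee_fin le_min ler01 sqr_ge0.
  - by move=> x; rewrite /= !in_itv /= !andbT; exact: lt_le_trans.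
have := le_lt_trans h L1.
by rewrite muleC -lte_pdivlMr// => /lt_le_trans; apply; exact: leey.
Qed.

Let map (p : R * R) : R * R := (p.1 * p.2, p.2).

Let mmap : measurable_fun setT map.
Proof.
apply: measurable_fun_pair; last exact: measurable_snd.
by apply: measurable_funM; [exact: measurable_fst|exact: measurable_snd].
Qed.

Let mean_abs := \int[F]_x (1 + `|x|).

Let i1 : F.-integrable setT (EFin \o (fun x : R => 1 + `|x|)).
Proof.
by have := integrableD measurableT (finite_measure_integrable_cst F 1 measurableT)
  (integrable_norm iF).
Qed.

(** The bound (1 + |x|) w(s) is integrable for F times L on s > 0, as a product of two integrable
    functions; Fubini's theorem then applies before the map (x, s) -> (x s, s). *)
Lemma product_jump_Rintegral (f : R * R -> R) (C : R) : measurable_fun setT f ->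
  (forall x s, 0 < s -> `|f (x * s, s)| <= C * ((1 + `|x|) * levy_weight s)) ->
  Pi.-integrable setT (EFin \o f) /\
  \int[Pi]_z f z = \int[L]_(s in `]0%R, +oo[) (\int[F]_x f (x * s, s)).
Proof.
move=> mf fC.
pose L' : {sigma_finite_measure set R -> \bar R} := sigma_finite_copy L_sigma_finite.
pose M1 := (F \x L')%E.
pose g : R * R -> \bar R := EFin \o (f \o map).
have mg : measurable_fun setT g by apply/measurable_EFinP; exact: measurableT_comp.
have D : `]0%R, +oo[%classic = setT `\` `]-oo, 0%R] :> set R.
  by apply/seteqP; split => x /=; rewrite !in_itv /= andbT ltNge; [move/negP|move=> [_] /negP].
have [L0 _] := hL.
have C0 : 0 <= C.
  have := le_trans (normr_ge0 _) (fC 0 1 ltr01); rewrite normr0 addr0 mul1r => h.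
  have w1 : 0 < levy_weight (1 : R) by rewrite divr_gt0.
  by rewrite -(pmulr_lge0 _ w1).
have mfs (s : R) : measurable_fun setT (fun x : R => f (x * s, s)).
  apply: (measurableT_comp (f := f)) => //.
  by apply: measurable_fun_pair => //; exact: measurable_funM.
have ifs (s : R) : 0 < s -> F.-integrable setT (EFin \o (fun x : R => f (x * s, s))).
  move=> s0.
  have im : F.-integrable setT (EFin \o (fun x : R => C * levy_weight s * (1 + `|x|))).
    exact: (integrableZl measurableT _ i1).
  apply: (le_integrable measurableT _ _ im); first exact/measurable_EFinP.
  move=> x _; rewrite /= lee_fin (le_trans (fC x s s0))// (le_trans _ (ler_norm _))//.
  by rewrite (_ : C * (_ * _) = C * levy_weight s * (1 + `|x|))//; ring.
have ig : M1.-integrable setT g.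
  apply/(integrable21ltyP F L' mg).
  have mG : measurable_fun setT (fun y => \int[F]_x `|g (x, y)|)%E.
    by apply: (@measurable_fun_fubini_tonelli_G _ _ _ _ _ F (fun z => `|g z|)%E) => //;
      exact: measurableT_comp.
  rewrite (@ge0_negligible_integral _ _ _ L' setT `]-oo, 0%R])//; last first.
    by move=> y _; exact: integral_ge0.
  rewrite -D; apply: (@le_lt_trans _ _ (\int[L]_(s in `]0%R, +oo[) (C * mean_abs * levy_weight s)%:E)%E).
    apply: ge0_le_integral => //.
    - by move=> y _; exact: integral_ge0.
    - exact: measurable_funS mG.
    - by apply/measurable_EFinP; apply: measurable_funM => //; exact: measurable_levy_weight.
    - move=> s; rewrite /= in_itv /= andbT => s0.
      apply: (@le_trans _ _ (\int[F]_x (C * levy_weight s * (1 + `|x|))%:E)%E).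
        apply: ge0_le_integral => //.
        + apply/measurable_EFinP.
          exact: (measurableT_comp (@normr_measurable R setT) (mfs s)).
        + apply/measurable_EFinP; apply: (@measurable_funM _ _ _ _ (fun=> _)) => //.
          by apply: (@measurable_funD _ _ _ _ (fun=> _)) => //; exact: (@normr_measurable R setT).
        + by move=> x _; rewrite /g /= lee_fin; rewrite (le_trans (fC x s s0))//; lra.
      have im : F.-integrable setT (EFin \o (fun x : R => C * levy_weight s * (1 + `|x|))).
        exact: (integrableZl measurableT _ i1).
      rewrite -[leLHS]fineK; last exact: integrable_fin_num.
      by rewrite lee_fin -/(Rintegral _ _ _) RintegralZl// -/mean_abs mulrAC.
  exact: (integrable_lty (measurable_itv _) (integrableZl (measurable_itv _) (C * mean_abs) iw)).
(* Pi was defined with the other order of integration; sigma-finiteness makes the two product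
   measures agree. *)
have PiE A : measurable A -> A `<=` setT -> Pi A = pushforward M1 map A.
  move=> mA _; rewrite /product_jump_measure /pushforward /M1.
  have mA' : measurable (map @^-1` A) by rewrite -[X in measurable X]setTI; exact: mmap.
  apply/esym; apply: (product_measure_unique (m1 := F) (m2 := L') (m' := (F \x^ L')%E)) => //.
  by move=> A1 A2 mA1 mA2; exact: product_measure2E.
have ipush : (pushforward M1 map).-integrable setT (EFin \o f).
  by apply: integrable_pushforward => //; exact/measurable_EFinP.
split.
  apply/integrableP; split; first exact/measurable_EFinP.
  have [_] := integrableP _ _ _ ipush; apply: le_lt_trans.
  by rewrite (eq_measure_integral _ PiE).
rewrite /Rintegral (eq_measure_integral _ PiE) integral_pushforward//; last exact/measurable_EFinP.
rewrite -(@integral21_prod_meas1 _ _ _ _ _ F L' _ ig).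
have iG : L'.-integrable setT (fubini_G F g).
  apply/integrableP; split; first exact: measurable_fubini_G ig.
  have := (integrable21ltyP F L' mg).1 ig.
  apply: le_lt_trans; apply: ge0_le_integral => //.
  - by apply: measurableT_comp => //; exact: measurable_fubini_G ig.
  - by apply: (@measurable_fun_fubini_tonelli_G _ _ _ _ _ F (fun z => `|g z|)%E) => //;
      exact: measurableT_comp.
  - move=> s _; apply: le_abse_integral => //.
    by apply/measurable_EFinP; exact: mfs.
rewrite (@negligible_integral _ _ _ L' setT `]-oo, 0%R])// -D.
congr fine; apply: eq_integral => s; rewrite inE /= in_itv /= andbT => s0.
rewrite /fubini_G /Rintegral fineK//; apply: integrable_fin_num => //; exact: ifs.
Qed.

(** Since s <= 2 w(s) for s <= 1 and 1 <= 2 w(s) for s > 1, hence the factor 2. *)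
Let jump_bound (x s C f : R) : 0 < s -> `|f| <= C -> `|f| <= C * ((1 + `|x|) * s) ->
  `|f| <= 2 * C * ((1 + `|x|) * levy_weight s).
Proof.
move=> s0 f1 f2; have x0 := normr_ge0 x; have C0 := le_trans (normr_ge0 _) f1.
have [s1|s1] := leP s 1.
  apply: (le_trans f2); rewrite -mulrA [leRHS]mulrCA ler_wpM2l// mulrCA ler_wpM2l ?addr_ge0//.
  by rewrite /levy_weight mulrA ler_pdivlMr; nra.
apply: (le_trans f1); have : 1 <= 2 * levy_weight s.
  by rewrite /levy_weight mulrA ler_pdivlMr; lra.
move=> w1; have w0 : 0 <= levy_weight s by lra.
have := ler_wpM2l C0 w1; have := mulr_ge0 (mulr_ge0 C0 w0) x0; move: (levy_weight s) => w; lra.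
Qed.

Local Notation disk z := ((z \in punctured_disk R)%:R : R).

Let measurable_disk : measurable (punctured_disk R).
Proof.
have m2 : measurable_fun setT (fun z : R * R => z.1 ^+ 2 + z.2 ^+ 2).
  apply: measurable_funD; apply: measurable_funX; [exact: measurable_fst|exact: measurable_snd].
rewrite (_ : punctured_disk R = (fun z : R * R => z.1 ^+ 2 + z.2 ^+ 2) @^-1` `]0, 1]).
  by rewrite -[X in measurable X]setTI; apply: m2 => //; exact: measurable_itv.
by apply/seteqP; split => z; rewrite /punctured_disk /= in_itv.
Qed.

Let measurable_disk_indic : measurable_fun setT (fun z : R * R => disk z).
Proof.
by have := @measurable_indic _ _ R setT _ measurable_disk; congr measurable_fun; apply/funext.
Qed.

Let disk_bound (z : R * R) : `|z.1 * disk z| <= 1 /\ `|z.2 * disk z| <= 1.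
Proof.
case: (boolP (z \in _)); last by rewrite !mulr0 normr0.
rewrite inE /punctured_disk /= !mulr1 => /andP[_ z1].
have h1 := sqr_ge0 z.1; have h2 := sqr_ge0 z.2.
by split; rewrite -(@expr_le1 _ 2)// -normrX ger0_norm ?sqr_ge0//; lra.
Qed.

Let disk1_bound (x s : R) : 0 < s ->
  `|x * s * disk (x * s, s)| <= 2 * ((1 + `|x|) * levy_weight s).
Proof.
move=> s0; rewrite -[X in _ <= X * _]mulr1; apply: jump_bound => //.
  by case: (disk_bound (x * s, s)).
rewrite normrM mul1r (@le_trans _ _ `|x * s|)//.
  by rewrite ler_piMr//; case: (_ \in _); rewrite /= ?normr1 ?normr0.
by rewrite normrM (gtr0_norm s0) ler_pM2r// lerDr.
Qed.

Let disk2_bound (x s : R) : 0 < s ->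
  `|s * disk (x * s, s)| <= 2 * ((1 + `|x|) * levy_weight s).
Proof.
move=> s0; rewrite -[X in _ <= X * _]mulr1; apply: jump_bound => //.
  by case: (disk_bound (x * s, s)).
rewrite normrM mul1r (@le_trans _ _ `|s|)//.
  by rewrite ler_piMr//; case: (_ \in _); rewrite /= ?normr1 ?normr0.
by rewrite (gtr0_norm s0) ler_peMl ?(ltW s0)// lerDl.
Qed.

Let m1d : measurable_fun setT (fun z : R * R => z.1 * disk z).
Proof. by apply: measurable_funM => //; exact: measurable_fst. Qed.

Let m2d : measurable_fun setT (fun z : R * R => z.2 * disk z).
Proof. by apply: measurable_funM => //; exact: measurable_snd. Qed.

Let i1d := (product_jump_Rintegral m1d disk1_bound).1.
Let i2d := (product_jump_Rintegral m2d disk2_bound).1.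

Let disk_patch (f : R * R -> R) : (EFin \o f) \_ (punctured_disk R) =
  EFin \o (fun z => f z * disk z).
Proof.
by apply/funext => z; rewrite /patch /=; case: (z \in _); rewrite ?mulr1 ?mulr0.
Qed.

Lemma product_jump_integrable_fst : Pi.-integrable (punctured_disk R) (fun z => z.1%:E).
Proof.
rewrite -[X in _.-integrable X]setTI; apply/(integrable_restrict Pi measurable_disk measurableT).
by rewrite (disk_patch fst).
Qed.

Lemma product_jump_integrable_snd : Pi.-integrable (punctured_disk R) (fun z => z.2%:E).
Proof.
rewrite -[X in _.-integrable X]setTI; apply/(integrable_restrict Pi measurable_disk measurableT).
by rewrite (disk_patch snd).
Qed.

Lemma product_jump_levy_measure2 : levy_measure2 Pi.
Proof.
split.
  have m0 : measurable (map @^-1` [set (0, 0)]).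
    rewrite -[X in measurable X]setTI; apply: mmap => //.
    by rewrite -[X in measurable X](_ : [set 0] `*` [set 0] = _)//;
      [exact: measurableX|apply/seteqP; split => -[x y] /= [-> ->]].
  have mT : measurable ([set: R] `*` [set 0 : R]) by exact: measurableX.
  apply/eqP; rewrite eq_le measure_ge0 andbT.
  apply: (@le_trans _ _ ((F \x^ L)%E ([set: R] `*` [set 0]))).
    apply: (@le_measure _ _ _ (F \x^ L)%E); rewrite ?inE//.
    by move=> [x y] /= [_ ->].
  rewrite product_measure2E//.
  suff -> : L [set 0] = 0%E by rewrite mule0.
  have [L0 _] := hL.
  apply/eqP; rewrite eq_le measure_ge0 andbT -L0.
  by apply: le_measure; rewrite ?inE// => _ ->; rewrite /= in_itv /=.
pose f (z : R * R) := Num.min 1 (z.1 ^+ 2 + z.2 ^+ 2).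
have mf : measurable_fun setT f.
  apply: measurable_minr => //.
  by apply: measurable_funD; apply: measurable_funX; [exact: measurable_fst|exact: measurable_snd].
have fb x s : 0 < s -> `|f (x * s, s)| <= 2 * 1 * ((1 + `|x|) * levy_weight s).
  have f0 : 0 <= f (x * s, s) by rewrite le_min ler01 addr_ge0// sqr_ge0.
  move=> s0; apply: jump_bound; rewrite ?(ger0_norm f0)// ?ge_min ?lexx// mul1r.
  have x0 := normr_ge0 x; have [//|/= h] := leP 1 ((1 + `|x|) * s).
  (* Here (x^2 + 1) s^2 is at most the square of (1 + |x|) s, which is below that number because it
     is at most 1. *)
  rewrite (@le_trans _ _ (((1 + `|x|) * s) ^+ 2))//; last first.
    have A0 : 0 <= (1 + `|x|) * s by rewrite mulr_ge0 ?addr_ge0// ltW.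
    by rewrite expr2 ler_piMr// ltW.
  rewrite !exprMn -(real_normK (num_real x)).
  by have := mulr_ge0 x0 (sqr_ge0 s); lra.
have [iPi _] := product_jump_Rintegral mf fb.
exact: (integrable_lty measurableT iPi).
Qed.

Let measurable_bool_indic (Q : R * R -> bool) : measurable [set z | Q z] ->
  measurable_fun setT (fun z => (Q z)%:R : R).
Proof.
move=> mQ; have := @measurable_indic _ _ R setT _ mQ; congr measurable_fun; apply/funext => z.
by rewrite indicE; congr (_%:R); congr nat_of_bool; apply/idP/idP; rewrite inE.
Qed.

(** The compensator in the exponent cancels against the disk integrals in b1 and b2. The remaining
    integrand is a plain sine, which |t1 x + t2| s dominates for small s, and Fubini's theorem gives
    [limit_Im]. *)
Lemma levy_exponent2_product_jump (alpha t1 t2 : R) :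
  levy_exponent2 (alpha * \int[F]_x x + \int[Pi]_(z in punctured_disk R) z.1)
    (alpha + \int[Pi]_(z in punctured_disk R) z.2) Pi t1 t2 =
  (limit_Re F L t1 t2 +i* limit_Im F L alpha t1 t2)%C.
Proof.
pose q (z : R * R) := t1 * z.1 + t2 * z.2.
pose H : set (R * R) := [set z | 0 < z.2].
pose u (z : R * R) := (0 < z.2)%R%:R : R.
pose r (z : R * R) := (z.1 ^+ 2 + z.2 ^+ 2 <= 1)%R%:R : R.
have mq : measurable_fun setT q by exact: measurable_lin2.
rewrite /levy_exponent2 (_ : (fun z => _ - _) = fun z => ((cos (q z) - 1) +i*
  (sin (q z) - q z * r z))%C); last by apply/funext => z; exact: levy_integrandE.
have mu_ : measurable_fun setT u.
  have mH : measurable H.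
    rewrite (_ : H = snd @^-1` `]0, +oo[); last first.
      by apply/seteqP; split => z; rewrite /H /= in_itv /= andbT.
    by rewrite -[X in measurable X]setTI; apply: measurable_snd => //; exact: measurable_itv.
  exact: measurable_bool_indic mH.
have mr : measurable_fun setT r.
  apply: measurable_bool_indic.
  rewrite (_ : mkset _ = (fun z : R * R => z.1 ^+ 2 + z.2 ^+ 2) @^-1` `]-oo, 1]); last first.
    by apply/seteqP; split => z; rewrite /= in_itv.
  rewrite -[X in measurable X]setTI.
  have m2 : measurable_fun setT (fun z : R * R => z.1 ^+ 2 + z.2 ^+ 2).
    by apply: measurable_funD; apply: measurable_funX; [exact: measurable_fst|exact: measurable_snd].
  by apply: m2 => //; exact: measurable_itv.
have qr z : `|q z * r z| <= `|t1| + `|t2|.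
  rewrite /r; have [z1|_] := leP (_ + _) 1; last by rewrite mulr0 normr0 addr_ge0.
  have h1 := sqr_ge0 z.1; have h2 := sqr_ge0 z.2.
  have a1 : `|z.1| <= 1 by rewrite -(@expr_le1 _ 2)// -normrX ger0_norm ?sqr_ge0//; lra.
  have a2 : `|z.2| <= 1 by rewrite -(@expr_le1 _ 2)// -normrX ger0_norm ?sqr_ge0//; lra.
  by rewrite mulr1 (le_trans (ler_normD _ _))// !normrM lerD// ler_piMr.
have u1 x s : 0 < s -> u (x * s, s) = 1 by rewrite /u /= => ->.
have qE x s : q (x * s, s) = (t1 * x + t2) * s by rewrite /q /=; ring.
have q_le x s : 0 < s -> `|q (x * s, s)| <= (`|t1| + `|t2|) * ((1 + `|x|) * s).
  move=> s0; rewrite qE normrM (gtr0_norm s0) mulrA ler_pM2r//.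
  rewrite (le_trans (ler_normD _ _))// normrM.
  by have := normr_ge0 t1; have := normr_ge0 t2; have := normr_ge0 x; nra.
have t0 : 0 <= `|t1| + `|t2| by rewrite addr_ge0.
pose fc z := (cos (q z) - 1) * u z; pose fs z := (sin (q z) - q z * r z) * u z.
have mfc : measurable_fun setT fc.
  by apply: measurable_funM => //; apply: measurable_funD => //; exact: measurable_cos.
have mfs : measurable_fun setT fs.
  apply: measurable_funM => //; apply: measurable_funB; first exact: measurable_sin.
  exact: measurable_funM.
have fcb x s : 0 < s -> `|fc (x * s, s)| <=
    2 * (2 + (`|t1| + `|t2|)) * ((1 + `|x|) * levy_weight s).
  move=> s0; apply: jump_bound => //; rewrite /fc u1// mulr1 distrC ger0_norm ?oneBcos_ge0//.
    by rewrite (le_trans (oneBcos_le2 _))// lerDl.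
  rewrite (le_trans (oneBcos_abs _))// (le_trans (q_le _ _ s0))// ler_wpM2r//.
    by rewrite mulr_ge0 ?addr_ge0// ltW.
  by rewrite lerDr.
have fsb x s : 0 < s -> `|fs (x * s, s)| <=
    2 * (2 + 2 * (`|t1| + `|t2|)) * ((1 + `|x|) * levy_weight s).
  move=> s0; have P0 : 0 <= (1 + `|x|) * s by rewrite mulr_ge0 ?addr_ge0// ltW.
  have r1 z : `|r z| <= 1 by rewrite /r; case: (z.1 ^+ 2 + _ <= 1); rewrite /= ?normr1 ?normr0.
  apply: jump_bound => //; rewrite /fs u1// mulr1 (le_trans (ler_normB _ _))//.
    by have := qr (x * s, s); have := sin_max (q (x * s, s)); lra.
  rewrite (@le_trans _ _ (`|q (x * s, s)| + `|q (x * s, s)|))//.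
    by rewrite lerD ?abs_sin_le// normrM ler_piMr.
  by have := q_le x s s0; nra.
have [ic ec] := product_jump_Rintegral mfc fcb.
have [is_ es] := product_jump_Rintegral mfs fsb.
have onH (f : R * R -> R) : \int[Pi]_(z in H) f z = \int[Pi]_z (f z * u z).
  rewrite Rintegral_mkcond; apply: eq_Rintegral => z _; rewrite /patch /u.
  have -> : (z \in H) = (0 < z.2) by apply/idP/idP; rewrite inE.
  by case: (0 < z.2); rewrite ?mulr1 ?mulr0.
have on_disk (f : R * R -> R) : \int[Pi]_(z in punctured_disk R) f z = \int[Pi]_z (f z * disk z).
  rewrite Rintegral_mkcond; apply: eq_Rintegral => z _; rewrite /patch.
  by case: (z \in _); rewrite ?mulr1 ?mulr0.
rewrite /cintegral !onH -/fc -/fs !on_disk.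
have eRe : \int[Pi]_z fc z = limit_Re F L t1 t2.
  rewrite ec; apply: eq_Rintegral => s; rewrite inE /= in_itv /= andbT => s0.
  rewrite -[X in _ * levy_weight X](gtr0_norm s0) (levy_kernel_weight _ _ iF kernel_kcos).
  by apply: eq_Rintegral => x _; rewrite (gtr0_norm s0) kcos_mul /fc u1// mulr1 qE.
pose G z := t1 * (z.1 * disk z) + t2 * (z.2 * disk z) + fs z.
have i1' := integrableZl measurableT t1 i1d; have i2' := integrableZl measurableT t2 i2d.
have eG : t1 * (\int[Pi]_z (z.1 * disk z)) + t2 * (\int[Pi]_z (z.2 * disk z)) + \int[Pi]_z fs z =
    levy_integral L (levy_kernel F ksin t1 t2).
  have -> : t1 * (\int[Pi]_z (z.1 * disk z)) + t2 * (\int[Pi]_z (z.2 * disk z)) +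
      \int[Pi]_z fs z = \int[Pi]_z G z.
    rewrite -!RintegralZl// -RintegralD// -RintegralD//.
    by have := integrableD measurableT i1' i2'.
  have mG : measurable_fun setT G.
    by apply: measurable_funD => //; apply: measurable_funD => //; exact: measurable_funM.
  have GE x s : 0 < s -> G (x * s, s) = sin (q (x * s, s)).
    move=> s0; rewrite /G /fs u1//= mulr1.
    (* The puncture at the origin is invisible because s > 0. *)
    have -> : disk (x * s, s) = r (x * s, s).
      rewrite /r; congr (_%:R); congr nat_of_bool; apply/idP/idP.
        by rewrite inE /punctured_disk /= => /andP[].
      move=> h; rewrite inE /punctured_disk /=; apply/andP; split => //.
      by rewrite ltr_wpDl ?sqr_ge0// exprn_gt0.
    by rewrite /q /=; ring.
  have Gb x s : 0 < s -> `|G (x * s, s)| <=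
      2 * (1 + (`|t1| + `|t2|)) * ((1 + `|x|) * levy_weight s).
    move=> s0; rewrite GE//; apply: jump_bound => //.
      by rewrite (le_trans (sin_max _))// lerDl.
    rewrite (le_trans (abs_sin_le _))// (le_trans (q_le _ _ s0))// ler_wpM2r//.
      by rewrite mulr_ge0 ?addr_ge0// ltW.
    by rewrite lerDr.
  have [_ ->] := product_jump_Rintegral mG Gb.
  apply: eq_Rintegral => s; rewrite inE /= in_itv /= andbT => s0.
  rewrite -[X in _ * levy_weight X](gtr0_norm s0) (levy_kernel_weight _ _ iF kernel_ksin).
  by apply: eq_Rintegral => x _; rewrite (gtr0_norm s0) ksin_mul GE// qE.
rewrite eRe /limit_Im -eG; simpc; congr (_ +i* _)%C; ring.
Qed.

End product_jump.

(** * Convergence tested on ultrafilters *)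

Lemma cvg_ultrafilters (T : Type) (E : topologicalType) (F : set_system T) {FF : ProperFilter F}
    (x : T -> E) (l : E) :
  (forall U : set_system T, UltraFilter U -> F `<=` U -> x @ U --> l) -> x @ F --> l.
Proof.
(* If the preimage of A is not in F, its complement B meets every set of F, so some ultrafilter
   contains both F and B, against convergence along it. *)
move=> h A lA; apply: contrapT => nA; pose B := ~` (x @^-1` A).
have FB : ProperFilter (within B F).
  split; last exact: within_filter.
  by rewrite /within /= => FB; apply: nA; apply: filterS FB => t Bt; exact: contrapT Bt.
have [U [UU FU]] := ultraFilterLemma FB.
have FsubU : F `<=` U by move=> S FS; apply: FU; rewrite /within /=; apply: filterS FS.
have UB : U B by apply: FU; rewrite /within /=; exact: nearW.
have UA : U (x @^-1` A) by exact: h lA.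
have PU : ProperFilter U by exact: ultra_proper.
by have := @filterI _ U (@filter_filter _ _ PU) _ _ UA UB; rewrite setICr; exact: filter_not_empty.
Qed.

(** * Laws on the plane and infinite divisibility *)

Section laws_on_plane.
Context (R : realType).

Lemma uniform_Rintegral (d : measure_display) (E : measurableType d) (V : R -> E) (f : E -> R) :
  measurable_fun setT V -> bmeas f ->
  \int[uniform_prob (@ltr01 R)]_w f (V w) = \int[lebesgue_measure]_(w in `[0, 1[) f (V w).
Proof.
move=> mV bf; have [mf [C fC]] := bf.
have mS : measurable_fun (`[0, 1[%classic : set R) V by exact: measurable_funS mV.
have b2 : bint (fun f : E -> R => \int[lebesgue_measure]_(w in `[0, 1[) f (V w)).
  have := @bint_Rintegral R _ _ _ _ (@lebesgue_measure R) `[0, 1[%classic V (fun=> 1)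
    (measurable_itv _) mS (integrable_itv_cst _ _ _).
  by congr bint; apply/funext => g; apply: eq_Rintegral => w _; rewrite mulr1.
apply: (bint_eq (bint_expectation (uniform_prob (@ltr01 R)) mV) b2 _ bf) => A mA.
have mg : measurable_fun setT (fun w => \1_A (V w) : R).
  by have [] := bmeas_comp mV (@bmeas_indic R _ E A mA).
rewrite Rintegral_itv_bndo_bndc; last first.
  have := @integrable_bmeasM R _ _ _ _ (@lebesgue_measure R) `[0, 1[%classic V (fun=> 1)
    (measurable_itv _) mS (integrable_itv_cst _ _ _) _ (@bmeas_indic R _ E A mA).
  by congr (_.-integrable _ _); apply/funext => w /=; rewrite mulr1.
rewrite /Rintegral integral_uniform//; last by apply/measurable_EFinP.
by rewrite subr0 invr1 mul1e.
Qed.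

Lemma char_fun2E (d : measure_display) (T : measurableType d) (P : probability T R)
    (V1 V2 : T -> R) t1 t2 : char_fun2 P V1 V2 t1 t2 =
  ((\int[P]_w cos (t1 * V1 w + t2 * V2 w)) +i* (\int[P]_w sin (t1 * V1 w + t2 * V2 w)))%C.
Proof. exact: char_funE. Qed.

Lemma char_fun2_Rintegral (d d' : measure_display) (T : measurableType d) (S : measurableType d')
    (P : probability T R) (Q : probability S R) (Z : T -> R * R) (Z' : S -> R * R) :
  measurable_fun setT Z -> measurable_fun setT Z' ->
  (forall t1 t2, char_fun2 P (fst \o Z) (snd \o Z) t1 t2 = char_fun2 Q (fst \o Z') (snd \o Z') t1 t2) ->
  forall f, bmeas f -> \int[P]_w f (Z w) = \int[Q]_w f (Z' w).
Proof.
move=> mZ mZ' h; apply: (fourier_unique2 (bint_expectation P mZ) (bint_expectation Q mZ')) => t1 t2.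
  by have := congr1 (@complex.Re R) (h t1 t2); rewrite !char_fun2E.
by have := congr1 (@complex.Im R) (h t1 t2); rewrite !char_fun2E.
Qed.

(** When the characteristic function is the m-th power of another one, m independent copies of the
    latter's variable have a sum with the right transform; Fourier uniqueness identifies its law. *)
Lemma infinitely_divisible2_roots (d : measure_display) (T : measurableType d)
    (P : probability T R) (V1 V2 : {RV P >-> R}) :
  (forall m, (0 < m)%N -> exists (d' : measure_display) (S : measurableType d')
    (Q : probability S R) (Z : S -> R * R), measurable_fun setT Z /\
    forall t1 t2, char_fun2 Q (fst \o Z) (snd \o Z) t1 t2 ^+ m = char_fun2 P V1 V2 t1 t2) ->
  infinitely_divisible2 P V1 V2.
Proof.
move=> h m m0; have [d' [S [Q [Z [mZ hZ]]]]] := h m m0.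
have [d'' [S' [Q' [Zs [mZs iZs indZs lawZs]]]]] := iid_copies_ord Q mZ m.
have m1 i : measurable_fun setT (fst \o Zs i) by exact: measurableT_comp measurable_fst (mZs i).
have m2 i : measurable_fun setT (snd \o Zs i) by exact: measurableT_comp measurable_snd (mZs i).
pose U (i : 'I_m) : {RV Q' >-> R} := mfun_Sub (mem_set (m1 i)).
pose V (i : 'I_m) : {RV Q' >-> R} := mfun_Sub (mem_set (m2 i)).
exists d'', S', Q', U, V.
have UV (i : 'I_m) : (fun w => (U i w, V i w)) = Zs i.
  by apply/funext => w; rewrite /U /V /=; case: (Zs i w).
split.
- by rewrite (_ : (fun i w => _) = fun i : 'I_m => Zs i)//; apply/funext => i; exact: UV.
- by move=> i j B mB; rewrite !UV !lawZs.
- have mV : measurable_fun setT (fun w => (V1 w, V2 w)) by exact: measurable_fun_pair.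
  have mS : measurable_fun setT (fun w => (\sum_(i < m) U i w, \sum_(i < m) V i w)).
    by apply: measurable_fun_pair; apply: measurable_sum.
  apply: Rintegral_same_law => // f bf.
  apply: (char_fun2_Rintegral mV mS _ bf) => t1 t2.
  rewrite -[LHS](hZ t1 t2).
  pose g (z : R * R) := cexp ('i%C * (t1 * z.1 + t2 * z.2)%:C%C).
  have bg (i : nat) : cbmeas ((fun _ => g) i).
    have mq := @measurable_lin2 R t1 t2.
    by split; rewrite /g; under eq_fun do rewrite cexp_i /=; [exact: bmeas_cos|exact: bmeas_sin].
  rewrite /char_fun2 (_ : (fun w => cexp _) = fun w => \prod_(i < m) g (Zs i w)); last first.
    apply/funext => w; rewrite /g -cexp_sum -mulr_sumr; congr (cexp (_ * _)).
    by rewrite -raddf_sum /= !mulr_sumr -big_split.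
  rewrite (cintegral_prod mZs iZs bg) -[m in LHS]card_ord -prodr_const; apply: eq_bigr => i _.
  have [b1 b2] := bg i; rewrite /cintegral.
  rewrite (same_law_Rintegral (mZs i) mZ (lawZs i (ltn_ord i)) b1).
  by rewrite (same_law_Rintegral (mZs i) mZ (lawZs i (ltn_ord i)) b2).
Qed.

End laws_on_plane.

(** * Block sizes and the proof of the limit theorem *)

Lemma divn_infty (R : realType) (F : set_system nat) {FF : Filter F} (n_ : nat -> nat) (m : nat) :
  (0 < m)%N -> ((n_ k)%:R : R) @[k --> F] --> +oo -> ((n_ k %/ m)%:R : R) @[k --> F] --> +oo.
Proof.
move=> m0 /cvgryPge h; apply/cvgryPge => A.
have mR : 0 < m%:R :> R by rewrite ltr0n.
have := h ((A + 1) * m%:R); apply: filterS => k hk.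
have : (n_ k)%:R <= ((n_ k %/ m)%:R + 1) * m%:R :> R.
  by rewrite natr1 -natrM ler_nat ltnW// ltn_ceil.
by move/(le_trans hk); rewrite ler_pM2r// lerD2r.
Qed.

Lemma divn_ratio (R : realType) (F : set_system nat) {FF : Filter F} (n_ : nat -> nat) (m : nat) :
  (0 < m)%N -> ((n_ k)%:R : R) @[k --> F] --> +oo ->
  (n_ k %/ m)%:R / (n_ k)%:R @[k --> F] --> (m%:R^-1 : R).
Proof.
move=> m0 h; have mR : 0 < m%:R :> R by rewrite ltr0n.
apply/cvgrPdist_le => e e0; have hh : \forall k \near F, 1 + e^-1 <= (n_ k)%:R by move/cvgryPge: h; exact.
move: hh; apply: filterS => k hk.
have ei : 0 < e^-1 by rewrite invr_gt0.
have n0 : 0 < (n_ k)%:R :> R by lra.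
have l1 : (n_ k %/ m)%:R * m%:R <= (n_ k)%:R :> R by rewrite -natrM ler_nat leq_divM.
have l2 : (n_ k)%:R <= ((n_ k %/ m)%:R + 1) * m%:R :> R.
  by rewrite natr1 -natrM ler_nat ltnW// ltn_ceil.
have -> : m%:R^-1 - (n_ k %/ m)%:R / (n_ k)%:R =
    ((n_ k)%:R - (n_ k %/ m)%:R * m%:R) / m%:R / (n_ k)%:R :> R by field; rewrite !gt_eqF.
rewrite ger0_norm ?divr_ge0 ?subr_ge0 ?(ltW mR) ?(ltW n0)//.
rewrite ler_pdivrMr//; apply: (@le_trans _ _ 1).
  by rewrite ler_pdivrMr// mul1r; lra.
by rewrite -(@ler_pM2l _ e^-1)// mulr1 mulrA mulVf ?gt_eqF// mul1r; lra.
Qed.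

Theorem theorem2 (R : realType)
  (* X and Y *)
  (d0 : measure_display) (T0 : measurableType d0) (P0 : probability T0 R)
  (X Y : {RV P0 >-> R})
  (hXY : independent P0 X Y)
  (hYpos : (0 < P0 [set w | (0 < Y w)%R])%E)
  (hYnneg : P0 [set w | 0 <= Y w] = 1%E)
  (hX : ('E_P0[fun w => `|X w|%R] < +oo)%E)
  (* i.i.d. copies of (X, Y) *)
  (d : measure_display) (T : measurableType d) (P : probability T R)
  (Xs Ys : nat -> {RV P >-> R})
  (hindep : mutually_independent P (fun i w => (Xs i w, Ys i w)))
  (hlaw : forall i, same_law P P0 (fun w => (Xs i w, Ys i w))
                                  (fun w => (X w, Y w)))
  (* the subsequence n_ 0 < n_ 1 < ... and the norming constants a (n_ k) *)
  (n_ : nat -> nat) (hn : {homo n_ : j k / (j < k)%N})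
  (a : nat -> R) (ha : forall k, 0 < a (n_ k))
  (hainf : a (n_ k) @[k --> \oo] --> +oo)
  (* the limit W2 *)
  (d2 : measure_display) (T2 : measurableType d2) (P2 : probability T2 R)
  (W2 : {RV P2 >-> R})
  (hW2 : forall w, 0 <= W2 w)
  (hW2id : infinitely_divisible P2 W2)
  (b : R) (Lambda : {measure set R -> \bar R})
  (hLambda : levy_measure_pos Lambda)
  (hLambda1 : (\int[Lambda]_(s in `]0%R, 1%R]) s%:E < +oo)%E)
  (hcf : forall u, char_fun P2 W2 u = cexp (levy_exponent b Lambda u))
  (hcvg : cvg_in_distribution P P2
     (fun k w => (\sum_(i < n_ k) Ys i w) / a (n_ k)) W2) :
  let alpha := b - \int[Lambda]_(x in `]0%R, 1%R]) x in
  let Pi : {measure set (R * R) -> \bar R} :=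
    product_jump_measure (distribution P0 X) Lambda in
  let b1 := alpha * fine 'E_P0[X] + \int[Pi]_(z in punctured_disk R) z.1 in
  let b2 := alpha + \int[Pi]_(z in punctured_disk R) z.2 in
  [/\ 0 <= alpha,
      levy_measure2 Pi,
      Pi.-integrable (punctured_disk R) (fun z => z.1%:E),
      Pi.-integrable (punctured_disk R) (fun z => z.2%:E) &
      exists (d3 : measure_display) (T3 : measurableType d3)
             (Q : probability T3 R) (V1 V2 : {RV Q >-> R}),
        [/\ infinitely_divisible2 Q V1 V2,
            forall t1 t2,
              char_fun2 Q V1 V2 t1 t2 = cexp (levy_exponent2 b1 b2 Pi t1 t2),
            same_law Q P2 V2 W2 &
            cvg_in_distribution P Q
              (fun k w => ((\sum_(i < n_ k) Xs i w * Ys i w) / a (n_ k),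
                           (\sum_(i < n_ k) Ys i w) / a (n_ k)))
              (fun w => (V1 w, V2 w))]].
Proof.
move=> alpha Pi b1 b2; pose F : probability R R := distribution P0 X; pose A k := a (n_ k).
have A0 k : 0 < A k by exact: ha.
have iF : F.-integrable setT (EFin \o (fun x : R => x)) by exact: integrable_distribution_id.
(* One ultrafilter is fixed to construct the limit pair; the others are compared with it at the
   end. *)
have [U [UU ooU]] := ultraFilterLemma (@eventually_filter : ProperFilter \oo).
have [alpha0 _] := array_limit ooU hXY hYnneg hX hindep hlaw hn A0 hW2 hLambda hLambda1 hcf hcvg.
have n_infty (V : set_system nat) : Filter V -> \oo `<=` V -> ((n_ k)%:R : R) @[k --> V] --> +oo.
  move=> FV ooV; apply: (@cvg_trans _ (((n_ k)%:R : R) @[k --> \oo])).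
    by move=> S; exact: ooV.
  have n_ge k : (k <= n_ k)%N by elim: k => // k ih; apply: (leq_ltn_trans ih); exact: hn.
  apply/cvgryPge => B; near=> k; rewrite (@le_trans _ _ k%:R) ?ler_nat//.
  by near: k; exact: nbhs_infty_ger.
pose Q : probability (measurableTypeR R) R := uniform_prob (@ltr01 R).
pose S k w := ((\sum_(i < n_ k) Xs i w * Ys i w) / A k, (\sum_(i < n_ k) Ys i w) / A k).
pose psi t1 t2 : R[i] := (limit_Re F Lambda t1 t2 +i* limit_Im F Lambda alpha t1 t2)%C.
(* Blocks of n_k %/ m summands give an m-th root of the limit law. For m = 1 the block is the whole
   sum, so the same statement yields the limit law itself. *)
have root (W : set_system nat) m : UltraFilter W -> \oo `<=` W -> (0 < m)%N ->
    exists V : R -> R * R, [/\ measurable_fun setT V,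
      forall t1 t2, char_fun2 Q (fst \o V) (snd \o V) t1 t2 ^+ m = cexp (psi t1 t2) &
      m = 1 -> forall f : R * R -> R, continuous f -> bounded_fun f ->
        \int[P]_w f (S k w) @[k --> W] --> \int[Q]_w f (V w)].
  move=> UW ooW m0; have hN k : (n_ k %/ m <= n_ k)%N by exact: leq_div.
  have PW : ProperFilter W by exact: ultra_proper.
  have nW := n_infty W (@filter_filter _ _ PW) ooW.
  have [V [mV lV cV sV]] := limit_law ooW hXY hYnneg hX hindep hlaw hn A0 hW2 hLambda hLambda1
    hcf hcvg hN (divn_infty m0 nW) (divn_ratio m0 nW).
  have mlin t1 t2 : bmeas (fun z : R * R => cos (t1 * z.1 + t2 * z.2)) /\
      bmeas (fun z : R * R => sin (t1 * z.1 + t2 * z.2)).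
    by split; [apply: bmeas_cos|apply: bmeas_sin]; exact: measurable_lin2.
  exists V; split => //.
  - move=> t1 t2; have [bc bs] := mlin t1 t2; rewrite char_fun2E /=.
    rewrite (uniform_Rintegral mV bc) (uniform_Rintegral mV bs) cV sV.
    have ReIm (z : R[i]) : (complex.Re z +i* complex.Im z)%C = z by case: z.
    by rewrite ReIm cexpX complexMn !mulrA mulfV ?mul1r// pnatr_eq0 -lt0n.
  - move=> m1 f cf bf; rewrite (uniform_Rintegral mV (bmeas_continuous2 cf bf)).
    apply: cvg_trans (lV f cf bf); apply: near_eq_cvg; apply: nearW => k /=.
    by rewrite m1 divn1.
have [V [mV cV lV]] := root U 1 UU ooU isT.
have mV1 : measurable_fun (setT : set (measurableTypeR R)) (fst \o V) by exact: measurableT_comp measurable_fst mV.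
have mV2 : measurable_fun (setT : set (measurableTypeR R)) (snd \o V) by exact: measurableT_comp measurable_snd mV.
have psiE t1 t2 : psi t1 t2 = levy_exponent2 b1 b2 Pi t1 t2.
  by rewrite /psi -(levy_exponent2_product_jump iF hLambda hLambda1) mean_distribution_id.
split => //.
- exact: product_jump_levy_measure2 iF hLambda hLambda1.
- exact: product_jump_integrable_fst iF hLambda hLambda1.
- exact: product_jump_integrable_snd iF hLambda hLambda1.
pose V1 : {RV Q >-> R} := @mfun_Sub _ _ (measurableTypeR R) _ (fst \o V) (mem_set mV1).
pose V2 : {RV Q >-> R} := @mfun_Sub _ _ (measurableTypeR R) _ (snd \o V) (mem_set mV2).
exists _, _, Q, V1, V2.
have charV t1 t2 : char_fun2 Q (fst \o V) (snd \o V) t1 t2 = cexp (psi t1 t2).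
  by rewrite -[RHS](cV t1 t2) expr1.
split.
- apply: infinitely_divisible2_roots => m m0.
  have [Vm [mVm cVm _]] := root U m UU ooU m0.
  by exists _, _, Q, Vm; split => // t1 t2; rewrite cVm -charV.
- by move=> t1 t2; rewrite -psiE -charV.
(* A zero first coordinate puts both variables in the plane, where the uniqueness theorem is
   stated. *)
- have m2 : measurable_fun setT (fun w => (0 : R, W2 w)) by exact: measurable_fun_pair.
  have m1 : measurable_fun (setT : set (measurableTypeR R)) (fun w => (0 : R, (V w).2)).
    by apply: measurable_fun_pair => //; exact: mV2.
  apply: Rintegral_same_law => // f bf.
  have bf2 : bmeas (fun z : R * R => f z.2).
    have [mf [C fC]] := bf; split; last by exists C => z; exact: fC.
    exact: (measurableT_comp mf measurable_snd).
  apply: (char_fun2_Rintegral (P := Q) m1 m2 _ bf2) => t1 t2.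
  transitivity (char_fun2 Q (fst \o V) (snd \o V) 0 t2).
    by congr cintegral; apply/funext => w /=; rewrite mulr0 mul0r.
  transitivity (char_fun P2 W2 t2); last first.
    by congr cintegral; apply/funext => w /=; rewrite mulr0 add0r.
  rewrite charV hcf; congr cexp; rewrite /psi /limit_Re /limit_Im.
  rewrite -(Re_levy_exponent Lambda iF b) mul0r add0r mulrC.
  by rewrite -(Im_levy_exponent hLambda hLambda1 iF) -/alpha; case: (levy_exponent _ _ _).
- move=> f cf bf; have bmf := bmeas_continuous2 cf bf.
  have mS k : measurable_fun setT (S k).
    apply: measurable_fun_pair; apply: measurable_funM => //.
      by apply: measurable_sum => i; exact: measurable_funM.
    exact: measurable_sum.
  have mVV : measurable_fun (setT : set (measurableTypeR R)) (fun w => ((V w).1, (V w).2)).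
    by apply: measurable_fun_pair; [exact: mV1|exact: mV2].
  rewrite (expectation_Rintegral Q (bmeas_comp mVV bmf)).
  under eq_fun do rewrite (expectation_Rintegral P (bmeas_comp (mS _) bmf)).
  apply: cvg_EFin; first exact: nearW.
  apply: cvg_ultrafilters => W UW ooW.
  have [V' [mV' cV' lV']] := root W 1 UW ooW isT.
  (* The limits along W and U have the same characteristic function exp psi, hence give f the same
     mean. *)
  rewrite (_ : \int[Q]_w _ = \int[Q]_w f (V' w)); first exact: lV'.
  apply: (char_fun2_Rintegral (P := Q) (Q := Q) mVV mV' _ bmf) => t1 t2.
  by rewrite -[RHS]expr1 cV' -charV.
Unshelve. all: by end_near. Qed.
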